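(* Let $\kappa\in\{2,3,\ldots\}$, let $\mathcal P$ be a Polish space, and let $(\mathcal M_n)_{n\ge0}$ be a $\kappa$-discrete $(\mathcal M_0,(\widetilde{\mathcal R}_x,x\in\mathcal P))$-measure-valued Pólya process, with $\widetilde{\mathcal R}_x=-\frac1\kappa\delta_x+\mathcal R_x$. Assume that there exists a pair of sequences $(a(n),b(n))_{n\ge0}$ such that: (a) the Markov chain with transition kernel $K(z,A)=\mathcal R_z(A)$ is $(a(n),b(n))_{n\ge0}$-ergodic, with limiting distribution $\gamma$; (b) there are two measurable functions $f:\mathbb R\to\mathcal P$ and $g$ (taking values in the set of scalars to which the $a(n)$ belong) such that, for every $x\in\mathbb R$ (almost every $x$ suffices) and every sequence $\varepsilon_n=o(\sqrt n)$, $$\frac{b(\lfloor n+x\sqrt n+\varepsilon_n\rfloor)-b(n)}{a(n)}\to f(x),\qquad \frac{a(\lfloor n+x\sqrt n+\varepsilon_n\rfloor)}{a(n)}\to g(x)\qquad (n\to\infty).$$ Then, for any finite measure $\mathcal M_0$ (of the form required of a $\kappa$-discrete process) such that $0<\mathcal M_0(\mathcal P)<+\infty$, $$\Theta_{a(\beta\log n),\,b(\beta\log n)}\left(n^{-1}\mathcal M_n\right)\longrightarrow\nu\quad\text{in probability as } n\to\infty,$$ for the topology of weak convergence on the space $\mathcal M(\mathcal P)$ of measures on $\mathcal P$, where $\beta=1+\frac1{\kappa-1}$ and $\nu$ is the distribution of $\Gamma g(\Lambda)+f(\Lambda)$, with $\Lambda$ a standard Gaussian random variable and $\Gamma\sim\gamma$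 independent of $\Lambda$.
   Context: $\kappa$-discrete measure-valued Pólya process: $\mathcal M_0=\frac1\kappa\sum_{y\in\mathcal P}w_y\delta_y$, where the $w_y$ are non-negative integers, all but finitely many equal to $0$; for every $x\in\mathcal P$, $\mathcal R_x=\frac1\kappa\sum_{y\in\mathcal P}r_{x,y}\delta_y$, where the $r_{x,y}$ are non-negative integers, for each $x$ all but finitely many equal to $0$, with $\sum_{y}r_{x,y}=\kappa$ (so $\mathcal R_x(\mathcal P)=1$); and $\widetilde{\mathcal R}_x=-\frac1\kappa\delta_x+\mathcal R_x$. The process $(\mathcal M_n)_{n\ge0}$ is the Markov chain of measures defined by: given $\mathcal M_n$, draw a random colour $C_n$ with law $\mathcal M_n/\mathcal M_n(\mathcal P)$, and, conditionally on $C_n=C$, set $\mathcal M_{n+1}=\mathcal M_n+\widetilde{\mathcal R}_C$. (The drawn ball, of weight $1/\kappa$, is removed from the urn.) A Markov chain $(X_n)$ is $(a(n),b(n))_{n\ge0}$-ergodic, with limiting distribution $\gamma$, if for every initial distribution of $X_0$ the sequence $(X_n-b(n))/a(n)$ converges in distribution to $\gamma$, where $\gamma$ does not depend on the initial distribution. For a measure $\mu$ on $\mathcal P$, a scalar $a$ and $b\in\mathcal P$, $\Theta_{a,b}(\mu)$ is the measure defined by $\int h\,d\Theta_{a,b}(\mu)=\int h(a^{-1}(x-b))\,d\mu(x)$ for all measurable functions $h$. Conventions on the operations: if $\mathcal P$ has no subtraction operation, the only allowed choice is $b\equiv0$, with $x-0:=x$; if $a(n)=1$ then $x/1:=x$.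 Otherwise the $a(n)$ belong to a set of scalars by which elements of $\mathcal P$ can be divided and whose quotients are well defined (typically $\mathcal P$ is a Banach space over $\mathbb R$ or $\mathbb C$ and the $a(n)$ are nonzero scalars). When $a\equiv1$ and $b\equiv0$, one has $g\equiv1$, $f\equiv0$, and $\Gamma g(\Lambda)+f(\Lambda)$ means $\Gamma$. For non-integer $t\ge0$, $a(t)$ and $b(t)$ are read as $a(\lfloor t\rfloor)$ and $b(\lfloor t\rfloor)$.
   Formalization: The limit is ((κ−1)/κ)ν instead of ν: each step adds mass 1−1/κ, so the total mass of n^{-1}M_n tends to (κ−1)/κ, while ν is a probability measure; the printed limit is therefore false (e.g. P a point, κ=2). *)

(* Defs.v *)
From HB Require Import structures.
From mathcomp Require Import all_boot all_order all_algebra.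
From mathcomp Require Import all_classical all_reals all_analysis.
From mathcomp Require Import measurable_realfun.

Set Implicit Arguments.
Unset Strict Implicit.
Unset Printing Implicit Defensive.
Import Order.TTheory GRing.Theory Num.Theory.
Import numFieldNormedType.Exports.

Local Open Scope classical_set_scope.
Local Open Scope ring_scope.

Definition separable (T : topologicalType) : Prop :=
  exists2 D : set T, countable D & dense D.

Definition completely_metrizable (R : realType) (T : topologicalType) : Prop :=
  exists dist : T -> T -> R,
    [/\ forall x y, dist x y = 0 <-> x = y,
        forall x y, dist x y = dist y x &
        forall x y z, dist x z <= dist x y + dist y z] /\
    [/\ forall x (A : set T), nbhs x A <->
          exists2 e : R, 0 < e & [set y | dist x y < e] `<=` A &
        forall u : nat -> T,
          (forall e : R, 0 < e -> exists N : nat, forall m n,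
            (N <= m)%N -> (N <= n)%N -> dist (u m) (u n) < e) ->
          exists l : T, u @ \oo --> l].

Definition polish (R : realType) (T : topologicalType) : Prop :=
  separable T /\ completely_metrizable R T.

Lemma polish_second_countable (R : realType) (T : topologicalType) :
  polish R T -> @second_countable T.
Proof.
move=> [[D cD dD] [dist [[d0 dC dT] [nE _]]]].
have dxx x : dist x x = 0 by exact/d0.
pose bl x (n : nat) : set T := [set y | dist x y < n.+1%:R^-1].
exists [set (bl p.1 p.2)° | p in D `*` [set: nat]].
  by apply: sub_countable (countableX cD (countableP _)); exact: card_image_le.
split; first by move=> _ [p _ <-]; exact: open_interior.
move=> x V /nE[e e0 eV].
pose e2 := e / 2; have e20 : 0 < e2 by rewrite divr_gt0.
pose n := (Num.truncn e2^-1).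
have ne : n.+1%:R^-1 < e2.
  by rewrite -[ltRHS]invrK ltf_pV2 ?posrE ?invr_gt0// truncnS_gt.
have n0 : (0 : R) < n.+1%:R^-1 by rewrite invr_gt0.
have bx : nbhs x (bl x n) by apply/nE; exists n.+1%:R^-1.
have [y [yx Dy]] : (bl x n)° `&` D !=set0.
  by apply: dD; [exists x | exact: open_interior].
have yx' : dist x y < n.+1%:R^-1 by exact: interior_subset yx.
exists (bl y n)°; first split.
- by exists (y, n).
- apply/nE; exists (n.+1%:R^-1 - dist x y); first by rewrite subr_gt0.
  move=> z /=; rewrite ltrBrDl; apply: le_lt_trans.
  by rewrite (dC x y); exact: dT.
- move=> z /interior_subset yz; apply: eV => /=.
  apply: le_lt_trans (dT x y z) _.
  by rewrite [e]splitr ltrD// (lt_trans _ ne).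
Qed.

Definition borel (T : ptopologicalType) := g_sigma_algebraType (@open T).
HB.instance Definition _ (T : ptopologicalType) :=
  Measurable.on (borel T).

(* Borel measurability of a map into a space that need not be pointed, hence
   need not carry the measurable structure above. *)
Definition borel_fun d (S : measurableType d) (T : topologicalType)
    (f : S -> T) : Prop :=
  forall U : set T, open U -> measurable (f @^-1` U).

Lemma borel_measurable_fun d (S : measurableType d) (T : ptopologicalType)
    (f : S -> borel T) :
  borel_fun (f : S -> T) -> measurable_fun setT f.
Proof.
move=> bf; apply: (@measurability _ _ S (borel T) setT f (@open T)) => //.
by move=> _ [U oU <-]; rewrite setTI; exact: bf.
Qed.

Section fscale.
Context d (T : measurableType d) (R : realType).
Variables (c : {nonneg R}) (mu : {finite_measure set T -> \bar R}).

Definition fscale : set T -> \bar R := mscale c mu.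

HB.instance Definition _ := Measure.on fscale.

Let fscale_fin : fin_num_fun fscale.
Proof.
by move=> A mA; rewrite /fscale /mscale fin_numM ?fin_num_measure.
Qed.

HB.instance Definition _ := @Measure_isFinite.Build _ _ _ fscale fscale_fin.

End fscale.

Section fimage.
Context d d' (T : measurableType d) (T' : measurableType d') (R : realType).
Variables (phi : T -> T') (mphi : measurable_fun setT phi)
  (mu : {finite_measure set T -> \bar R}).

Definition fimage of measurable_fun setT phi : set T' -> \bar R :=
  pushforward mu phi.

Let fimage0 : fimage mphi set0 = 0%E.
Proof. exact: measure0. Qed.

Let fimage_ge0 A : (0 <= fimage mphi A)%E.
Proof. exact: measure_ge0. Qed.

Let fimage_sigma_additive : semi_sigma_additive (fimage mphi).
Proof. exact: measure_semi_sigma_additive. Qed.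

HB.instance Definition _ := isMeasure.Build _ _ _ (fimage mphi)
  fimage0 fimage_ge0 fimage_sigma_additive.

Let fimage_fin : fin_num_fun (fimage mphi).
Proof.
move=> A mA; rewrite /fimage /pushforward fin_num_measure//.
by rewrite -[X in measurable X]setTI; exact: mphi.
Qed.

HB.instance Definition _ :=
  @Measure_isFinite.Build _ _ _ (fimage mphi) fimage_fin.

End fimage.

Section chain_law.
Context d (T : measurableType d) (R : realType) (K : R.-pker T ~> T).

Section step.
Variable mu : probability T R.

Definition chain_step (A : set T) : \bar R := (\int[mu]_x K x A)%E.

Let chain_step0 : chain_step set0 = 0%E.
Proof.
by rewrite /chain_step integral0_eq// => x _; rewrite measure0.
Qed.

Let chain_step_ge0 A : (0 <= chain_step A)%E.
Proof. exact: integral_ge0. Qed.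

Let chain_step_sigma_additive : semi_sigma_additive chain_step.
Proof.
move=> U mU tU mUU; rewrite [X in _ --> X](_ : _ =
  \int[mu]_x (\sum_(n <oo) K x (U n)))%E; last first.
  by apply: eq_integral => V _; apply/esym/cvg_lim => //;
    exact/measure_semi_sigma_additive.
apply/cvg_closeP; split.
  by apply: is_cvg_nneseries => n _ _; exact: integral_ge0.
rewrite closeE// integral_nneseries// => n.
exact: measurable_kernel.
Qed.

HB.instance Definition _ := isMeasure.Build _ _ _ chain_step
  chain_step0 chain_step_ge0 chain_step_sigma_additive.

Let chain_stepT : chain_step setT = 1%E.
Proof.
rewrite /chain_step (eq_integral (cst 1%E)) => [|x _]; last first.
  exact: prob_kernel.
rewrite integral_cst// mul1e; exact: probability_setT.
Qed.

HB.instance Definition _ :=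
  Measure_isProbability.Build _ _ _ chain_step chain_stepT.

End step.

(* The law of X_n for a Markov chain X with kernel K and X_0 of law mu. *)
Fixpoint chain_law (mu : probability T R) (n : nat) : probability T R :=
  if n is m.+1 then chain_step (chain_law mu m) else mu.

End chain_law.

Section weak_topology_of_measures.
Context (R : realType) (P : ptopologicalType).

Definition fmeas : Type := {finite_measure set (borel P) -> \bar R}.

HB.instance Definition _ := gen_eqMixin fmeas.
HB.instance Definition _ := gen_choiceMixin fmeas.

Definition bounded_continuous : Type :=
  {h : P -> R | continuous h /\ exists c : R, forall x, `|h x| <= c}.

Definition integrals (mu : fmeas) : {ptws bounded_continuous -> R} :=
  fun h => \int[mu]_(x in [set: borel P]) (sval h x).

(* The space of finite measures with the topology of weak convergence: the
   coarsest one making mu |-> \int h dmu continuous for every bounded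
   continuous h. *)
Definition measures : topologicalType := initial_topology integrals.

End weak_topology_of_measures.

(* Convergence in probability to a constant of a topological space. The inner
   approximation by events E n avoids evaluating Pr at the sets {X_n \in U}
   when these are not known to be measurable. *)
Definition cvg_in_probability d (Omega : measurableType d) (R : realType)
    (Pr : probability Omega R) (T : topologicalType)
    (X : nat -> Omega -> T) (l : T) : Prop :=
  forall U : set T, nbhs l U ->
    exists2 E : nat -> set Omega,
      (forall n, measurable (E n) /\ E n `<=` [set w | U (X n w)]) &
      (fun n => Pr (E n)) @ \oo --> (1%:E : \bar R).

#[short(type="scalarType")]
HB.structure Definition Scalar := {S of Group S & Topological S}.

(* The operations used to normalise elements of P: an abelian group [scalars]
   and an additive group [shifts] of allowed translations, both acting on P,
   scalars also acting on shifts. A Polish space without any operation is the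
   case of two trivial groups, where a = 1, b = 0, g = 1 and f = 0 are forced
   (see [plain_affine]); a separable normed space V is the case where [shifts]
   is V and [scalars] is the nonzero elements of the base field (see
   [normed_affine]). Spaces with only a subtraction, or only a multiplication
   by scalars, are obtained by taking one of the two groups trivial. *)
Record affine_structure (P : topologicalType) := AffineStructure {
  scalars : scalarType;
  shifts : topologicalZmodType;
  scale : scalars -> P -> P;
  sscale : scalars -> shifts -> shifts;
  translate : P -> shifts -> P;
  scalC : forall s t : scalars, (s * t = t * s)%g;
  scale1 : forall x, scale 1%g x = x;
  scaleM : forall s t x, scale (s * t)%g x = scale s (scale t x);
  sscale1 : forall v, sscale 1%g v = v;
  sscaleM : forall s t v, sscale (s * t)%g v = sscale s (sscale t v);
  sscaleD : forall s u v, sscale s (u + v) = sscale s u + sscale s v;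
  translate0 : forall x, translate x 0 = x;
  translateD : forall x u v, translate x (u + v) = translate (translate x u) v;
  scale_translate : forall s x v,
    scale s (translate x v) = translate (scale s x) (sscale s v);
  affine_continuous :
    continuous (fun p : scalars * P * shifts =>
      translate (scale p.1.1 p.1.2) p.2);
  scalars_countable : @second_countable scalars;
  shifts_countable : @second_countable shifts
}.
Arguments scale {P a}.
Arguments sscale {P a}.
Arguments translate {P a}.

Definition one_point : Type := unit.

HB.instance Definition _ := Choice.copy one_point (discrete_topology unit).
HB.instance Definition _ := Topological.copy one_point (discrete_topology unit).

Section one_point_group.
Let mul (_ _ : one_point) : one_point := tt.
Let inv (_ : one_point) : one_point := tt.
Let one : one_point := tt.

Let mulA : associative mul. Proof. by []. Qed.
Let mulC : commutative mul. Proof. by []. Qed.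
Let idl : left_id one mul. Proof. by case. Qed.
Let idr : right_id one mul. Proof. by case. Qed.
Let invl : left_inverse one inv mul. Proof. by []. Qed.
Let invr : right_inverse one inv mul. Proof. by []. Qed.

HB.instance Definition _ := isGroup.Build one_point mulA idl idr invl invr.
HB.instance Definition _ := GRing.isZmodule.Build one_point mulA mulC idl invl.
End one_point_group.

Lemma one_point_sub_continuous :
  continuous (fun x : one_point * one_point => x.1 - x.2).
Proof. by move=> x; exact: cvg_cst. Qed.

HB.instance Definition _ :=
  PreTopologicalNmodule_isTopologicalZmodule.Build one_point
    one_point_sub_continuous.

Lemma one_point_second_countable : @second_countable one_point.
Proof.
exists [set setT]; first exact: countable1.
split; first by move=> _ ->; exact: openT.
move=> x V /nbhs_singleton Vx; exists setT => //.
by move=> y _; case: x Vx; case: y.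
Qed.

Definition plain_affine (P : topologicalType) : affine_structure P.
Proof.
refine (@AffineStructure P one_point one_point (fun _ x => x) (fun _ v => v)
  (fun x _ => x) _ _ _ _ _ _ _ _ _ _
  one_point_second_countable one_point_second_countable) => //.
move=> p; apply: (@cvg_comp _ _ _ fst snd); [exact: cvg_fst|exact: cvg_snd].
Defined.

Definition nonzero (K : fieldType) : Type := {x : K | x != 0}.

HB.instance Definition _ (K : fieldType) := Choice.on (nonzero K).

Section nonzero_group.
Variable K : fieldType.

Let mul (s t : nonzero K) : nonzero K :=
  exist _ (\val s * \val t) (mulf_neq0 (valP s) (valP t)).
Let inv (s : nonzero K) : nonzero K :=
  exist _ (\val s)^-1 (etrans (congr1 negb (invr_eq0 (\val s))) (valP s)).
Let one : nonzero K := exist _ 1 (oner_neq0 K).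

Let mulA : associative mul.
Proof. by move=> x y z; apply: val_inj; exact: mulrA. Qed.
Let idl : left_id one mul.
Proof. by move=> x; apply: val_inj; exact: mul1r. Qed.
Let idr : right_id one mul.
Proof. by move=> x; apply: val_inj; exact: mulr1. Qed.
Let invl : left_inverse one inv mul.
Proof. by move=> x; apply: val_inj; exact: mulVf (valP x). Qed.
Let invr : right_inverse one inv mul.
Proof. by move=> x; apply: val_inj; exact: mulfV (valP x). Qed.

HB.instance Definition _ := isGroup.Build (nonzero K) mulA idl idr invl invr.
End nonzero_group.

HB.instance Definition _ (K : numFieldType) :=
  Topological.copy (nonzero K) (initial_topology (val : nonzero K -> K)).

Lemma initial_second_countable (S : choiceType) (T : topologicalType)
    (f : S -> T) :
  @second_countable T -> @second_countable (initial_topology f).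
Proof.
move=> [B cB [oB bB]]; exists [set f @^-1` A | A in B].
  by apply: sub_countable cB; exact: card_image_le.
split=> [_ [A BA <-]|x V]; first by exists A => //; exact: oB.
move=> [_ [[A oA <-] Ax AV]].
have [C [BC Cx] CA] : filter_from [set U | B U /\ U (f x)] id A.
  by apply: bB; apply: open_nbhs_nbhs.
exists (f @^-1` C) => /=; first by split=> //; exists C.
by move=> y Cy; apply: AV; exact: CA.
Qed.

Definition normed_affine (K : numFieldType) (V : normedModType K)
  (cK : @second_countable K) (cV : @second_countable V) : affine_structure V.
Proof.
refine (@AffineStructure V (nonzero K) V
  (fun s x => \val s *: x) (fun s x => \val s *: x) +%R
  _ _ _ _ _ _ _ _ _ _ (initial_second_countable _ cK) cV).
- by move=> s t; apply: val_inj; exact: mulrC.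
- by move=> x; exact: scale1r.
- by move=> s t x; rewrite scalerA.
- by move=> x; exact: scale1r.
- by move=> s t x; rewrite scalerA.
- by move=> s u v; rewrite scalerDr.
- by move=> x; exact: addr0.
- by move=> x u v; rewrite addrA.
- by move=> s x v; rewrite scalerDr.
- move=> p; apply: cvgD; last exact: cvg_snd.
  apply: cvgZ.
  + apply: (@cvg_comp _ _ _ (fun q : nonzero K * V * V => q.1.1) val);
      last exact: initial_continuous.
    by apply: (@cvg_comp _ _ _ fst fst); [exact: cvg_fst|exact: cvg_fst].
  + by apply: (@cvg_comp _ _ _ fst snd); [exact: cvg_fst|exact: cvg_snd].
Defined.

Section normalisation.
Context (R : realType) (P : ptopologicalType) (A : affine_structure P).

(* a^-1 (x - b) *)
Definition rescale (a : scalars A) (b : shifts A) (x : P) : P :=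
  scale a^-1%g (translate x (- b)).

Lemma measurable_rescale (a : scalars A) (b : shifts A) :
  measurable_fun setT (rescale a b : borel P -> borel P).
Proof.
apply: borel_measurable_fun => U oU.
apply: sub_sigma_algebra.
suff : continuous (rescale a b) by move/continuousP; exact.
have -> : rescale a b = (fun p : scalars A * P * shifts A =>
    translate (scale p.1.1 p.1.2) p.2) \o
    (fun x => ((a^-1)%g, x, sscale a^-1%g (- b))).
  by apply/funext => x; rewrite /rescale scale_translate.
move=> x; apply: cvg_comp; last exact: affine_continuous.
apply: (@cvg_pair _ _ _ _ (nbhs (a^-1%g, x)) (nbhs (sscale a^-1%g (- b)))
    _ _ _ (fun y => (a^-1%g, y)) (fun=> sscale a^-1%g (- b))); last exact: cvg_cst.
apply: (@cvg_pair _ _ _ _ (nbhs a^-1%g) (nbhs x) _ _ _ (fun=> a^-1%g) id).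
- exact: cvg_cst.
- exact: cvg_id.
Qed.

Definition Theta (a : scalars A) (b : shifts A) (mu : fmeas R P) : fmeas R P :=
  fimage mu (measurable_rescale a b).

Definition ergodic (K : R.-pker borel P ~> borel P)
    (a : nat -> scalars A) (b : nat -> shifts A)
    (gamma : probability (borel P) R) : Prop :=
  forall mu0 : probability (borel P) R,
    (fun n => Theta (a n) (b n) (chain_law K mu0 n) : measures R P)
      @ \oo --> (gamma : measures R P).

Lemma measurable_recombine (f : R -> shifts A) (g : R -> scalars A) :
  polish R P -> borel_fun f -> borel_fun g ->
  measurable_fun setT (fun p : borel P * R =>
    translate (scale (g p.2) p.1) (f p.2) : borel P).
Proof.
move=> /polish_second_countable[B2 cB2 [oB2 bB2]] mf mg.
have [B1 cB1 [oB1 bB1]] := @scalars_countable _ A.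
have [B3 cB3 [oB3 bB3]] := @shifts_countable _ A.
apply: borel_measurable_fun => U oU.
pose phi (p : scalars A * P * shifts A) := translate (scale p.1.1 p.1.2) p.2.
pose I := [set q : set (scalars A) * set P * set (shifts A) |
  [/\ B1 q.1.1, B2 q.1.2, B3 q.2 & q.1.1 `*` q.1.2 `*` q.2 `<=` phi @^-1` U]].
rewrite [X in measurable X](_ : _ = \bigcup_(q in I)
  ((fst @^-1` (q.1.2 : set (borel P))) `&`
   (snd @^-1` ((g @^-1` q.1.1) `&` (f @^-1` q.2))))); last first.
  apply/seteqP; split => [[y x] /= Uyx|[y x] [q [_ _ _ qU] [/= q2 [q1 q3]]]].
    have : nbhs (g x, y, f x) (phi @^-1` U).
      by apply: (@affine_continuous _ A (g x, y, f x));
        exact: open_nbhs_nbhs.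
    move=> [[V W]] /= [[[V1 V2] /= [nV1 nV2] sV]] nW sVW.
    have [C1 [BC1 gC1] CV1] := bB1 _ _ nV1.
    have [C2 [BC2 yC2] CV2] := bB2 _ _ nV2.
    have [C3 [BC3 fC3] CV3] := bB3 _ _ nW.
    exists (C1, C2, C3) => //; split => //= -[[s z] v] [[/= C1s C2z] C3v].
    apply: (sVW (s, z, v)); split => /=; last exact: CV3.
    by apply: sV; split => /=; [exact: CV1|exact: CV2].
  exact: (qU (g x, y, f x)).
have cI : countable I.
  apply: (@sub_countable _ _ _ (B1 `*` B2 `*` B3)).
    by apply: subset_card_le => q [].
  by apply: countableX => //; exact: countableX.
rewrite bigcup_set_type; apply: countable_bigcupT_measurable.
  by apply: sub_countable cI; rewrite (card_le_eql (card_setT I)).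
move=> [q /= /set_mem[B1q B2q B3q _]].
apply: measurableI.
  rewrite -[X in measurable X]setTI; apply: measurable_fst => //.
  by apply: sub_sigma_algebra; exact: oB2.
rewrite -[X in measurable X]setTI; apply: measurable_snd => //.
by apply: measurableI; [apply: mg; exact: oB1|apply: mf; exact: oB3].
Qed.

Definition standard_gaussian : probability (measurableTypeR R) R :=
  normal_prob 0 1.

(* The law of Gamma g(Lambda) + f(Lambda) for independent Gamma ~ gamma and
   Lambda ~ N(0, 1). *)
Definition mixture_law (hP : polish R P) (f : R -> shifts A) (g : R -> scalars A)
    (mf : borel_fun f) (mg : borel_fun g) (gamma : probability (borel P) R) :
    fmeas R P :=
  fimage ((gamma \x standard_gaussian)%E : probability _ R)
    (measurable_recombine hP mf mg).

End normalisation.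

Section urn.
Context (R : realType) (P : ptopologicalType).
Variable kappa : nat.

(* kappa^-1 \sum_y w_y delta_y; the sum over P is a finite one because w is
   required to have finite support. *)
Definition balls (w : P -> nat) (A : set (borel P)) : \bar R :=
  ((kappa%:R^-1 : R)%:E *
    \sum_(y \in [set: P]) (((w y)%:R : R)%:E * \d_(y : borel P) A))%E.

Definition discrete (mu : set (borel P) -> \bar R) : Prop :=
  exists w : P -> nat, finite_set [set y | w y != 0%N] /\
    forall A, measurable A -> mu A = balls w A.

Definition discrete_replacement (mu : set (borel P) -> \bar R) : Prop :=
  exists r : P -> nat,
    [/\ finite_set [set y | r y != 0%N],
        \big[addn/0%N]_(y \in [set: P]) r y = kappa &
        forall A, measurable A -> mu A = balls r A].

Variable Rep : R.-pker borel P ~> borel P.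

Definition signed_replacement (x : borel P) (A : set (borel P)) : \bar R :=
  (- ((kappa%:R^-1 : R)%:E * \d_x A) + Rep x A)%E.

Section process.
Context d (Omega : measurableType d) (M : nat -> Omega -> fmeas R P).

(* sigma(M_0, ..., M_n), for the sigma-algebra on measures generated by the
   evaluations at Borel sets. *)
Definition history (n : nat) : set (set Omega) :=
  <<s [set E | exists i (A : set (borel P)) (Y : set (\bar R)),
         [/\ (i <= n)%N, measurable A, measurable Y &
             E = (fun w => M i w A) @^-1` Y]] >>.

Record discrete_mvpp (Pr : probability Omega R) (C : nat -> Omega -> borel P)
    (M0 : fmeas R P) : Prop := DiscreteMvpp {
  mvpp_initial_discrete : discrete M0;
  mvpp_replacement_discrete : forall x, discrete_replacement (Rep x);
  mvpp_measurable : forall n (A : set (borel P)), measurable A ->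
    measurable_fun setT (fun w => M n w A);
  mvpp_colour_measurable : forall n, measurable_fun setT (C n);
  mvpp_initial : \forall w \ae Pr,
    forall A : set (borel P), measurable A -> M 0%N w A = M0 A;
  (* the conditional law of C_n given M_0, ..., M_n is M_n / M_n(P) *)
  mvpp_draw : forall n (E : set Omega) (A : set (borel P)),
    history n E -> measurable A ->
    Pr (E `&` C n @^-1` A) =
      (\int[Pr]_(w in E) (fine (M n w A) / fine (M n w setT))%:E)%E;
  mvpp_step : forall n, \forall w \ae Pr,
    forall A : set (borel P), measurable A ->
      M n.+1 w A = (M n w A + signed_replacement (C n w) A)%E
}.

End process.
End urn.

(* Scaling regularity of (a, b) at the scale sqrt n. The index
   n + x sqrt n + eps n is eventually nonnegative, so that truncn is then the
   integer part. *)
Definition sqrt_regular (R : realType) (P : ptopologicalType)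
    (A : affine_structure P) (a : nat -> scalars A) (b : nat -> shifts A)
    (f : R -> shifts A) (g : R -> scalars A) : Prop :=
  \forall x \ae (@lebesgue_measure R), forall eps : nat -> R,
    eps =o_\oo (fun n : nat => Num.sqrt n%:R : R) ->
    let k n := Num.truncn (n%:R + x * Num.sqrt n%:R + eps n) in
    (fun n => sscale (a n)^-1%g (b (k n) - b n)) @ \oo --> f x /\
    (fun n => (a (k n) * (a n)^-1)%g) @ \oo --> g x.

(* Each step adds mass 1 - kappa^-1 = (beta kappa)^-1, hence M_n(P) ~ n / beta;
   beta is also the growth rate of the depth of a typical ball in log n. *)
Definition beta (R : realType) (kappa : nat) : R := 1 + (kappa%:R - 1)^-1.

(* Main.v *)
Require Import Defs.
From HB Require Import structures.
From mathcomp Require Import all_boot all_order all_algebra.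
From mathcomp Require Import all_classical all_reals all_analysis.
From mathcomp Require Import measurable_realfun ring lra.
Set Implicit Arguments.
Unset Strict Implicit.
Unset Printing Implicit Defensive.
Import Order.TTheory GRing.Theory Num.Theory.
Import numFieldNormedType.Exports.
Local Open Scope classical_set_scope.
Local Open Scope ring_scope.

(** Fix a bounded continuous [h] and put c = E h(Gamma g(Lambda) + f(Lambda)).
    The total mass s_n = M_n(P) = s_0 + n (1 - 1/kappa) is deterministic and
    s_n / n tends to (kappa - 1)/kappa. With t = floor(beta log n) and obs the
    function y |-> h((y - b(t)) / a(t)), it has to be shown that M_n(obs - c)
    is o(s_n) in probability.

    Ancestral lines. Choose a ball of the urn uniformly at time i + 1. With
    probability 1/s_{i+1} it was added at that step, and then its colour has
    law R_x, where x is the colour of a uniform ball at time i; otherwise it is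
    itself a uniform ball of time i. Going back in time, the colour of a uniform
    ball at time n is thus the state of the Markov chain of kernel R after a
    number of steps that is a sum of independent Bernoulli variables of
    parameters 1/s_j. For i <= n let L_{i,n}(x) be the mean of obs for the
    chain started at x and run for such a sum over i < j <= n ([lineage]). The
    recursion for L says exactly that (s_n / s_i) M_i(L_{i,n} - c) is, for
    fixed n, a martingale in i, from time 0 to the quantity M_n(obs - c) of
    interest.

    Second moments. The increment of this martingale at step i is s_n times a
    quantity that is O(1/s_{i+1}) uniformly and that, for fixed i, tends to 0
    with n as soon as L_{i,n} tends to c pointwise: up to any fixed time only
    finitely many colours can occur. Since the 1/s_i^2 are summable, the second
    moment of M_n(obs - c) is o(s_n^2): the steps before a fixed time J
    contribute o(s_n^2), the others at most s_n^2 times the tail of the series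
    ([second_moment_step], [concentration]). Chebyshev's inequality concludes.

    Convergence of L_{i,n} ([lineage_mean_cvg]). By Le Cam's inequality
    ([bern_sum_pois_tv]) the number of steps is within O(1/s_i) in total
    variation of a Poisson variable of mean beta (log s_n - log s_i), which
    stays at bounded distance from t. A lineage started at i is first followed
    up to a large time J, which makes the error O(1/s_J). Under the Poisson law
    the weight of t + x sqrt(t), relative to that of t, tends to exp(-x^2/2)
    and is dominated by a multiple of exp(-|x|) ([pois_local_cvg],
    [pois_dominated]). Along k = t + x sqrt(t) the ergodicity of the chain and
    the regularity of a and b give that the mean of obs after k steps tends to
    E h(Gamma g(x) + f(x)), by a Slutsky argument ([slutsky_integral],
    [observable_path_cvg]). Dominated convergence for step functions then turns
    Poisson averages into Gaussian integrals ([pois_sum_cvg0]); comparing with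
    the constant function 1 dispenses with the normalising constant of the
    local limit theorem. *)

(** * Sums of Bernoulli variables and the Poisson law *)

Section bernoulli_sums.
Context {R : realType}.
Implicit Types (f g u : nat -> R) (p m l : R) (ps : seq R).

Definition conv f g k : R := \sum_(j < k.+1) f j * g (k - j)%N.

Definition bern p k : R := if k is k'.+1 then (k' == 0)%:R * p else 1 - p.

Definition bern_sum ps : nat -> R :=
  foldr (fun p g => conv (bern p) g) (fun k => (k == 0)%:R) ps.

Definition pois l k : R := expR (- l) * l ^+ k / k`!%:R.

(** The expectation of [u] at a sum of independent Bernoulli variables of
    parameters [ps], computed by conditioning on one variable at a time: this
    is the form in which one step of the urn acts on a lineage. *)
Fixpoint mix ps u : R :=
  if ps is p :: ps' then (1 - p) * mix ps' u + p * mix ps' (u \o succn)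
  else u 0%N.

(** The l^1 norm is submultiplicative under convolution; truncated sums suffice
    because [conv f g k] with [k < N] involves only indices below [N]. *)
Lemma conv_norm_sum_le f g N :
  \sum_(k < N) `|conv f g k| <= (\sum_(k < N) `|f k|) * (\sum_(k < N) `|g k|).
Proof.
apply: (@le_trans _ _ (\sum_(k < N) \sum_(j < k.+1) `|f j| * `|g (k - j)%N|)).
  apply: ler_sum => k _; apply: le_trans (ler_norm_sum _ _ _) _.
  by apply: ler_sum => j _; rewrite normrM.
have -> : \sum_(k < N) \sum_(j < k.+1) `|f j| * `|g (k - j)%N| =
  \sum_(k < N) \sum_(j < N | (j < k.+1)%N) `|f j| * `|g (k - j)%N|.
  apply: eq_bigr => k _.
  by rewrite (big_ord_widen N (fun j => `|f j| * `|g (k - j)%N|)).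
rewrite (exchange_big_dep xpredT)//= mulr_suml; apply: ler_sum => j _.
rewrite -mulr_sumr ler_wpM2l//.
rewrite -(big_mkord (fun k => j < k.+1)%N (fun k => `|g (k - j)%N|)).
rewrite -(big_mkord xpredT (fun k => `|g k|)).
rewrite (@big_cat_nat _ _ _ j)//= ?(ltnW (ltn_ord j))//.
rewrite big_nat_cond big_pred0 ?add0r; last first.
  by move=> i; apply/negP => /andP[/andP[_ ij]]; rewrite ltnS leqNgt ij.
rewrite big_nat_cond (eq_bigl (fun i => (j <= i < N)%N && true)); last first.
  by move=> i; rewrite ltnS andbT; case: (j <= i)%N; rewrite ?andbT ?andbF.
rewrite -big_nat_cond -{1}[nat_of_ord j]add0n big_addn.
under eq_bigr do rewrite addnK.
rewrite [leRHS](@big_cat_nat _ _ _ (N - j))//= ?leq_subr//.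
by rewrite lerDl; exact: sumr_ge0.
Qed.

Lemma convBl f1 f2 g k : conv (f1 \- f2) g k = conv f1 g k - conv f2 g k.
Proof. by rewrite /conv -sumrB; apply: eq_bigr => j _; rewrite mulrBl. Qed.

Lemma convBr f g1 g2 k : conv f (g1 \- g2) k = conv f g1 k - conv f g2 k.
Proof. by rewrite /conv -sumrB; apply: eq_bigr => j _; rewrite mulrBr. Qed.

Lemma conv_bern0 p g : conv (bern p) g 0 = (1 - p) * g 0%N.
Proof. by rewrite /conv big_ord1. Qed.

Lemma conv_bernS p g k : conv (bern p) g k.+1 = (1 - p) * g k.+1 + p * g k.
Proof.
rewrite /conv big_ord_recl /= subn0 big_ord_recl /= mul1r subSS subn0.
by rewrite big1 ?addr0// => i _; rewrite !mul0r.
Qed.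

Lemma mixE ps u N : (size ps < N)%N ->
  mix ps u = \sum_(k < N) bern_sum ps k * u k.
Proof.
elim: ps N u => [|p ps IH] [|N]//= u sN.
  rewrite big_ord_recl /= mul1r big1 ?addr0// => i _.
  by rewrite mul0r.
rewrite (IH N.+1 u) ?(ltnW sN)// (IH N (u \o succn))//.
rewrite !big_ord_recl /= conv_bern0.
under [in RHS]eq_bigr do rewrite /bump /= add1n conv_bernS mulrDl.
rewrite big_split /= mulrDr mulr_sumr -!addrA; congr (_ + _); first by rewrite mulrA.
congr (_ + _).
  by apply: eq_bigr => i _; rewrite mulrA.
rewrite mulr_sumr; apply: eq_bigr => i _.
by rewrite mulrA.
Qed.

Lemma mix_cst ps (c : R) : mix ps (fun=> c) = c.
Proof.
by elim: ps => //= p ps; rewrite /comp /= => ->; rewrite mulrBl mul1r subrK.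
Qed.

Lemma mixB ps u v : mix ps (u \- v) = mix ps u - mix ps v.
Proof.
elim: ps u v => //= p ps IH u v; rewrite IH.
have -> : (u \- v) \o succn = (u \o succn) \- (v \o succn) by [].
by rewrite IH; ring.
Qed.

Definition is_prob_seq ps := forall p, p \in ps -> 0 <= p <= 1.

Lemma mix_norm_le ps u (B : R) : is_prob_seq ps ->
  (forall k, `|u k| <= B) -> `|mix ps u| <= B.
Proof.
elim: ps u => [|p ps IH] u //= psP uB.
have /andP[p0 p1] := psP p (mem_head _ _).
have psP' : is_prob_seq ps by move=> q qps; apply: psP; rewrite in_cons qps orbT.
apply: le_trans (ler_normD _ _) _; rewrite !normrM.
rewrite (@ger0_norm _ (1 - p)) ?subr_ge0// (@ger0_norm _ p)//.
rewrite [leRHS](_ : B = (1 - p) * B + p * B); last by ring.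
by apply: lerD; apply: ler_wpM2l; rewrite ?subr_ge0// IH// => k; exact: uB.
Qed.

Lemma bern_norm_sum_le1 p N : 0 <= p <= 1 -> \sum_(k < N) `|bern p k| <= 1.
Proof.
move=> /andP[p0 p1]; case: N => [|N]; first by rewrite big_ord0.
rewrite big_ord_recl /= ger0_norm ?subr_ge0//.
case: N => [|N]; first by rewrite big_ord0; lra.
rewrite big_ord_recl /= big1; last by move=> i _; rewrite mul0r normr0.
by rewrite mul1r addr0 ger0_norm//; lra.
Qed.

Lemma pois_ge0 l k : 0 <= l -> 0 <= pois l k.
Proof. by move=> l0; rewrite /pois !mulr_ge0 ?expR_ge0 ?exprn_ge0. Qed.

Lemma pois_sum_le1 l N : 0 <= l -> \sum_(k < N) pois l k <= 1.
Proof.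
move=> l0; rewrite /pois; under eq_bigr do rewrite -mulrA.
rewrite -mulr_sumr expRN mulrC ler_pdivrMr ?expR_gt0// mul1r.
rewrite -(big_mkord xpredT (fun k => l ^+ k / k`!%:R)).
rewrite -/(series (exp_coeff l) N) /expR.
apply: nondecreasing_cvgn_le; last exact: is_cvg_series_exp_coeff.
apply/nondecreasing_seqP => n; rewrite /series /= big_nat_recr//= lerDl.
exact: exp_coeff_ge0.
Qed.

Lemma poisD l m k : pois (l + m) k = conv (pois l) (pois m) k.
Proof.
rewrite /pois /conv [l + m]addrC exprDn mulr_sumr mulr_suml; apply: eq_bigr => i _.
have ik : (i <= k)%N by rewrite -ltnS.
have fn0 n : (n`!%:R : R) != 0 by rewrite pnatr_eq0 -lt0n fact_gt0.
rewrite opprD expRD -(bin_fact ik) 2!natrM -[(_ * _) *+ 'C(k, i)]mulr_natr.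
have c0 : ('C(k, i)%:R : R) != 0 by rewrite pnatr_eq0 -lt0n bin_gt0.
have := fn0 i; have := fn0 (k - i)%N; move: c0.
set c := 'C(k, i)%:R; set a := i`!%:R; set b := (k - i)`!%:R => c0 b0 a0.
by field; rewrite a0 b0 c0.
Qed.

(** Moving the parameter from [p] to [m] costs [2 * `|p - m|]. At a common
    parameter the distance is O(m^2), by the two bounds 1 - m <= exp(-m) and
    (1 + m) exp(-m) <= 1 for the weights at 0 and 1 and the remaining mass. *)
Lemma pois_bern_tv p m N : 0 <= m ->
  \sum_(k < N) `|bern p k - pois m k| <= 2 * `|p - m| + 3 * m ^+ 2.
Proof.
move=> m0.
apply: (@le_trans _ _ (\sum_(k < N.+2) `|bern p k - pois m k|)).
  by rewrite 2!big_ord_recr /= -addrA lerDl addr_ge0.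
have P0 : pois m 0 = expR (- m) by rewrite /pois expr0 mulr1 fact0 divr1.
have P1 : pois m 1 = expR (- m) * m by rewrite /pois expr1 factS fact0 mul1n divr1.
set S := \sum_(i < N) pois m i.+2.
have S1 : expR (- m) + expR (- m) * m + S <= 1.
  have := @pois_sum_le1 m N.+2 m0.
  by rewrite 2!big_ord_recl addrA P0 /bump /= P1.
have -> : \sum_(k < N.+2) `|bern p k - pois m k| =
    `|1 - p - expR (- m)| + `|p - expR (- m) * m| + S.
  rewrite 2!big_ord_recl addrA P0 /bump /= P1 mul1r; congr (_ + _).
  by apply: eq_bigr => i _; rewrite mul0r sub0r normrN ger0_norm ?pois_ge0.
have e1 : 1 - m <= expR (- m) by apply: expR_ge1Dx.
have e2 : expR (- m) * (1 + m) <= 1.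
  by rewrite expRN mulrC ler_pdivrMr ?expR_gt0// mul1r expR_ge1Dx.
have e3 : expR (- m) <= 1 by rewrite expR_le1 oppr_le0.
move: e1 e2 e3 S1; set e := expR (- m) => e1 e2 e3 S1.
have e4 : e * m <= m by rewrite ler_piMl.
have e5 : (1 - m) * m <= e * m by rewrite ler_wpM2r.
have h1 : `|1 - p - e| <= `|p - m| + m ^+ 2.
  rewrite [1 - p - e](_ : _ = - (p - m) + (1 - m - e)); last by ring.
  apply: le_trans (ler_normD _ _) _; rewrite normrN lerD2l ler0_norm; last by lra.
  by nra.
have h2 : `|p - e * m| <= `|p - m| + m ^+ 2.
  rewrite [p - e * m](_ : _ = (p - m) + (m - e * m)); last by ring.
  apply: le_trans (ler_normD _ _) _; rewrite lerD2l ger0_norm; last by lra.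
  by nra.
have h3 : S <= m ^+ 2 by nra.
lra.
Qed.

(** Le Cam's inequality. Poisson laws convolve by adding their parameters and
    convolution by a subprobability contracts the l^1 norm, so that replacing
    the Bernoulli factors one by one adds up the errors of [pois_bern_tv]. *)
Lemma bern_sum_pois_tv (pms : seq (R * R)) N :
  (forall q, q \in pms -> [/\ 0 <= q.1 <= 1 & 0 <= q.2]) ->
  \sum_(k < N) `|bern_sum (map fst pms) k - pois (\sum_(q <- pms) q.2) k| <=
  \sum_(q <- pms) (2 * `|q.1 - q.2| + 3 * q.2 ^+ 2).
Proof.
elim: pms => [|[p m] pms IH] pmsP.
  rewrite !big_nil big1// => i _ /=.
  rewrite /pois oppr0 expR0 mul1r; case: (nat_of_ord i) => [|k].
    by rewrite expr0 fact0 divr1 subrr normr0.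
  by rewrite expr0n /= mul0r subr0 normr0.
rewrite !big_cons /=.
have [/= p01 m0] := pmsP _ (mem_head _ _).
have pmsP' q : q \in pms -> 0 <= q.1 <= 1 /\ 0 <= q.2.
  by move=> qi; apply: pmsP; rewrite in_cons qi orbT.
set L := \sum_(j <- pms) j.2.
have L0 : 0 <= L by rewrite /L big_seq sumr_ge0// => q /pmsP'[].
pose d0 := bern p \- pois m; pose d1 := bern_sum (map fst pms) \- pois L.
apply: (@le_trans _ _ (\sum_(k < N) (`|conv (bern p) d1 k| + `|conv d0 (pois L) k|))).
  apply: ler_sum => k _; apply: le_trans (ler_normD _ _).
  rewrite convBr convBl poisD le_eqVlt; apply/orP; left; apply/eqP; congr (`| _ |); ring.
rewrite big_split /= addrC; apply: lerD.
  apply: le_trans (conv_norm_sum_le _ _ _) _.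
  apply: (@le_trans _ _ ((\sum_(k < N) `|d0 k|) * 1)).
    rewrite ler_wpM2l ?sumr_ge0//; under eq_bigr do rewrite ger0_norm ?pois_ge0//.
    exact: pois_sum_le1.
  by rewrite mulr1; exact: pois_bern_tv.
apply: le_trans (conv_norm_sum_le _ _ _) _.
apply: (@le_trans _ _ (1 * (\sum_(k < N) `|d1 k|))).
  by rewrite ler_wpM2r ?sumr_ge0// bern_norm_sum_le1.
by rewrite mul1r; exact: IH.
Qed.

End bernoulli_sums.

(** * A local limit theorem for the Poisson law *)

Section pois_ratio.
Context {R : realType}.
Implicit Types (l D x : R) (t m k : nat).

Lemma pois_gt0 l k : 0 < l -> 0 < pois l k.
Proof.
move=> l0; by rewrite /pois divr_gt0 ?mulr_gt0 ?expR_gt0 ?exprn_gt0// ltr0n fact_gt0.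
Qed.

Lemma poisS l k : pois l k.+1 = pois l k * (l / k.+1%:R).
Proof.
rewrite /pois exprS factS natrM.
have f0 : (k`!%:R : R) != 0 by rewrite pnatr_eq0 -lt0n fact_gt0.
have k0 : (k.+1%:R : R) != 0 by rewrite pnatr_eq0.
by field; rewrite f0 addrC natr1 k0.
Qed.

Lemma inv1Dx_ge_expRN (y : R) : 0 < 1 + y -> expR (- y) <= (1 + y)^-1.
Proof.
by move=> y0; rewrite expRN lef_pV2 ?posrE ?expR_gt0// expR_ge1Dx.
Qed.

(** The four bounds on the ratio of two Poisson weights have the same proof.
    Consecutive weights have ratio [l / k.+1], or [k / l] when going left; at
    distance [j] from [t] this is 1 + y with y close to - j / t, hence at most
    exp y and, through its inverse, at least the exponential of a comparable
    quantity. A product of [m] such factors has an exponent that is quadratic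
    in [m]. Where it occurs, the integer [M] bounds [m], so that all factors
    can be given the same denominator. *)
Lemma pois_right_le l D t M m : 0 < l -> (0 < t)%N -> `|l - t%:R| <= D ->
  (m <= M)%N ->
  pois l (t + m) <= pois l t *
    expR (D * m%:R / t%:R - m%:R * m.+1%:R / (2 * (t + M)%:R)).
Proof.
move=> l0 t0 /ler_normlP[lD1 lD2]; have D0 : 0 <= D by lra.
have t0' : 0 < (t%:R : R) by rewrite ltr0n.
have tM0 : 0 < ((t + M)%:R : R) by rewrite ltr0n addn_gt0 t0.
elim: m => [|m IH] mM.
  by rewrite addn0 mulr0 !mul0r subr0 expR0 mulr1.
rewrite addnS poisS.
have tm0 : 0 < ((t + m).+1%:R : R) by rewrite ltr0n.
have step : l / (t + m).+1%:R <= expR (D / t%:R - m.+1%:R / (t + M)%:R).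
  apply: le_trans (expR_ge1Dx _).
  have -> : l / (t + m).+1%:R = 1 + ((l - t%:R) / (t + m).+1%:R - m.+1%:R / (t + m).+1%:R).
    rewrite -mulrBl; apply: (mulIf (lt0r_neq0 tm0)).
    rewrite mulrDl mul1r !mulfVK ?lt0r_neq0//.
    by rewrite -!natr1 natrD; ring.
  rewrite lerD2l lerB//.
    apply: (@le_trans _ _ (D / (t + m).+1%:R)); first by rewrite ler_pM2r ?invr_gt0//; lra.
    by rewrite ler_wpM2l// lef_pV2 ?posrE// ler_nat -addnS leq_addr.
  by rewrite ler_wpM2l// lef_pV2 ?posrE// ler_nat -addnS leq_add2l.
apply: (@le_trans _ _ (pois l t * expR (D * m%:R / t%:R - m%:R * m.+1%:R / (2 * (t + M)%:R)) * expR (D / t%:R - m.+1%:R / (t + M)%:R))).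
  apply: ler_pM => //.
  - by rewrite pois_ge0// ltW.
  - by rewrite divr_ge0 ?ltW.
  - by apply: IH; exact: ltnW.
rewrite -mulrA -expRD ler_pM2l ?pois_gt0// ler_expR le_eqVlt; apply/orP; left; apply/eqP.
have := lt0r_neq0 t0'; have := lt0r_neq0 tM0.
rewrite -!(natr1 m.+1) -!(natr1 m); move: (t%:R) ((t + M)%:R) (m%:R) => a b c a0 b0.
by field; rewrite a0 b0.
Qed.

Lemma pois_right_ge l D t m : 0 < l -> `|l - t%:R| <= D ->
  pois l t * expR (- (D * m%:R + m%:R * m.+1%:R / 2) / l) <= pois l (t + m).
Proof.
move=> l0 /ler_normlP[lD1 lD2]; have D0 : 0 <= D by lra.
elim: m => [|m IH].
  by rewrite addn0 mulr0 !mul0r addr0 oppr0 mul0r expR0 mulr1.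
rewrite addnS poisS.
have tm0 : 0 < ((t + m).+1%:R : R) by rewrite ltr0n.
have step : expR (- (D + m.+1%:R) / l) <= l / (t + m).+1%:R.
  rewrite -[leRHS]invrK invf_div mulNr.
  have -> : (t + m).+1%:R / l = 1 + (t%:R - l + m.+1%:R) / l.
    by rewrite -!natr1 natrD; field; rewrite lt0r_neq0.
  apply: le_trans (inv1Dx_ge_expRN _).
    by rewrite ler_expR lerN2 ler_pM2r ?invr_gt0//; lra.
  have -> : 1 + (t%:R - l + m.+1%:R) / l = (t + m).+1%:R / l.
    by rewrite -!natr1 natrD; field; rewrite lt0r_neq0.
  by rewrite divr_gt0.
apply: (@le_trans _ _ (pois l t * expR (- (D * m%:R + m%:R * m.+1%:R / 2) / l) * expR (- (D + m.+1%:R) / l))).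
  rewrite -[leRHS]mulrA -expRD ler_pM2l ?pois_gt0// ler_expR le_eqVlt; apply/orP; left; apply/eqP.
  by rewrite -!(natr1 m.+1) -!(natr1 m); field; rewrite lt0r_neq0.
by apply: ler_pM => //; rewrite ?expR_ge0// mulr_ge0 ?expR_ge0// pois_ge0// ltW.
Qed.

Lemma poisP l k : 0 < l -> (0 < k)%N -> pois l k.-1 = pois l k * (k%:R / l).
Proof.
case: k => // k l0 _; rewrite poisS /=.
have : (k.+1%:R : R) != 0 by rewrite pnatr_eq0.
by move: (k.+1%:R) => a a0; field; rewrite a0 lt0r_neq0.
Qed.

Lemma pois_left_le l D t m : 0 < l -> `|l - t%:R| <= D -> (m <= t)%N ->
  pois l (t - m) <= pois l t *
    expR ((D * m%:R - m%:R * (m%:R - 1) / 2) / l).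
Proof.
move=> l0 /ler_normlP[lD1 lD2]; have D0 : 0 <= D by lra.
elim: m => [|m IH] mt.
  by rewrite subn0 mulr0 !mul0r subr0 mul0r expR0 mulr1.
rewrite subnS poisP ?subn_gt0//.
have step : (t - m)%:R / l <= expR ((D - m%:R) / l).
  apply: le_trans (expR_ge1Dx _).
  rewrite natrB ?(ltnW mt)//.
  have -> : 1 + (D - m%:R) / l = (l + D - m%:R) / l by field; rewrite lt0r_neq0.
  by rewrite ler_pM2r ?invr_gt0//; lra.
apply: (@le_trans _ _ (pois l t * expR ((D * m%:R - m%:R * (m%:R - 1) / 2) / l) * expR ((D - m%:R) / l))).
  apply: ler_pM => //.
  - by rewrite pois_ge0// ltW.
  - by rewrite divr_ge0 ?ler0n ?(ltW l0).
  - by apply: IH; exact: ltnW.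
rewrite -mulrA -expRD ler_pM2l ?pois_gt0// ler_expR le_eqVlt; apply/orP; left; apply/eqP.
by rewrite -!(natr1 m); field; rewrite lt0r_neq0.
Qed.

Lemma pois_left_ge l D t M m : 0 < l -> `|l - t%:R| <= D -> (M < t)%N ->
  (m <= M)%N ->
  pois l t * expR (- (D * m%:R + m%:R * (m%:R - 1) / 2) / (t%:R - M%:R))
    <= pois l (t - m).
Proof.
move=> l0 /ler_normlP[lD1 lD2] Mt; have D0 : 0 <= D by lra.
have tM0 : 0 < (t%:R - M%:R : R) by rewrite subr_gt0 ltr_nat.
elim: m => [|m IH] mM.
  by rewrite subn0 mulr0 !mul0r addr0 oppr0 mul0r expR0 mulr1.
have mt : (m < t)%N by rewrite (leq_trans mM)// ltnW.
rewrite subnS poisP ?subn_gt0//.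
have tm0 : 0 < ((t - m)%:R : R) by rewrite ltr0n subn_gt0.
have tmE : (t - m)%:R = t%:R - m%:R :> R by rewrite natrB// ltnW.
have step : expR (- (D + m%:R) / (t%:R - M%:R)) <= (t - m)%:R / l.
  rewrite -[leRHS]invrK invf_div mulNr.
  have -> : l / (t - m)%:R = 1 + (l - t%:R + m%:R) / (t - m)%:R.
    by rewrite [X in l - X + _](_ : _ = (t - m)%:R + m%:R) ?tmE ?subrK//; field; rewrite -tmE lt0r_neq0.
  apply: le_trans (inv1Dx_ge_expRN _).
    rewrite ler_expR lerN2; apply: (@le_trans _ _ ((D + m%:R) / (t - m)%:R)).
      by rewrite ler_pM2r ?invr_gt0//; lra.
    rewrite ler_wpM2l ?addr_ge0// lef_pV2 ?posrE// tmE lerD2l lerN2 ler_nat.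
    exact: ltnW.
  have -> : 1 + (l - t%:R + m%:R) / (t - m)%:R = l / (t - m)%:R.
    by rewrite [X in l - X + _](_ : _ = (t - m)%:R + m%:R) ?tmE ?subrK//; field; rewrite -tmE lt0r_neq0.
  by rewrite divr_gt0.
apply: (@le_trans _ _ (pois l t * expR (- (D * m%:R + m%:R * (m%:R - 1) / 2) / (t%:R - M%:R)) * expR (- (D + m%:R) / (t%:R - M%:R)))).
  rewrite -[leRHS]mulrA -expRD ler_pM2l ?pois_gt0// ler_expR le_eqVlt; apply/orP; left; apply/eqP.
  by rewrite -!(natr1 m); field; rewrite lt0r_neq0.
apply: ler_pM => //; rewrite ?expR_ge0//.
  by rewrite mulr_ge0 ?expR_ge0// pois_ge0// ltW.
by apply: IH; exact: ltnW.
Qed.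

End pois_ratio.

Section pois_local_limit.
Context {R : realType}.
Variables (t : nat -> nat) (l : nat -> R) (D : R).
Hypothesis tny : t n @[n --> \oo] --> \oo.
Hypothesis lt_le : forall n, `|l n - (t n)%:R| <= D.
Implicit Types (x y : R) (m : nat -> nat).

Let s n : R := Num.sqrt (t n)%:R.
Let e n : R := (s n)^-1.

Let near_t K : \forall n \near \oo, (K <= t n)%N.
Proof. exact: (tny (nbhs_infty_ge K)). Qed.

Let sq n : s n * s n = (t n)%:R.
Proof. by rewrite -expr2 sqr_sqrtr. Qed.

Let e_cvg0 : e n @[n --> \oo] --> (0 : R).
Proof.
apply/cvgrPdist_le => eps eps0; near=> n.
have t0 : (0 : R) < (t n)%:R by rewrite ltr0n; near: n; exact: near_t.
have s0 : 0 < s n by rewrite sqrtr_gt0.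
rewrite sub0r normrN ger0_norm; last by rewrite invr_ge0 ltW.
rewrite /e -[leRHS]invrK lef_pV2 ?posrE ?invr_gt0//.
rewrite -[leLHS]ger0_norm ?invr_ge0 ?(ltW eps0)// -sqrtr_sqr ler_wsqrtr//.
have : (Num.truncn (eps^-1 ^+ 2)).+1%:R <= (t n)%:R :> R.
  by rewrite ler_nat; near: n; exact: near_t.
by apply: le_trans; rewrite ltW// truncnS_gt.
Unshelve. all: by end_near. Qed.

Let l_cvg : l n / (t n)%:R @[n --> \oo] --> (1 : R).
Proof.
have D0 : 0 <= D by apply: le_trans (lt_le 0%N).
have h : D * (e n * e n) @[n --> \oo] --> (0 : R).
  rewrite -[X in _ --> X](mulr0 D) -[X in D * X](mulr0 0).
  by apply: cvgM; [exact: cvg_cst|exact: cvgM].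
apply/cvgrPdist_le => eps eps0; near=> n.
have t0 : (0 : R) < (t n)%:R by rewrite ltr0n; near: n; exact: near_t.
have -> : 1 - l n / (t n)%:R = - ((l n - (t n)%:R) / (t n)%:R).
  by rewrite mulrBl divff ?lt0r_neq0// opprB.
rewrite normrN normrM normfV (@ger0_norm _ (t n)%:R) ?(ltW t0)//.
apply: (@le_trans _ _ (D * (e n * e n))).
  rewrite /e -invfM sq; exact: ler_pM.
near: n.
have /cvgrPdist_le /(_ _ eps0) := h; apply: filterS => n.
by rewrite sub0r normrN; apply: le_trans; exact: ler_norm.
Unshelve. all: by end_near. Qed.

Let l_gt0 : \forall n \near \oo, 0 < l n.
Proof.
near=> n; have /ler_normlP[l1 l2] := lt_le n.
have : (Num.truncn D).+1%:R <= (t n)%:R :> R.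
  by rewrite ler_nat; near: n; exact: near_t.
have := truncnS_gt D; lra.
Unshelve. all: by end_near. Qed.

(** With m / sqrt t -> y, the exponents of both ratio bounds tend to
    - y^2 / 2, the term in [D] being of order m / t. *)
Lemma pois_right_cvg m y : (m n)%:R * e n @[n --> \oo] --> y ->
  pois (l n) (t n + m n) / pois (l n) (t n) @[n --> \oo] --> expR (- (y ^+ 2 / 2)).
Proof.
move=> mr; pose r n := (m n)%:R * e n.
have er : r n * e n @[n --> \oo] --> (0 : R) by rewrite -(mulr0 y); exact: cvgM.
pose up n := D * (r n * e n) - r n * (r n + e n) / (2 * (1 + r n * e n)).
pose lo n := - (D * (r n * e n) + r n * (r n + e n) / 2) / (l n / (t n)%:R).
have rre : r n * (r n + e n) @[n --> \oo] --> y ^+ 2.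
  by rewrite -[y ^+ 2]/(y * y) -[X in y * X]addr0; apply: cvgM => //; exact: cvgD.
have Dre : D * (r n * e n) @[n --> \oo] --> (0 : R).
  by rewrite -[X in _ --> X](mulr0 D); apply: cvgM => //; exact: cvg_cst.
have upc : expR (up n) @[n --> \oo] --> expR (- (y ^+ 2 / 2)).
  apply: continuous_cvg; first exact: continuous_expR.
  rewrite (_ : - (y ^+ 2 / 2) = 0 - y ^+ 2 / (2 * (1 + 0))); last by field.
  apply: cvgB => //; apply: cvgM => //; apply: cvgV; first by rewrite addr0 mulr1.
  apply: cvgM; first exact: cvg_cst.
  by apply: cvgD => //; exact: cvg_cst.
have loc : expR (lo n) @[n --> \oo] --> expR (- (y ^+ 2 / 2)).
  apply: continuous_cvg; first exact: continuous_expR.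
  rewrite (_ : - (y ^+ 2 / 2) = - (0 + y ^+ 2 / 2) / 1); last by field.
  apply: cvgM; last by apply: cvgV => //; exact: oner_neq0.
  apply: cvgN; apply: cvgD => //; apply: cvgM => //; exact: cvg_cst.
apply: squeeze_cvgr loc upc; near=> n.
have t0 : (0 < t n)%N by near: n; exact: near_t.
have t0' : (0 : R) < (t n)%:R by rewrite ltr0n.
have s0 : 0 < s n by rewrite sqrtr_gt0.
have l0 : 0 < l n by near: n; exact: l_gt0.
have p0 := pois_gt0 (t n) l0.
have mE : (m n)%:R = r n * s n by rewrite /r /e mulfVK// lt0r_neq0.
rewrite ler_pdivlMr// ler_pdivrMr// ![expR _ * _]mulrC; apply/andP; split.
  apply: le_trans (pois_right_ge _ l0 (lt_le n)).
  rewrite ler_pM2l// ler_expR le_eqVlt; apply/orP; left; apply/eqP.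
  rewrite /lo -(natr1 (m n)) mE -sq.
  have := lt0r_neq0 l0; have := lt0r_neq0 s0; rewrite /e.
  by move=> h1 h2; field; rewrite h1 h2.
apply: le_trans (pois_right_le l0 t0 (lt_le n) (leqnn _)) _.
rewrite ler_pM2l// ler_expR le_eqVlt; apply/orP; left; apply/eqP.
have : (t n + m n)%:R != 0 :> R by rewrite pnatr_eq0 -lt0n addn_gt0 t0.
rewrite /up -(natr1 (m n)) natrD mE -sq.
have := lt0r_neq0 s0; rewrite /e => h1 h2; field; rewrite h1/=.
by rewrite h2 andbT; move: h2; rewrite -mulrDl mulf_eq0 negb_or => /andP[].
Unshelve. all: by end_near. Qed.

Lemma pois_left_cvg m y : (m n)%:R * e n @[n --> \oo] --> y ->
  (\forall n \near \oo, m n <= t n)%N ->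
  pois (l n) (t n - m n) / pois (l n) (t n) @[n --> \oo] --> expR (- (y ^+ 2 / 2)).
Proof.
move=> mr mlet; pose r n := (m n)%:R * e n.
have er : r n * e n @[n --> \oo] --> (0 : R) by rewrite -(mulr0 y); exact: cvgM.
pose up n := (D * (r n * e n) - r n * (r n - e n) / 2) / (l n / (t n)%:R).
pose lo n := - (D * (r n * e n) + r n * (r n - e n) / 2) / (1 - r n * e n).
have rre : r n * (r n - e n) @[n --> \oo] --> y ^+ 2.
  by rewrite -[y ^+ 2]/(y * y) -[X in y * X]subr0; apply: cvgM => //; exact: cvgB.
have Dre : D * (r n * e n) @[n --> \oo] --> (0 : R).
  by rewrite -[X in _ --> X](mulr0 D); apply: cvgM => //; exact: cvg_cst.
have upc : expR (up n) @[n --> \oo] --> expR (- (y ^+ 2 / 2)).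
  apply: continuous_cvg; first exact: continuous_expR.
  rewrite (_ : - (y ^+ 2 / 2) = (0 - y ^+ 2 / 2) / 1); last by field.
  apply: cvgM; last by apply: cvgV => //; exact: oner_neq0.
  apply: cvgB => //; apply: cvgM => //; exact: cvg_cst.
have loc : expR (lo n) @[n --> \oo] --> expR (- (y ^+ 2 / 2)).
  apply: continuous_cvg; first exact: continuous_expR.
  rewrite (_ : - (y ^+ 2 / 2) = - (0 + y ^+ 2 / 2) / (1 - 0)); last by field.
  apply: cvgM; last first.
    apply: cvgV; first by rewrite subr0 oner_neq0.
    by apply: cvgB => //; exact: cvg_cst.
  apply: cvgN; apply: cvgD => //; apply: cvgM => //; exact: cvg_cst.
have mt' : \forall n \near \oo, r n * e n < 1.
  have /cvgrPdist_lt /(_ _ ltr01) := er; apply: filterS => n.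
  by rewrite sub0r normrN; apply: le_lt_trans; exact: ler_norm.
apply: squeeze_cvgr loc upc; near=> n.
have t0 : (0 < t n)%N by near: n; exact: near_t.
have t0' : (0 : R) < (t n)%:R by rewrite ltr0n.
have s0 : 0 < s n by rewrite sqrtr_gt0.
have l0 : 0 < l n by near: n; exact: l_gt0.
have p0 := pois_gt0 (t n) l0.
have mE : (m n)%:R = r n * s n by rewrite /r /e mulfVK// lt0r_neq0.
have esE : e n * s n = 1 by rewrite /e mulVf// lt0r_neq0.
have mt : (m n < t n)%N.
  have : r n * e n < 1 by near: n; exact: mt'.
  by rewrite -(ltr_pM2r t0') mul1r -sq mulrA -(mulrA _ (e n)) esE mulr1 -mE sq ltr_nat.
rewrite ler_pdivlMr// ler_pdivrMr// ![expR _ * _]mulrC; apply/andP; split.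
  apply: le_trans (pois_left_ge l0 (lt_le n) mt (leqnn _)).
  rewrite ler_pM2l// ler_expR le_eqVlt; apply/orP; left; apply/eqP.
  have : (t n)%:R - (m n)%:R != 0 :> R by rewrite subr_eq0 eqr_nat gtn_eqF.
  rewrite /lo mE -sq.
  have := lt0r_neq0 s0; rewrite /e => h1 h2; field; rewrite h1 andbC/=.
  by rewrite h2 andbT; move: h2; rewrite -mulrBl mulf_eq0 negb_or => /andP[].
apply: le_trans (pois_left_le l0 (lt_le n) (ltnW mt)) _.
rewrite ler_pM2l// ler_expR le_eqVlt; apply/orP; left; apply/eqP.
rewrite /up mE -sq.
have := lt0r_neq0 l0; have := lt0r_neq0 s0; rewrite /e.
by move=> h1 h2; field; rewrite h1 h2.
Unshelve. all: by end_near. Qed.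

Let kx x n := Num.truncn ((t n)%:R + x * s n).

Lemma pois_local_cvg x :
  pois (l n) (kx x n) / pois (l n) (t n) @[n --> \oo] --> expR (- (x ^+ 2 / 2)).
Proof.
have [x0|x0] := leP 0 x.
  pose m n := (kx x n - t n)%N.
  have mE n : kx x n = (t n + m n)%N.
    rewrite /m subnKC// -(@natrK R (t n)) le_truncn// lerDl.
    by rewrite mulr_ge0// sqrtr_ge0.
  under eq_fun do rewrite mE.
  apply: pois_right_cvg.
  have lo : x - e n @[n --> \oo] --> x.
    by rewrite -[X in _ --> X]subr0; apply: cvgB => //; exact: cvg_cst.
  apply: squeeze_cvgr lo (cvg_cst x); near=> n.
  have t0 : (0 : R) < (t n)%:R by rewrite ltr0n; near: n; exact: near_t.
  have s0 : 0 < s n by rewrite sqrtr_gt0.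
  have q0 : 0 <= (t n)%:R + x * s n by rewrite addr_ge0// mulr_ge0// ltW.
  have := truncn_itv q0; rewrite -/(kx x n) mE -natr1 natrD => /andP[h1 h2].
  rewrite /e ler_pdivlMr// mulrBl mulVf ?lt0r_neq0// ler_pdivrMr//.
  by apply/andP; split; lra.
pose m n := (t n - kx x n)%N.
have mE n : kx x n = (t n - m n)%N.
  rewrite /m subKn// -(@natrK R (t n)) le_truncn// gerDl.
  by rewrite mulr_le0_ge0 ?sqrtr_ge0// ltW.
under eq_fun do rewrite mE.
rewrite -sqrrN; apply: pois_left_cvg; last by apply: nearW => n; exact: leq_subr.
have lo : - x + e n @[n --> \oo] --> - x.
  by rewrite -[X in _ --> X]addr0; apply: cvgD => //; exact: cvg_cst.
apply: squeeze_cvgr (cvg_cst (- x)) lo.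
have /cvgrPdist_lt /(_ (- x)^-1) xe := e_cvg0.
have xn : 0 < - x by lra.
have xi : 0 < (- x)^-1 by rewrite invr_gt0.
near=> n.
have t0 : (0 : R) < (t n)%:R by rewrite ltr0n; near: n; exact: near_t.
have s0 : 0 < s n by rewrite sqrtr_gt0.
have ex : e n < (- x)^-1.
  apply: le_lt_trans (ler_norm _) _; rewrite -normrN -sub0r.
  by near: n; exact: xe.
have q0 : 0 <= (t n)%:R + x * s n.
  move: ex; rewrite /e ltf_pV2 ?posrE// => ex.
  by rewrite -sq -mulrDl mulr_ge0// ltW//; lra.
have := truncn_itv q0; rewrite -/(kx x n).
have km : (kx x n <= t n)%N by rewrite mE leq_subr.
rewrite -natr1 => /andP[h1 h2].
rewrite /e /m natrB// ler_pdivrMr// ler_pdivlMr// mulrDl mulVf ?lt0r_neq0//.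
by apply/andP; split; lra.
Unshelve. all: by end_near. Qed.

End pois_local_limit.

Section pois_domination.
Context {R : realType}.
Implicit Types (t : nat) (l D x : R).

(** The quadratic exponent of the ratio bounds is weakened to a linear one. Its
    exponential is still integrable, and the bound remains valid far out in the
    right tail, where the Poisson weights are larger than Gaussian ones. *)
Lemma pois_dominated t l D x : (64 <= t)%N -> 8 * D <= t%:R ->
  `|l - t%:R| <= D -> 0 <= t%:R + x * Num.sqrt t%:R ->
  pois l (Num.truncn (t%:R + x * Num.sqrt t%:R)) <=
    pois l t * expR (2 * D + 2 - `|x|).
Proof.
move=> t64 tD ltD; have /ler_normlP[lD1 lD2] := ltD.
have D0 : 0 <= D by lra.
have T64 : (64 : R) <= t%:R by rewrite (ler_nat R 64).
have t0 : (0 < t)%N by exact: leq_trans t64.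
have l0 : 0 < l by lra.
have p0 := pois_gt0 t l0.
have := sqr_sqrtr (ler0n R t); set s := Num.sqrt t%:R; rewrite expr2 => sq.
have s8 : 8 <= s.
  rewrite -[8]ger0_norm// -sqrtr_sqr ler_wsqrtr//.
  by apply: le_trans T64; rewrite expr2; lra.
have s0 : 0 < s by lra.
move=> q0; have := truncn_itv q0; set k := Num.truncn _.
rewrite -natr1 => /andP[h1 h2].
have [tk|kt] := leqP t k.
  move: h1 h2; rewrite -(subnKC tk) natrD; set m := (k - t)%N => h1 h2.
  apply: le_trans (pois_right_le l0 t0 ltD (leqnn _)) _.
  rewrite ler_pM2l// ler_expR.
  have m0 : (0 : R) <= m%:R by [].
  have x1 : x * s <= m%:R + 1 by lra.
  have ms : m%:R / s >= x - 1 by rewrite ler_pdivlMr//; nra.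
  have xn : x - 1 <= m%:R / s -> `|x| <= m%:R / s + 1.
    move=> _; rewrite ler_norml; apply/andP; split; last by lra.
    have : 0 <= m%:R / s by rewrite divr_ge0// ltW.
    have : -1 < x by rewrite -(ltr_pM2r s0); nra.
    lra.
  have {}xn := xn ms.
  (* For m <= t the exponent is at most D - y^2/4 with y = m/s, and
     y^2/4 >= y - 1. *)
  have [mt|tm] := leqP m t.
    have mt' : m%:R <= t%:R :> R by rewrite ler_nat.
    have e1 : D * m%:R / t%:R <= D.
      by rewrite ler_pdivrMr ?ltr0n// ler_wpM2l.
    have e2 : (m%:R / s) ^+ 2 / 4 <= m%:R * m.+1%:R / (2 * (t + m)%:R).
      have -> : (m%:R / s) ^+ 2 / 4 = m%:R * m%:R / (4 * t%:R).
        by rewrite -sq; field; rewrite lt0r_neq0.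
      apply: ler_pM.
      - by rewrite mulr_ge0.
      - by rewrite invr_ge0 mulr_ge0.
      - by rewrite ler_wpM2l// ler_nat.
      - rewrite lef_pV2 ?posrE ?mulr_gt0 ?ltr0n ?addn_gt0 ?t0//.
        by rewrite natrD; lra.
    have : 0 <= (m%:R / s - 2) ^+ 2 by exact: sqr_ge0.
    rewrite !expr2 in e2 *; nra.
  (* For m > t it is at most m/8 - m/4, while m/s <= m/8 because s >= 8. *)
  have mt' : t%:R <= m%:R :> R by rewrite ler_nat ltnW.
  have m1 : (0 : R) < m%:R by rewrite ltr0n (leq_trans t0)// ltnW.
  have e1 : D * m%:R / t%:R <= m%:R / 8.
    rewrite ler_pdivrMr ?ltr0n// -mulrA [D * _]mulrC ler_wpM2l//.
    by rewrite ler_pdivlMl//.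
  have e2 : m%:R / 4 <= m%:R * m.+1%:R / (2 * (t + m)%:R) :> R.
    rewrite -mulrA ler_wpM2l// ler_pdivlMr ?mulr_gt0 ?ltr0n ?addn_gt0 ?t0//.
    by rewrite natrD -(natr1 m); lra.
  have e3 : m%:R / s <= m%:R / 8 :> R.
    by rewrite ler_wpM2l// lef_pV2 ?posrE.
  lra.
have kt' := ltnW kt.
move: h1 h2; rewrite -(subKn kt') natrB ?leq_subr//; set m := (t - k)%N => h1 h2.
have mt : (m <= t)%N by exact: leq_subr.
have mt' : m%:R <= t%:R :> R by rewrite ler_nat.
apply: le_trans (pois_left_le l0 ltD mt) _.
rewrite ler_pM2l// ler_expR.
have m0 : (0 : R) <= m%:R by [].
have m1 : (1 : R) <= m%:R by rewrite ler1n subn_gt0.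
have x0 : x <= 0.
  by rewrite -(ler_pM2r s0) mul0r; lra.
have xm : - x <= m%:R / s by rewrite ler_pdivlMr//; lra.
rewrite (ler0_norm x0).
have e1 : D * m%:R / l <= 2 * D.
  rewrite ler_pdivrMr//; nra.
have e2 : m%:R * (m%:R - 1) / (4 * t%:R) <= m%:R * (m%:R - 1) / 2 / l :> R.
  rewrite -[leRHS]mulrA ler_wpM2l ?mulr_ge0 ?subr_ge0//.
  by rewrite -invfM lef_pV2 ?posrE ?mulr_gt0 ?ltr0n//; lra.
have e3 : (m%:R / s) ^+ 2 / 4 - 1 / 4 <= m%:R * (m%:R - 1) / (4 * t%:R) :> R.
  rewrite ler_pdivlMr ?mulr_gt0 ?ltr0n// expr_div_n [s ^+ 2]expr2 sq expr2 -subr_ge0.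
  rewrite (_ : _ - _ = t%:R - m%:R); first by rewrite subr_ge0.
  by field; rewrite pnatr_eq0 -lt0n.
have : 0 <= (m%:R / s - 2) ^+ 2 by exact: sqr_ge0.
rewrite mulrBl; rewrite !expr2 in e3 *; nra.
Qed.

End pois_domination.

Lemma normal_pdf01E {R : realType} (x : R) :
  normal_pdf 0 1 x = normal_peak 1 * expR (- (x ^+ 2 / 2)).
Proof.
rewrite normal_pdfE ?oner_neq0// /normal_fun subr0 expr1n mulNr.
by rewrite -[1 *+ 2]/(2%:R).
Qed.

(** The value of the integral never matters, only that it is finite and
    nonzero; both follow from the Gaussian density being a probability
    density. *)
Lemma integral_gauss {R : realType} : exists2 I : R, 0 < I &
  (\int[@lebesgue_measure R]_x (expR (- (x ^+ 2 / 2)))%:E = I%:E)%E.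
Proof.
have p0 := normal_peak_gt0 (oner_neq0 R).
have := @integral_normal_pdf R 0 1.
under eq_integral do rewrite normal_pdf01E EFinM.
rewrite ge0_integralZl_EFin//=; first last.
- exact: ltW.
- apply/measurable_EFinP; apply: measurableT_comp => //.
  by apply: measurableT_comp => //; apply: measurable_funM.
case: (\int[_]_x _)%E.
- move=> I; rewrite -EFinM => -[pI]; exists I => //.
  by rewrite -(pmulr_rgt0 _ p0) pI.
- by rewrite mulry gtr0_sg// mul1e.
- by rewrite mulrNy gtr0_sg// mul1e.
Qed.

Section local_limit_integral.
Context {R : realType}.
Local Notation mu := (@lebesgue_measure R).

(** The points [x] for which [t + x * sqrt t] has integer part [k]. *)
Definition cell (t k : nat) : set R :=
  `[(k%:R - t%:R) / Num.sqrt t%:R, (k.+1%:R - t%:R) / Num.sqrt t%:R[%classic.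

Definition step (t N : nat) (G : nat -> R) (x : R) : R :=
  \sum_(k < N) G k * \1_(cell t k) x.

Lemma stepE t N G x : (0 < t)%N ->
  let q := t%:R + x * Num.sqrt t%:R in
  step t N G x = if (0 <= q) && (Num.truncn q < N)%N then G (Num.truncn q) else 0.
Proof.
move=> t0 /=; set s := Num.sqrt t%:R; set q := _ + _.
have s0 : 0 < s by rewrite sqrtr_gt0 ltr0n.
have cellE k : \1_(cell t k) x = ((k%:R <= q) && (q < k.+1%:R))%:R :> R.
  rewrite indicE /cell; congr (nat_of_bool _)%:R; apply/idP/idP.
    rewrite inE /= in_itv /= -/s ler_pdivrMr// ltr_pdivlMr// => /andP[h1 h2].
    by rewrite /q; apply/andP; split; lra.
  rewrite /q => /andP[h1 h2]; rewrite inE /= in_itv /= -/s.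
  by rewrite ler_pdivrMr// ltr_pdivlMr//; apply/andP; split; lra.
rewrite /step; under eq_bigr do rewrite cellE.
have [q0|q0] /= := leP 0 q; last first.
  rewrite big1// => k _; rewrite leNgt (lt_le_trans q0)//=.
  by rewrite mulr0n mulr0.
under eq_bigr do rewrite -truncn_eq//.
case: ifP => [qN|qN].
  rewrite (bigD1 (Ordinal qN))//= eqxx mulr1 big1 ?addr0// => k kN.
  by case: eqP => qk; rewrite ?mulr0//; case/eqP: kN; exact: val_inj.
rewrite big1// => k _; case: eqP => qk; last by rewrite mulr0.
by move: qN; rewrite qk ltn_ord.
Qed.

Let mcell t k : measurable (cell t k). Proof. exact: measurable_itv. Qed.

Let integrable_cell t k (c : R) : (0 < t)%N ->
  mu.-integrable setT (EFin \o (fun x => c * \1_(cell t k) x)).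
Proof.
move=> t0; rewrite (_ : _ \o _ = (fun x => c%:E * (EFin \o \1_(cell t k)) x)%E)//.
apply: integrableZl => //; exact: integrable_indic_itv.
Qed.

Lemma integrable_step t N G : (0 < t)%N -> mu.-integrable setT (EFin \o step t N G).
Proof.
move=> t0; rewrite (_ : _ \o _ = (fun x => \sum_(k < N) (G k * \1_(cell t k) x)%:E)%E).
  by apply: integrable_sum => // k _; exact: integrable_cell.
by apply/funext => x /=; rewrite sumEFin.
Qed.

Lemma integral_step t N G : (0 < t)%N ->
  (\int[mu]_x (step t N G x)%:E = ((\sum_(k < N) G k) / Num.sqrt t%:R)%:E)%E.
Proof.
move=> t0; under eq_integral do rewrite /step -sumEFin.
rewrite integral_sum//; last by move=> k; exact: integrable_cell.
rewrite mulr_suml -sumEFin; apply: eq_bigr => k _.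
under eq_integral do rewrite EFinM.
rewrite integralZl//; last exact: integrable_indic_itv.
rewrite EFinM; congr (_ * _)%E; rewrite integral_indic; [|exact: measurableT|exact: mcell].
transitivity (mu (cell t k)); first by congr (mu _); exact: setIT.
rewrite /cell lebesgue_measure_itv/= lte_fin.
have s0 : (0 : R) < Num.sqrt t%:R by rewrite sqrtr_gt0 ltr0n.
rewrite ltr_pM2r ?invr_gt0// ltrD2r ltr_nat ltnSn -EFinB; congr EFin.
by rewrite -(natr1 k); field; rewrite lt0r_neq0.
Qed.

Lemma integrable_expR_norm : mu.-integrable setT (fun x => (expR (- `|x|))%:E).
Proof.
have mE : measurable_fun setT (fun x : R => expR (- `|x|)).
  apply: measurableT_comp => //; apply: measurableT_comp => //.
apply/integrableP; split; first exact/measurable_EFinP.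
under eq_integral do rewrite /= ger0_norm ?expR_ge0//.
rewrite ge0_symfun_integralT //=; first last.
- by move=> x /=; rewrite normrN.
- move=> x; apply: continuous_comp; last exact: continuous_expR.
  by apply: continuousN; exact: norm_continuous.
- have h : mu.-integrable [set x | 0 <= x] (fun x => (exponential_pdf 1 x)%:E).
    apply: integrableS (integrable_exponential_pdf ltr01) => //.
    have := @measurable_itv R (Interval (BLeft 0) +oo%O).
    by rewrite set_itvE.
  have /integrableP[_] := h.
  move=> hfin; apply: lte_mul_pinfty => //.
  apply: le_lt_trans hfin; rewrite le_eqVlt; apply/orP; left; apply/eqP.
  apply: eq_integral => x; rewrite inE /= => x0; rewrite exponential_pdfE// mul1r mulN1r.
  by rewrite (ger0_norm x0) ger0_norm ?expR_ge0.
Qed.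

Variables (t N : nat -> nat) (l : nat -> R) (D : R).
Hypothesis tny : t n @[n --> \oo] --> \oo.
Hypothesis lt_le : forall n, `|l n - (t n)%:R| <= D.
Hypothesis t64 : forall n, (64 <= t n)%N.
Hypothesis tD : forall n, 8 * D <= (t n)%:R.
Hypothesis tN : forall n, (2 * t n <= N n)%N.

Let gauss (x : R) := expR (- (x ^+ 2 / 2)).
Let s n : R := Num.sqrt (t n)%:R.

(** A Poisson sum divided by [pois l t * sqrt t] is the integral of a step
    function of x = (k - t) / sqrt t, to which dominated convergence applies.
    The condition [2 * t n <= N n] makes the truncation at [N n] invisible at
    each fixed [x] for large [n]. *)
Lemma pois_sum_integral_cvg (B : R) (U : nat -> nat -> R) (phi : R -> R) :
  (forall n k, `|U n k| <= B) ->
  measurable_fun setT phi ->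
  {ae mu, forall x, U n (Num.truncn ((t n)%:R + x * s n)) @[n --> \oo] --> phi x} ->
  mu.-integrable setT (EFin \o (fun x => phi x * gauss x)) /\
  (((\sum_(k < N n) pois (l n) k * U n k) / (pois (l n) (t n) * s n))%:E
    @[n --> \oo] --> \int[mu]_x (phi x * gauss x)%:E)%E.
Proof.
move=> UB mphi Uphi.
have t0 n : (0 < t n)%N by exact: leq_trans (t64 n).
have s0 n : 0 < s n by rewrite sqrtr_gt0 ltr0n.
have l0 n : 0 < l n.
  have /ler_normlP[? ?] := lt_le n; have := tD n.
  have : (0 : R) < (t n)%:R by rewrite ltr0n.
  lra.
have B0 : 0 <= B by exact: le_trans (UB 0%N 0%N).
pose G n k := pois (l n) k / pois (l n) (t n) * U n k.
pose F n x := step (t n) (N n) (G n) x.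
have mgauss : measurable_fun setT gauss.
  apply: measurableT_comp => //; apply: measurableT_comp => //.
  by apply: measurable_funM => //; exact: measurable_funX.
have [//|||||] := @dominated_convergence _ _ _ mu setT measurableT
  (fun n x => (F n x)%:E) (fun x => (phi x * gauss x)%:E)
  (fun x => ((B * expR (2 * D + 2))%:E * (expR (- `|x|))%:E)%E).
- move=> n; have := integrable_step (N n) (G n) (t0 n).
  by move=> /integrableP[].
- by apply/measurable_EFinP; exact: measurable_funM.
- apply: (@filterS _ _ (ae_filter_ringOfSetsType mu) _ _ _ Uphi) => x Ux _.
  apply: cvg_EFin; first by near=> n.
  have Gc : G n (Num.truncn ((t n)%:R + x * s n)) @[n --> \oo] --> phi x * gauss x.
    rewrite mulrC; apply: cvgM => //; exact: pois_local_cvg tny lt_le x.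
  rewrite /= -[X in _ --> X]/(phi x * gauss x).
  apply: cvg_trans Gc; apply: near_eq_cvg; near=> n.
  have xs : `|x| < s n.
    rewrite -[ltLHS]ger0_norm// -sqrtr_sqr ltr_sqrt ?ltr0n//.
    apply: lt_le_trans (truncnS_gt _) _; rewrite ler_nat.
    by near: n; exact: (tny (nbhs_infty_ge _)).
  have /andP[x1 x2] : - s n < x < s n by rewrite -ltr_norml.
  have sq : s n * s n = (t n)%:R by rewrite -expr2 sqr_sqrtr.
  have q0 : 0 <= (t n)%:R + x * s n.
    by rewrite -sq -mulrDl mulr_ge0// ?ltW//; lra.
  rewrite /= /F stepE// q0 /= ifT//.
  rewrite truncn_lt_nat//; apply: (@lt_le_trans _ _ (2 * t n)%:R).
    have : x * s n < s n * s n by rewrite ltr_pM2r.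
    by rewrite sq natrM -/(s n) => xs2; lra.
  by rewrite ler_nat.
- by apply: integrableZl => //; exact: integrable_expR_norm.
- apply: aeW => x n _; rewrite /= lee_fin /F stepE//.
  case: ifP => [/andP[q0 _]|_]; last by rewrite normr0 !mulr_ge0 ?expR_ge0.
  have pr0 k : 0 <= pois (l n) k / pois (l n) (t n).
    by rewrite divr_ge0 ?pois_ge0 ?(ltW (l0 n)).
  rewrite /G normrM (ger0_norm (pr0 _)) [leLHS]mulrC -[leRHS]mulrA.
  apply: ler_pM => //.
  rewrite -expRD ler_pdivrMr ?pois_gt0// [leRHS]mulrC.
  exact: pois_dominated.
move=> If _; rewrite /=.
under eq_fun do rewrite integral_step//.
move=> Ic; split; first exact: If.
rewrite (_ : (fun n => _) = (fun n => ((\sum_(k < N n) G n k) / s n)%:E)); first exact: Ic.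
apply/funext => n; congr EFin; rewrite /G !mulr_suml; apply: eq_bigr => k _.
by field; rewrite !lt0r_neq0 ?pois_gt0.
Unshelve. all: by end_near. Qed.

(** The normalising factor [pois l t * sqrt t] stays bounded: for [U = 1] the
    normalised sum tends to the positive constant of [integral_gauss], whereas
    the sum itself is at most 1. This replaces Stirling's formula. *)
Lemma pois_sum_cvg0 (B : R) (U : nat -> nat -> R) (phi : R -> R) :
  (forall n k, `|U n k| <= B) ->
  measurable_fun setT phi ->
  {ae mu, forall x, U n (Num.truncn ((t n)%:R + x * s n)) @[n --> \oo] --> phi x} ->
  (\int[mu]_x (phi x * gauss x)%:E = 0)%E ->
  \sum_(k < N n) pois (l n) k * U n k @[n --> \oo] --> (0 : R).
Proof.
move=> UB mphi Uphi phi0.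
have t0 n : (0 < t n)%N by exact: leq_trans (t64 n).
have s0 n : 0 < s n by rewrite sqrtr_gt0 ltr0n.
have l0 n : 0 < l n.
  have /ler_normlP[? ?] := lt_le n; have := tD n.
  have : (0 : R) < (t n)%:R by rewrite ltr0n.
  lra.
pose ps n := pois (l n) (t n) * s n.
have ps0 n : 0 < ps n by rewrite mulr_gt0// pois_gt0.
pose A n := (\sum_(k < N n) pois (l n) k * U n k) / ps n.
have Ac : A n @[n --> \oo] --> (0 : R).
  have [_] := pois_sum_integral_cvg UB mphi Uphi.
  by rewrite phi0 => /fine_cvg.
pose J n := (\sum_(k < N n) pois (l n) k) / ps n.
have [I I0 Jc] : exists2 I : R, 0 < I & J n @[n --> \oo] --> I.
  have [I I0 IE] := @integral_gauss R.
  exists I => //.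
  have [|||_] := @pois_sum_integral_cvg 1 (fun _ _ => 1) (fun=> 1).
  - by move=> _ _; rewrite normr1.
  - exact: measurable_cst.
  - by apply: aeW => x; exact: cvg_cst.
  under eq_integral do rewrite mul1r.
  rewrite IE => /fine_cvg /=; rewrite /J.
  by under eq_fun do under eq_bigr do rewrite mulr1.
have J2 : \forall n \near \oo, I / 2 < J n.
  by apply: (cvgr_gt _ Jc); rewrite ltr_pdivrMr// mulr_natr mulr2n; lra.
have hc : `|A n| * (2 / I) @[n --> \oo] --> (0 : R).
  rewrite (_ : 0 = `|0 : R| * (2 / I)); last by rewrite normr0 mul0r.
  by apply: cvgM; [exact: cvg_norm|exact: cvg_cst].
apply/cvgr0Pnorm_le => eps eps0.
have /cvgr0Pnorm_le /(_ _ eps0) := hc.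
apply: filterS2 J2 => n Jn; rewrite ger0_norm ?mulr_ge0 ?invr_ge0 ?(ltW I0)// => h.
have -> : \sum_(k < N n) pois (l n) k * U n k = A n * ps n.
  by rewrite /A mulfVK// lt0r_neq0.
rewrite normrM (gtr0_norm (ps0 n)); apply: le_trans h; apply: ler_wpM2l => //.
have S1 : J n * ps n <= 1.
  by rewrite /J mulfVK ?lt0r_neq0// pois_sum_le1// ltW.
rewrite ler_pdivlMr//.
have := ps0 n; nra.
Qed.

End local_limit_integral.

(** * Weak convergence *)

Section bounded_integrals.
Context d (T : measurableType d) (R : realType).
Variable mu : {finite_measure set T -> \bar R}.

Lemma bounded_integrable (f : T -> R) (B : R) : measurable_fun setT f ->
  (forall x, `|f x| <= B) -> mu.-integrable setT (EFin \o f).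
Proof.
move=> mf fB; apply: measurable_bounded_integrable => //.
  exact: fin_num_fun_lty.
exists B; split; first exact: num_real.
by move=> y By x _ /=; apply: le_trans (fB x) _; exact: ltW.
Qed.

End bounded_integrals.

Section weak_convergence.
Context (R : realType) (P : ptopologicalType).

Lemma continuous_borel (h : P -> R) : continuous h ->
  measurable_fun setT (h : borel P -> R).
Proof.
move=> /continuousP ch.
apply: (measurability _ (RGenOInfty.measurableE R)) => _ [_ [x ->] <-].
rewrite setTI; apply: sub_sigma_algebra; apply: ch; exact: interval_open.
Qed.

Lemma measures_cvgP (F : set_system (measures R P)) (FF : Filter F) (mu : fmeas R P) :
  (forall h : P -> R, continuous h -> (exists B : R, forall x, `|h x| <= B) ->
    \int[nu]_(x in [set: borel P]) h x @[nu --> F] -->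
    (\int[mu]_(x in [set: borel P]) h x : R)) ->
  F --> (mu : measures R P).
Proof.
move=> H.
have Hp : @integrals R P @ F --> (integrals mu : {ptws bounded_continuous R P -> R}).
  apply/cvg_sup => -[h [ch hB]] V [? [[A oA <-] Omu OV]].
  by apply: filterS OV _; apply: (H h ch hB); exact: open_nbhs_nbhs.
move=> U [? [[W oW <-] Wmu WU]].
apply: filterS WU _; apply: Hp; exact: open_nbhs_nbhs.
Qed.

Lemma measures_cvg_integral (T : Type) (F : set_system T) {FF : Filter F}
    (nu : T -> fmeas R P) (mu : fmeas R P) (h : P -> R) (B : R) :
  (nu : T -> measures R P) x @[x --> F] --> (mu : measures R P) ->
  continuous h -> (forall x, `|h x| <= B) ->
  \int[nu x]_(y in [set: borel P]) h y @[x --> F] -->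
    (\int[mu]_(y in [set: borel P]) h y : R).
Proof.
move=> numu ch hB.
pose h' : bounded_continuous R P := exist _ h (conj ch (ex_intro _ B hB)).
have : continuous (fun nu : measures R P => \int[nu]_(y in [set: borel P]) h y : R).
  move=> nu0; apply: (@cvg_comp _ _ _ (@integrals R P) (fun f => f h')).
    exact: initial_continuous.
  pose f : {ptws bounded_continuous R P -> R} := integrals nu0.
  have /cvg_sup/(_ h') : f --> f by exact: cvg_id.
  move=> ff V fV; apply: ff.
  exact: (@initial_continuous _ _ (fun g : {ptws bounded_continuous R P -> R} => g h') f V fV).
move=> /(_ mu); exact: cvg_comp numu.
Qed.

End weak_convergence.

Section slutsky.
Context (R : realType) (P : ptopologicalType) (hP : polish R P).
Variables (psi : nat -> P -> R) (psi0 : P -> R) (B : R).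
Hypothesis psiB : forall m z, `|psi m z| <= B.
Hypothesis psi0B : forall z, `|psi0 z| <= B.
Hypothesis cpsi : forall m, continuous (psi m).
Hypothesis cpsi0 : continuous psi0.
Hypothesis psi_cvg : forall (z : P) (e : R), 0 < e -> exists j : nat,
  nbhs z [set z' | forall m, (j <= m)%N -> `|psi m z' - psi0 z'| <= e].

Let gap_bound m z : `|psi m z - psi0 z| <= 2 * B.
Proof.
apply: le_trans (ler_normB _ _) _.
by rewrite mulrDl mul1r lerD.
Qed.

(** Pointwise convergence that is uniform near every point is upgraded to a
    bound by continuous functions, by a Lipschitz regularisation: [Psi j z] is
    the supremum over [m >= j] and [z'] of
    [`|psi m z' - psi0 z'| - j%:R * dist z z']. It is [j]-Lipschitz and
    bounds the gap at [z' = z]; it tends to 0 because the penalty discards all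
    points except those near [z], where the gap is small. *)
Lemma modulus_exists : exists Psi : nat -> P -> R,
  [/\ forall j, continuous (Psi j),
      forall j z, 0 <= Psi j z <= 2 * B,
      forall j m z, (j <= m)%N -> `|psi m z - psi0 z| <= Psi j z &
      forall z, Psi j z @[j --> \oo] --> (0 : R)].
Proof.
have [_ [dist [[d0 dC dT] [nE _]]]] := hP.
have dxx x : dist x x = 0 by exact/d0.
have d_ge0 x y : 0 <= dist x y.
  by have := dT x y x; rewrite dxx (dC y x); lra.
pose S j z := [set r | exists m z', (j <= m)%N /\
  r = `|psi m z' - psi0 z'| - j%:R * dist z z'].
have S0 j z : S j z (`|psi j z - psi0 z|).
  by exists j, z; rewrite dxx mulr0 subr0.
have Sub j z : ubound (S j z) (2 * B).
  move=> _ [m [z' [_ ->]]]; apply: le_trans (gap_bound m z').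
  by rewrite gerBl mulr_ge0.
have Ssup j z : has_sup (S j z) by split; [exists (`|psi j z - psi0 z|)|exists (2 * B)].
have Sle j z r : S j z r -> r <= sup (S j z) by apply: ub_le_sup; exists (2 * B).
have lip j z y : sup (S j z) <= sup (S j y) + j%:R * dist z y.
  apply: ge_sup; first by exists (`|psi j z - psi0 z|).
  move=> _ [m [z' [jm ->]]].
  have : `|psi m z' - psi0 z'| - j%:R * dist y z' <= sup (S j y).
    by apply: Sle; exists m, z'.
  have : j%:R * dist y z' <= j%:R * dist z y + j%:R * dist z z' :> R.
    by rewrite -mulrDr ler_wpM2l// (dC z y); exact: dT.
  lra.
exists (fun j z => sup (S j z)); split.
- move=> j z; apply/cvgrPdist_le => e e0.
  apply/nE; exists (e / j.+1%:R); first by rewrite divr_gt0.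
  move=> y /=; rewrite ltr_pdivlMr// => zy.
  have jd : j%:R * dist z y <= e.
    apply: le_trans (ltW zy); rewrite mulrC ler_wpM2l// ler_nat.
    exact: leqnSn.
  have := lip j z y; have := lip j y z; rewrite (dC y z) => h1 h2.
  by rewrite ler_norml; apply/andP; split; lra.
- move=> j z; apply/andP; split.
    by apply: le_trans (Sle _ _ _ (S0 j z)).
  by apply: ge_sup => //; exists (`|psi j z - psi0 z|).
- by move=> j m z jm; apply: Sle; exists m, z; rewrite dxx mulr0 subr0.
move=> z; apply/cvgrPdist_le => e e0.
have [j0 /nE[r r0 rV]] := psi_cvg z e0.
have B0 : 0 <= B by exact: le_trans (psi0B z).
near=> j; rewrite sub0r normrN ger0_norm; last first.
  by apply: le_trans (Sle _ _ _ (S0 j z)).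
apply: ge_sup; first by exists (`|psi j z - psi0 z|).
move=> _ [m [z' [jm ->]]].
have jd : 0 <= j%:R * dist z z' by rewrite mulr_ge0.
have [zr|rz] := ltP (dist z z') r.
  have : `|psi m z' - psi0 z'| <= e.
    by apply: rV => //; apply: leq_trans jm; near: j; exact: nbhs_infty_ge.
  lra.
have : 2 * B <= j%:R * dist z z'.
  apply: (@le_trans _ _ (j%:R * r)); last by rewrite ler_wpM2l.
  rewrite -ler_pdivrMr//; apply: ltW; apply: lt_le_trans (truncnS_gt _) _.
  by rewrite ler_nat; near: j; exact: nbhs_infty_ge.
have := gap_bound m z'; lra.
Unshelve. all: by end_near. Qed.

(** The gap between [psi m] and [psi0] is at most [Psi j], a fixed bounded
    continuous function against which weak convergence applies; its integral
    against [gamma] is small for large [j]. *)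
Lemma slutsky_integral (mu : nat -> fmeas R P) (gamma : fmeas R P) :
  (mu : nat -> measures R P) @ \oo --> (gamma : measures R P) ->
  \int[mu m]_(z in [set: borel P]) psi m z @[m --> \oo] -->
    (\int[gamma]_(z in [set: borel P]) psi0 z : R).
Proof.
move=> mug; have [Psi [cPsi PsiB psiPsi Psi0]] := modulus_exists.
have PsiN j z : `|Psi j z| <= 2 * B.
  by have /andP[h1 h2] := PsiB j z; rewrite ger0_norm.
have ipsi m (nu : fmeas R P) : nu.-integrable [set: borel P] (EFin \o psi m).
  by apply: (bounded_integrable nu (continuous_borel (@cpsi m))) => x; exact: psiB.
have ipsi0 (nu : fmeas R P) : nu.-integrable [set: borel P] (EFin \o psi0).
  by apply: (bounded_integrable nu (continuous_borel cpsi0)) => x; exact: psi0B.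
have iPsi j (nu : fmeas R P) : nu.-integrable [set: borel P] (EFin \o Psi j).
  by apply: (bounded_integrable nu (continuous_borel (@cPsi j))) => x; exact: PsiN.
have Ic : \int[gamma]_(z in [set: borel P]) Psi j z @[j --> \oo] --> (0 : R).
  have [//|||||_ _] := @dominated_convergence _ (borel P) R gamma setT measurableT
    (fun j z => (Psi j z)%:E) (fun=> 0%E) (cst (2 * B)%:E).
  - by move=> j; apply/measurable_EFinP; exact: continuous_borel.
  - exact: measurable_cst.
  - apply: aeW => z _; apply: cvg_EFin; first by apply: nearW.
    exact: Psi0.
  - have := @bounded_integrable _ (borel P) R gamma (cst (2 * B)) `|2 * B|.
    by apply => //; exact: measurable_cst.
  - by apply: aeW => z j _; rewrite /= lee_fin.
  by rewrite integral0 => /fine_cvg.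
apply/cvgrPdist_le => e e0.
have e4 : 0 < e / 4 by rewrite divr_gt0.
have /cvgrPdist_le /(_ _ e4) [j _ /(_ j (leqnn j)) /=] := Ic.
rewrite sub0r normrN => Ij.
have := measures_cvg_integral (FF := eventually_filter) mug (@cPsi j) (PsiN j).
move=> /cvgrPdist_le /(_ _ e4) H1.
have := measures_cvg_integral (FF := eventually_filter) mug cpsi0 psi0B.
move=> /cvgrPdist_le /(_ _ e4) H2.
near=> m.
have : `|\int[mu m]_(z in [set: borel P]) psi m z - \int[mu m]_(z in [set: borel P]) psi0 z|
   <= \int[mu m]_(z in [set: borel P]) Psi j z.
  rewrite -RintegralB; [|exact: measurableT|exact: ipsi|exact: ipsi0].
  apply: (@le_trans _ _
    (\int[mu m]_(z in [set: borel P]) `|psi m z - psi0 z|)).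
    apply: le_normr_Rintegral => //.
    by have := integrableB measurableT (ipsi m (mu m)) (ipsi0 (mu m)).
  apply: le_Rintegral; [exact: measurableT| |exact: iPsi|].
    apply: integrable_norm => //.
    by have := integrableB measurableT (ipsi m (mu m)) (ipsi0 (mu m)).
  move=> z _; apply: psiPsi; near: m; exact: nbhs_infty_ge.
have : `|\int[gamma]_(z in [set: borel P]) Psi j z - \int[mu m]_(z in [set: borel P]) Psi j z| <= e / 4.
  by near: m.
have : `|\int[gamma]_(z in [set: borel P]) psi0 z - \int[mu m]_(z in [set: borel P]) psi0 z| <= e / 4.
  by near: m.
move: Ij.
rewrite !ler_norml => /andP[? ?] /andP[? ?] /andP[? ?] /andP[? ?].
by apply/andP; split; lra.
Unshelve. all: by end_near. Qed.

End slutsky.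

(** * The transition operator of a Markov chain *)

Section markov_operator.
Context d (T : measurableType d) (R : realType) (K : R.-pker T ~> T).
Implicit Types (v : T -> R) (B : R) (mu : probability T R).

Definition bmeas B v := measurable_fun setT v /\ forall x, `|v x| <= B.

Lemma bmeas_integrable (mu : {finite_measure set T -> \bar R}) B v :
  bmeas B v -> mu.-integrable setT (EFin \o v).
Proof. by move=> [mv vB]; exact: bounded_integrable mv vB. Qed.

Lemma bmeas_cst c : bmeas `|c| (fun=> c).
Proof. by split. Qed.

Lemma bmeasD B1 B2 u v : bmeas B1 u -> bmeas B2 v -> bmeas (B1 + B2) (u \+ v).
Proof.
move=> [mu uB] [mv vB]; split; first exact: measurable_funD.
by move=> x; apply: le_trans (ler_normD _ _) _; exact: lerD.
Qed.

Lemma bmeasB B1 B2 u v : bmeas B1 u -> bmeas B2 v -> bmeas (B1 + B2) (u \- v).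
Proof.
move=> [mu uB] [mv vB]; split; first exact: measurable_funB.
by move=> x; apply: le_trans (ler_normB _ _) _; exact: lerD.
Qed.

Lemma bmeasZ B c v : bmeas B v -> bmeas (`|c| * B) (fun x => c * v x).
Proof.
move=> [mv vB]; split; first exact: measurable_funM.
by move=> x; rewrite normrM ler_wpM2l.
Qed.

Definition trans v x : R := \int[K x]_(y in setT) v y.

Lemma Rintegral_prob_cst mu c : \int[mu]_(x in setT) c = c :> R.
Proof.
rewrite Rintegral_cst// (_ : fine _ = 1) ?mulr1//.
by rewrite -[RHS]/(fine 1%E); congr fine; exact: probability_setT.
Qed.

Lemma Rintegral_prob_bound mu B v : bmeas B v -> `|\int[mu]_(x in setT) v x| <= B.
Proof.
move=> vB; have iv := bmeas_integrable mu vB; have [mv vb] := vB.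
apply: le_trans (le_normr_Rintegral _ iv) _ => //.
rewrite -[leRHS](Rintegral_prob_cst mu); apply: le_Rintegral => //.
  exact: (integrable_norm iv).
exact: (bmeas_integrable _ (bmeas_cst B)).
Qed.

(** A synonym of [K x] that carries the structure of a probability measure. *)
Definition ker_prob (x : T) : set T -> \bar R := K x.

Let ker_prob0 x : ker_prob x set0 = 0%E. Proof. exact: measure0. Qed.
Let ker_prob_ge0 x A : (0 <= ker_prob x A)%E. Proof. exact: measure_ge0. Qed.
Let ker_prob_sigma_additive x : semi_sigma_additive (ker_prob x).
Proof. exact: measure_semi_sigma_additive. Qed.
HB.instance Definition _ x := isMeasure.Build _ _ _ (ker_prob x)
  (ker_prob0 x) (ker_prob_ge0 x) (@ker_prob_sigma_additive x).
Let ker_probT x : ker_prob x setT = 1%E. Proof. exact: prob_kernel. Qed.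
HB.instance Definition _ x :=
  Measure_isProbability.Build _ _ _ (ker_prob x) (ker_probT x).

Lemma trans_ker v x : trans v x = \int[ker_prob x]_(y in setT) v y.
Proof. by congr fine; apply: eq_measure_integral. Qed.

Lemma Rintegral_shift (mu : probability T R) B c v : bmeas B v ->
  \int[mu]_(x in setT) (v x + c) = \int[mu]_(x in setT) v x + c.
Proof.
move=> vB; rewrite RintegralD//; last exact: (bmeas_integrable _ (bmeas_cst c)).
  by rewrite Rintegral_prob_cst.
exact: bmeas_integrable vB.
Qed.

Lemma bmeas_trans B v : bmeas B v -> bmeas B (trans v).
Proof.
move=> vB; split; last by move=> x; rewrite trans_ker; exact: Rintegral_prob_bound.
have [mv vb] := vB.
have v0 y : 0 <= v y + B by have := vb y; rewrite ler_norml => /andP[? _]; lra.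
have -> : trans v = (fun x => fine (\int[K x]_y (v y + B)%:E)%E - B).
  apply/funext => x; rewrite trans_ker -(addrK B (\int[_]_(_ in _) _)).
  by rewrite -(Rintegral_shift _ _ vB) /Rintegral.
apply: measurable_funB => //; apply: measurableT_comp => //.
apply: measurable_fun_integral_kernel.
- by move=> U mU; exact: measurable_kernel.
- by move=> y; rewrite lee_fin.
- by apply/measurable_EFinP; exact: measurable_funD.
Qed.

Lemma trans_cst c x : trans (fun=> c) x = c.
Proof. by rewrite trans_ker Rintegral_prob_cst. Qed.

Lemma trans_lin B1 B2 u v (a b : R) x : bmeas B1 u -> bmeas B2 v ->
  trans (fun y => a * u y + b * v y) x = a * trans u x + b * trans v x.
Proof.
move=> uB vB; rewrite !trans_ker RintegralD//.
- rewrite !RintegralZl//; [exact: bmeas_integrable vB|exact: bmeas_integrable uB].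
- exact: bmeas_integrable (bmeasZ _ uB).
- exact: bmeas_integrable (bmeasZ _ vB).
Qed.

Lemma integral_chain_step (mu : probability T R) B v : bmeas B v ->
  \int[chain_step K mu]_(x in setT) v x = \int[mu]_(x in setT) trans v x.
Proof.
move=> vB; have [mv vb] := vB.
have v0 y : 0 <= v y + B by have := vb y; rewrite ler_norml => /andP[? _]; lra.
apply: (addIr B); rewrite -(Rintegral_shift _ _ vB).
rewrite -(Rintegral_shift _ _ (bmeas_trans vB)) /Rintegral; congr fine.
(* A step of the chain is the composition of the constant kernel [mu] with
   [K]; adding [B] reduces the integration formula to nonnegative functions. *)
pose l : R.-sfker unit ~> T :=
  kprobability (measurable_cst (mu : pprobability T R)).
pose k : R.-sfker (unit * T) ~> T := @kernel.kernel_snd _ _ _ unit T T R K.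
transitivity (\int[kcomp l k tt]_x (v x + B)%:E)%E.
  by apply: eq_measure_integral.
rewrite integral_kcomp; first last.
- by apply/measurable_EFinP; exact: measurable_funD.
- by move=> y; rewrite lee_fin.
rewrite [LHS](_ : _ = \int[mu]_y (\int[k (tt, y)]_z (v z + B)%:E))%E; last first.
  by apply: eq_measure_integral.
apply: eq_integral => x _.
rewrite trans_ker -(Rintegral_shift _ _ vB) /Rintegral fineK.
  by apply: eq_measure_integral.
apply: integrable_fin_num => //.
exact: bmeas_integrable (bmeasD vB (bmeas_cst B)).
Qed.

Lemma bmeas_iter_trans B v n : bmeas B v -> bmeas B (iter n trans v).
Proof. by move=> vB; elim: n => // n; exact: bmeas_trans. Qed.

Lemma integral_chain_law (mu : probability T R) B v n : bmeas B v ->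
  \int[chain_law K mu n]_(x in setT) v x = \int[mu]_(x in setT) iter n trans v x.
Proof.
elim: n v => // n IH v vB.
rewrite [LHS](_ : _ = \int[chain_law K mu n]_(x in setT) trans v x).
  by rewrite IH -?iterSr//; exact: bmeas_trans.
exact: integral_chain_step vB.
Qed.

End markov_operator.

(** * The chain observed at Gaussian times *)

Lemma Rintegral_fimage d d' (T : measurableType d) (T' : measurableType d')
    (R : realType) (phi : T -> T') (mphi : measurable_fun setT phi)
    (mu : {finite_measure set T -> \bar R}) B (v : T' -> R) : bmeas B v ->
  \int[fimage mu mphi]_(y in setT) v y = \int[mu]_(x in setT) v (phi x).
Proof.
move=> [mv vB]; congr fine.
transitivity (\int[pushforward mu phi]_y (v y)%:E)%E.
  by apply: eq_measure_integral.
rewrite integral_pushforward//; last first.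
- apply: (bounded_integrable mu (measurableT_comp mv mphi)) => x; exact: vB.
- exact/measurable_EFinP.
Qed.

Lemma integral_standard_gaussian (R : realType) (f : measurableTypeR R -> R) B : bmeas B f ->
  (\int[normal_prob 0 1]_x (f x)%:E =
   \int[@lebesgue_measure R]_x (f x * normal_pdf 0 1 x)%:E)%E.
Proof.
move=> fB; have [mf _] := fB.
have dom := @normal_prob_dominates R 0 1.
rewrite -(Radon_Nikodym_change_of_variables dom)//=; last exact: (@bmeas_integrable _ _ R (normal_prob 0 1 : probability (measurableTypeR R) R) B f fB).
under [in RHS]eq_integral do rewrite EFinM.
apply: ae_eq_integral => //.
- by apply: emeasurable_funM; [exact/measurable_EFinP|exact: (measurable_int lebesgue_measure (Radon_Nikodym_integrable _))].
- apply: emeasurable_funM; first exact/measurable_EFinP.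
  by apply/measurable_EFinP; exact: measurable_normal_pdf.
- apply: ae_eqe_mul2l => /=.
  rewrite Radon_NikodymE//=.
  case: cid => /= h [h1 h2 h3].
  apply: integral_ae_eq => //=.
  + by apply/measurable_EFinP; exact: measurable_normal_pdf.
  + by move=> E E01 mE; rewrite -h3.
Qed.

Section ergodic_limit.
Context (R : realType) (P : ptopologicalType) (hP : polish R P) (A : affine_structure P).
Variables (K : R.-pker borel P ~> borel P).
Variables (a : nat -> scalars A) (b : nat -> shifts A) (gamma : probability (borel P) R).
Hypothesis herg : ergodic K a b gamma.
Variables (f : R -> shifts A) (g : R -> scalars A) (mf : borel_fun f) (mg : borel_fun g).
Hypothesis hreg : sqrt_regular a b f g.
Variables (h : P -> R) (B : R).
Hypothesis ch : continuous h.
Hypothesis hB : forall x, `|h x| <= B.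

Definition observable (m : nat) (y : borel P) : R := h (rescale (a m) (b m) y).

Lemma bmeas_h : bmeas B (h : borel P -> R).
Proof. by split; [exact: continuous_borel|exact: hB]. Qed.

Lemma bmeas_observable m : bmeas B (observable m).
Proof.
split; last by move=> x; exact: hB.
exact: measurableT_comp (continuous_borel ch) (measurable_rescale _ _ ).
Qed.

(** The conditional mean of h(Gamma g(Lambda) + f(Lambda)) given Lambda = x. *)
Definition fibre_mean (x : R) : R :=
  \int[gamma]_(z in [set: borel P]) h (translate (scale (g x) z) (f x)).

Let recomb := measurable_recombine hP mf mg.

Let bmeas_recomb : bmeas B (fun p : borel P * R => h (translate (scale (g p.2) p.1) (f p.2))).
Proof.
split; last by move=> x; exact: hB.
exact: measurableT_comp (continuous_borel ch) recomb.
Qed.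

Lemma bmeas_fibre_mean : bmeas B fibre_mean.
Proof.
have [mr rB] := bmeas_recomb.
split; last first.
  move=> x; apply: Rintegral_prob_bound; split; last by move=> z; exact: hB.
  exact: measurableT_comp mr (measurable_pair2 x).
apply: measurableT_comp => //.
apply: (@measurable_fubini_G _ _ _ _ R gamma (standard_gaussian R)
  (fun p => (h (translate (scale (g p.2) p.1) (f p.2)))%:E)).
have := @bmeas_integrable _ _ R ((gamma \x standard_gaussian R)%E : probability _ R) _ _ bmeas_recomb.
by [].
Qed.

Lemma integral_mixture_law :
  \int[mixture_law hP mf mg gamma]_(x in [set: borel P]) h x =
  \int[standard_gaussian R]_(x in setT) fibre_mean x.
Proof.
rewrite (Rintegral_fimage _ _ bmeas_h) /Rintegral; congr fine.
rewrite -(@integral21_prod_meas1 _ _ _ _ R gamma (standard_gaussian R)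
  (fun p => (h (translate (scale (g p.2) p.1) (f p.2)))%:E)); last first.
  exact: @bmeas_integrable _ _ R ((gamma \x standard_gaussian R)%E : probability _ R) _ _ bmeas_recomb.
apply: eq_integral => x _; rewrite /fibre_mean /Rintegral fineK//.
apply: integrable_fin_num => //.
apply: bmeas_integrable; split; last by move=> z; exact: hB.
have [mr rB] := bmeas_recomb.
exact: measurableT_comp mr (measurable_pair2 x).
Qed.

Lemma mixture_mean_le :
  `|\int[mixture_law hP mf mg gamma]_(x in [set: borel P]) h x| <= B.
Proof.
rewrite integral_mixture_law.
exact: (Rintegral_prob_bound (standard_gaussian R) bmeas_fibre_mean).
Qed.

(** Normalising with the constants of time [m] is normalising with those of
    time [k], followed by the affine map whose coefficients are the two
    quantities controlled by the regularity of [a] and [b]. *)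
Lemma rescale_change (m k : nat) (y : P) :
  rescale (a m) (b m) y =
  translate (scale (a k * (a m)^-1)%g (rescale (a k) (b k) y))
    (sscale (a m)^-1%g (b k - b m)).
Proof.
have E : ((a k * (a m)^-1) * (a k)^-1 = (a m)^-1)%g.
  by rewrite (scalC (a k)) -mulgA mulgV mulg1.
by rewrite /rescale -scaleM E -scale_translate -translateD addrA addNr add0r.
Qed.

(** Joint continuity of the affine action, split into neighbourhoods of the
    three variables: the one of [z] does not depend on the coefficients, which
    is the local uniformity that [slutsky_integral] asks for. *)
Lemma affine_cvg (z : P) (s0 : scalars A) (v0 : shifts A) (e : R) : 0 < e ->
  exists V1 V2 V3, [/\ nbhs s0 V1, nbhs z V2, nbhs v0 V3 &
    forall s z' v, V1 s -> V2 z' -> V3 v ->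
      `|h (translate (scale s z') v) - h (translate (scale s0 z) v0)| <= e].
Proof.
move=> e0.
pose Phi (p : scalars A * P * shifts A) := translate (scale p.1.1 p.1.2) p.2.
have cPhi : {for (s0, z, v0), continuous (h \o Phi)}.
  by apply: continuous_comp; [exact: affine_continuous|exact: ch].
have := cPhi; move=> /cvgrPdist_le /(_ _ e0) [[W V3]] /=.
move=> [[[V1 V2] /= [V1s V2z] VW] V3v] WV.
exists V1, V2, V3; split => // s z' v Vs Vz' Vv.
by rewrite distrC; apply: (WV (s, z', v)); split => //=; exact: VW.
Qed.

Let idx (x : R) (m : nat) := Num.truncn (m%:R + x * Num.sqrt m%:R).

Lemma idx_cvg x : idx x m @[m --> \oo] --> \oo.
Proof.
apply/cvgrnyP; apply/cvgryPge => M; near=> m.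
have m0 : (0 : R) < m%:R by rewrite ltr0n; near: m; exact: nbhs_infty_gt.
have s0 : 0 < Num.sqrt (m%:R : R) by rewrite sqrtr_gt0.
have sq : Num.sqrt m%:R * Num.sqrt m%:R = m%:R :> R by rewrite -expr2 sqr_sqrtr// ltW.
have sx : 2 * `|x| <= Num.sqrt m%:R.
  rewrite -[leLHS]ger0_norm ?mulr_ge0// -sqrtr_sqr ler_wsqrtr//.
  apply: ltW; apply: lt_le_trans (truncnS_gt _) _; rewrite ler_nat.
  by near: m; exact: nbhs_infty_ge.
have mM : 2 * (M + 1) <= m%:R.
  apply: ltW; apply: lt_le_trans (truncnS_gt _) _; rewrite ler_nat.
  by near: m; exact: nbhs_infty_ge.
have q : M + 1 <= m%:R + x * Num.sqrt m%:R.
  have := lerNnormlW (lexx `|x|); nra.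
have [q0|q0] := leP 0 (m%:R + x * Num.sqrt m%:R).
  by have /andP[_] := truncn_itv q0; rewrite -natr1 -/(idx x m); lra.
apply: (@le_trans _ _ 0) => //; lra.
Unshelve. all: by end_near. Qed.

(** After m + x sqrt m steps the chain, normalised with its own constants, is
    close in law to [gamma] by ergodicity; [rescale_change] passes to the
    constants of time [m], and the coefficients of the affine map tend to
    [g x] and [f x]. *)
Lemma observable_path_cvg (mu0 : probability (borel P) R) :
  {ae @lebesgue_measure R, forall x,
    \int[chain_law K mu0 (idx x m)]_(y in setT) observable m y
      @[m --> \oo] --> fibre_mean x}.
Proof.
apply: (@filterS _ _ (ae_filter_ringOfSetsType (@lebesgue_measure R)) _ _ _ hreg) => x.
move=> /(_ (fun=> 0)) []; first by apply/eqoP => e e0; near=> n; rewrite normr0 mulr_ge0// ltW.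
have idxE m : Num.truncn (m%:R + x * Num.sqrt m%:R + 0) = idx x m by rewrite addr0.
move=> fc gc.
pose al m := (a (idx x m) * (a m)^-1)%g.
pose v m := sscale (a m)^-1%g (b (idx x m) - b m).
have {}fc : v m @[m --> \oo] --> f x.
  by move: fc; apply: cvg_trans; apply: near_eq_cvg; apply: nearW => m; rewrite idxE.
have {}gc : al m @[m --> \oo] --> g x.
  by move: gc; apply: cvg_trans; apply: near_eq_cvg; apply: nearW => m; rewrite idxE.
pose psi m (z : P) := h (translate (scale (al m) z) (v m)).
pose psi0 (z : P) := h (translate (scale (g x) z) (f x)).
pose nu m : fmeas R P := Theta (a (idx x m)) (b (idx x m)) (chain_law K mu0 (idx x m)).
have nug : (nu : nat -> measures R P) @ \oo --> (gamma : measures R P).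
  exact: cvg_comp (idx_cvg x) (herg mu0).
have c1 (s : scalars A) (w : shifts A) : continuous (fun z : P => h (translate (scale s z) w)).
  move=> z; apply/cvgrPdist_le => e e0.
  have [V1 [V2 [V3 [V1s V2z V3v H]]]] := affine_cvg z s w e0.
  apply: filterS V2z => z' V2z'; rewrite distrC.
  by apply: H => //; exact: nbhs_singleton.
have pc (z : P) (e : R) : 0 < e -> exists j : nat,
    nbhs z [set z' | forall m, (j <= m)%N -> `|psi m z' - psi0 z'| <= e].
  move=> e0; have e20 : 0 < e / 2 by rewrite divr_gt0.
  have [V1 [V2 [V3 [V1s V2z V3v H]]]] := affine_cvg z (g x) (f x) e20.
  have [j1 _ J1] := gc _ V1s; have [j3 _ J3] := fc _ V3v.
  exists (maxn j1 j3); apply: filterS V2z => z' V2z' m.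
  rewrite geq_max => /andP[m1 m3].
  have h1 := H (al m) z' (v m) (J1 _ m1) V2z' (J3 _ m3).
  have h2 := H (g x) z' (f x) (nbhs_singleton V1s) V2z' (nbhs_singleton V3v).
  move: h1 h2; rewrite /psi /psi0 !ler_norml => /andP[? ?] /andP[? ?].
  by apply/andP; split; lra.
have := @slutsky_integral R P hP psi psi0 B (fun m z => hB _) (fun z => hB _)
  (fun m => c1 _ _) (c1 _ _) pc nu gamma nug.
apply: cvg_trans; apply: near_eq_cvg; apply: nearW => m.
have bp : bmeas B (psi m : borel P -> R).
  by split; [apply: (@continuous_borel R P (psi m)); exact: c1|move=> z; exact: hB].
rewrite /nu /Theta (Rintegral_fimage _ _ bp).
by apply: eq_Rintegral => y _; rewrite /psi /observable (rescale_change m (idx x m)).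
Unshelve. all: by end_near. Qed.

End ergodic_limit.

Section poisson_steps.
Context (R : realType) (P : ptopologicalType) (hP : polish R P) (A : affine_structure P).
Variables (K : R.-pker borel P ~> borel P).
Variables (a : nat -> scalars A) (b : nat -> shifts A) (gamma : probability (borel P) R).
Hypothesis herg : ergodic K a b gamma.
Variables (f : R -> shifts A) (g : R -> scalars A) (mf : borel_fun f) (mg : borel_fun g).
Hypothesis hreg : sqrt_regular a b f g.
Variables (h : P -> R) (B : R).
Hypothesis ch : continuous h.
Hypothesis hB : forall x, `|h x| <= B.

Let c : R := \int[mixture_law hP mf mg gamma]_(x in [set: borel P]) h x.

Let obs_mean (mu0 : probability (borel P) R) (m k : nat) : R :=
  \int[chain_law K mu0 k]_(y in setT) observable a b h m y.

Let obs_mean_le mu0 m k : `|obs_mean mu0 m k| <= B.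
Proof. by apply: Rintegral_prob_bound; exact: bmeas_observable. Qed.

Let cE : c = \int[standard_gaussian R]_(x in setT) fibre_mean gamma f g h x.
Proof. exact: integral_mixture_law hB. Qed.

Let bphi : bmeas B (fibre_mean gamma f g h).
Proof. exact: bmeas_fibre_mean hB. Qed.

Let c_le : `|c| <= B.
Proof. exact: mixture_mean_le. Qed.

Let centred_gauss0 :
  (\int[@lebesgue_measure R]_x
     ((fibre_mean gamma f g h x - c) * expR (- (x ^+ 2 / 2)))%:E = 0)%E.
Proof.
have bc := bmeasB bphi (@bmeas_cst _ _ R c).
have p0 := normal_peak_gt0 (oner_neq0 R).
have := integral_standard_gaussian bc.
have -> : (\int[normal_prob 0 1]_x (fibre_mean gamma f g h x - c)%:E = 0)%E.
  have ib := @bmeas_integrable _ _ R (standard_gaussian R) _ _ bc.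
  rewrite -[LHS]fineK; last exact: integrable_fin_num ib.
  congr EFin; rewrite -/(Rintegral _ _ _) RintegralB//.
  - by rewrite Rintegral_prob_cst cE subrr.
  - exact: (@bmeas_integrable _ _ R (standard_gaussian R) _ _ bphi).
  - exact: (@bmeas_integrable _ _ R (standard_gaussian R) _ _ (@bmeas_cst _ _ R c)).
move=> E0.
transitivity (\int[@lebesgue_measure R]_x ((normal_peak 1)^-1%:E *
  ((fibre_mean gamma f g h x - c) * normal_pdf 0 1 x)%:E))%E.
  apply: eq_integral => x _; rewrite normal_pdf01E -EFinM; congr EFin.
  by field; rewrite lt0r_neq0.
rewrite integralZl//; first by rewrite -E0 mule0.
have [mphi phiB] := bc.
have mpdf := measurable_normal_pdf (0 : R) 1.
have ig : (@lebesgue_measure R).-integrable setT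
    (fun x => (B + `|c|)%:E * (normal_pdf 0 1 x)%:E)%E.
  by apply: integrableZl => //; exact: integrable_normal_pdf.
apply: (le_integrable measurableT _ _ ig).
- by apply/measurable_EFinP; exact: measurable_funM.
- move=> x _; rewrite -EFinM /= lee_fin normrM.
  have B0 : 0 <= B by exact: le_trans c_le.
  rewrite [leRHS]ger0_norm ?mulr_ge0 ?normal_pdf_ge0 ?addr_ge0//.
  by rewrite (ger0_norm (normal_pdf_ge0 _ _ _)) ler_wpM2r ?normal_pdf_ge0//; exact: phiB.
Qed.

(** The integral of [fibre_mean] against the Gaussian law is [c], so that the
    centred observable has a vanishing limit integral in [pois_sum_cvg0]. The
    times [n] at which the size conditions of that lemma fail are finitely
    many, and removed by a shift. *)
Lemma pois_chain_cvg0 (mu0 : probability (borel P) R) (t : nat -> nat)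
    (l : nat -> R) (D : R) (N : nat -> nat) :
  t n @[n --> \oo] --> \oo ->
  (\forall n \near \oo, `|l n - (t n)%:R| <= D) ->
  (forall n, (2 * t n <= N n)%N) ->
  \sum_(k < N n) pois (l n) k * (obs_mean mu0 (t n) k - c) @[n --> \oo]
    --> (0 : R).
Proof.
move=> ty lD tN.
have h64 := ty _ (nbhs_infty_ge 64).
have hD := ty _ (nbhs_infty_ge (Num.truncn (8 * D)).+1).
have [n0 _ n0P] : \forall n \near \oo, [/\ `|l n - (t n)%:R| <= D, (64 <= t n)%N &
    8 * D <= (t n)%:R].
  near=> n; split.
  - by near: n; exact: lD.
  - by near: n; exact: h64.
  - apply: ltW; apply: lt_le_trans (truncnS_gt _) _; rewrite ler_nat.
    by near: n; exact: hD.
pose t' n := t (n + n0)%N.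
have n0P' n := n0P (n + n0)%N (leq_addl _ _).
have ty' : t' n @[n --> \oo] --> \oo.
  by apply: cvg_comp ty; apply: cvg_addnr.
rewrite -(cvg_shiftn n0).
apply: (@pois_sum_cvg0 R t' (fun n => N (n + n0)%N) (fun n => l (n + n0)%N) D
  ty' _ _ _ _ (2 * B) (fun n k => obs_mean mu0 (t' n) k - c)
  (fun x => fibre_mean gamma f g h x - c)) => //.
- by move=> n; have [] := n0P' n.
- by move=> n; have [] := n0P' n.
- by move=> n; have [] := n0P' n.
- by move=> n; exact: tN.
- move=> n k; apply: le_trans (ler_normB _ _) _.
  by rewrite mulrDl mul1r; apply: lerD.
- by have [] := bmeasB bphi (@bmeas_cst _ _ R c).
- apply: (@filterS _ _ (ae_filter_ringOfSetsType (@lebesgue_measure R)) _ _ _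
    (observable_path_cvg hP herg hreg ch hB mu0)) => x Hx.
  by apply: cvgB; [exact: cvg_comp ty' Hx|exact: cvg_cst].
Unshelve. all: by end_near. Qed.

End poisson_steps.

(** * The clock of the urn *)

Section urn_clock.
Context (R : realType) (kappa : nat) (hkappa : (2 <= kappa)%N) (s0 : R).
Hypothesis hs0 : kappa%:R^-1 <= s0.

Definition gain : R := (kappa.-1)%:R / kappa%:R.
Definition mass (i : nat) : R := s0 + i%:R * gain.

Let k0 : 0 < kappa%:R :> R. Proof. by rewrite ltr0n (leq_trans _ hkappa). Qed.
Let kE : (kappa.-1)%:R = kappa%:R - 1 :> R.
Proof. by rewrite -(@natrB R _ 1) ?subn1// (leq_trans _ hkappa). Qed.
Let k1 : 1 <= kappa%:R - 1 :> R.
Proof. by rewrite -kE ler1n -ltnS prednK// (leq_trans _ hkappa). Qed.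

Lemma gain_gt0 : 0 < gain.
Proof. by rewrite /gain kE divr_gt0//; have := k1; lra. Qed.

Lemma beta_gain : beta R kappa * gain = 1.
Proof. by rewrite /beta /gain kE; field; rewrite !lt0r_neq0//; have := k1; lra. Qed.

Lemma beta_gt0 : 0 < beta R kappa.
Proof. by rewrite /beta addr_gt0// invr_gt0; have := k1; lra. Qed.

Let s0_gt0 : 0 < s0. Proof. by apply: lt_le_trans hs0; rewrite invr_gt0. Qed.

Lemma massS i : mass i.+1 = mass i + gain.
Proof. by rewrite /mass -natr1 mulrDl mul1r addrA. Qed.

Lemma mass_gt0 i : 0 < mass i.
Proof. by rewrite /mass ltr_wpDr// mulr_ge0// ltW// gain_gt0. Qed.

Lemma mass_inv_le1 i : 0 <= (mass i.+1)^-1 <= 1.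
Proof.
rewrite invr_ge0 ltW ?mass_gt0//= invf_le1 ?mass_gt0// /mass.
have : gain <= i.+1%:R * gain by rewrite ler_peMl ?(ltW gain_gt0)// ler1n.
have : kappa%:R^-1 + gain = 1 by rewrite /gain kE; field; exact: lt0r_neq0.
by have := hs0; lra.
Qed.

(** An approximation of the probability [(mass i.+1)^-1] whose sums telescope;
    it is the parameter of the Poisson variable compared with step [i]. *)
Definition tick i : R := beta R kappa * (ln (mass i.+1) - ln (mass i)).

Lemma tick_le i : tick i <= (mass i)^-1.
Proof.
have m0 := mass_gt0 i; have m1 := mass_gt0 i.+1; have b0 := beta_gt0.
rewrite /tick -ln_div// -ler_pdivlMl//.
have -> : mass i.+1 / mass i = 1 + gain / mass i.
  by rewrite massS; field; exact: lt0r_neq0.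
apply: le_trans (le_ln1Dx _) _.
  by apply: (@lt_le_trans _ _ 0); rewrite ?ltrN10// divr_ge0 ?ltW// gain_gt0.
have -> : gain = (beta R kappa)^-1 by rewrite -[LHS](mulKf (lt0r_neq0 b0)) beta_gain mulr1.
by [].
Qed.

Lemma tick_ge i : (mass i.+1)^-1 <= tick i.
Proof.
have m0 := mass_gt0 i; have m1 := mass_gt0 i.+1; have b0 := beta_gt0.
have E : mass i / mass i.+1 = 1 + (- (gain / mass i.+1)).
  rewrite -[mass i](addrK gain) -massS; field; exact: lt0r_neq0.
rewrite /tick -opprB -ln_div// E mulrN lerNr.
rewrite -ler_pdivlMl//; apply: le_trans (le_ln1Dx _) _.
  by rewrite ltrNl opprK ltr_pdivrMr// mul1r massS ltrDr.
have -> : gain = (beta R kappa)^-1 by rewrite -[LHS](mulKf (lt0r_neq0 b0)) beta_gain mulr1.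
by rewrite mulrN.
Qed.

(** Telescoping bound: the sum of the squares over all steps after [i] is
    O(1 / mass i). *)
Lemma mass_sqr_le i : (mass i)^-1 ^+ 2 <=
  (1 + gain / s0) * beta R kappa * ((mass i)^-1 - (mass i.+1)^-1).
Proof.
have m0 := mass_gt0 i; have m1 := mass_gt0 i.+1; have b0 := beta_gt0.
have -> : (mass i)^-1 - (mass i.+1)^-1 = gain / (mass i * mass i.+1).
  by rewrite massS; field; rewrite -massS !lt0r_neq0.
rewrite mulrA -(mulrA _ _ gain) beta_gain mulr1.
rewrite ler_pdivlMr ?mulr_gt0//.
have -> : (mass i)^-1 ^+ 2 * (mass i * mass i.+1) = 1 + gain / mass i.
  by rewrite massS; field; exact: lt0r_neq0.
rewrite lerD2l ler_wpM2l ?(ltW gain_gt0)// lef_pV2 ?posrE//.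
by rewrite /mass lerDl mulr_ge0// ltW// gain_gt0.
Qed.

Definition probs i n : seq R := [seq (mass j.+1)^-1 | j <- iota i (n - i)].

Lemma probs_is_prob i n : is_prob_seq (probs i n).
Proof. by move=> p /mapP[j _ ->]; exact: mass_inv_le1. Qed.

Definition err_cst : R := 2 + 3 * ((1 + gain / s0) * beta R kappa).

Lemma err_cst_ge0 : 0 <= err_cst.
Proof.
have r0 := ltW gain_gt0; have b0 := ltW beta_gt0; have s1 := ltW s0_gt0.
by rewrite /err_cst addr_ge0// mulr_ge0// mulr_ge0// addr_ge0// divr_ge0.
Qed.

(** Both the distance from [tick j] to the probability at step [j] and the
    square of [tick j] are at most a constant times the decrement of
    [(mass j)^-1], so that the error of Le Cam's inequality telescopes. *)
Lemma probs_pois_tv i n N : (i <= n)%N ->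
  \sum_(k < N) `|bern_sum (probs i n) k -
      pois (beta R kappa * (ln (mass n) - ln (mass i))) k| <=
  err_cst / mass i.
Proof.
move=> le_in.
pose pms := [seq ((mass j.+1)^-1, tick j) | j <- iota i (n - i)].
have E1 : probs i n = map fst pms by rewrite /pms -map_comp.
have E2 : beta R kappa * (ln (mass n) - ln (mass i)) = \sum_(q <- pms) q.2.
  rewrite /pms big_map /= /tick -mulr_sumr; congr (_ * _).
  have := @telescope_sumr _ i n (fun j => ln (mass j)) le_in.
  by rewrite /index_iota => ->.
rewrite E1 E2; apply: le_trans (bern_sum_pois_tv _ _) _.
  move=> _ /mapP[j _ ->]; split; first exact: mass_inv_le1.
  by apply: le_trans (tick_ge j); rewrite invr_ge0 ltW// mass_gt0.
rewrite /pms big_map /=.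
apply: (@le_trans _ _ (\sum_(j <- iota i (n - i))
    err_cst * ((mass j)^-1 - (mass j.+1)^-1))).
  apply: ler_sum => j _; rewrite /err_cst [leRHS]mulrDl.
  have h1 := tick_ge j; have h2 := tick_le j; have h3 := mass_sqr_le j.
  have h0 : 0 <= (mass j.+1)^-1 by rewrite invr_ge0 ltW// mass_gt0.
  apply: lerD.
    by rewrite ler_pM2l// ler0_norm; lra.
  rewrite -mulrA ler_pM2l//; apply: le_trans h3.
  by rewrite ler_sqr ?nnegrE//; lra.
rewrite -mulr_sumr ler_wpM2l ?err_cst_ge0//.
under eq_bigr do rewrite -opprB.
rewrite sumrN; have := @telescope_sumr _ i n (fun j => (mass j)^-1) le_in.
rewrite /index_iota => ->; rewrite opprB gerBl invr_ge0 ltW// mass_gt0//.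
Qed.

Lemma ln_mass_bound : exists D0, forall n, (0 < n)%N ->
  `|ln (mass n) - ln n%:R| <= D0.
Proof.
exists (`|ln gain| + `|ln (s0 + gain)|) => n n0.
have n0' : (0 : R) < n%:R by rewrite ltr0n.
have r0 := gain_gt0; have m0 := mass_gt0 n.
have sr0 : 0 < s0 + gain by rewrite addr_gt0.
have lo : gain <= mass n / n%:R.
  by rewrite ler_pdivlMr// mulrC /mass lerDr ltW.
have hi : mass n / n%:R <= s0 + gain.
  rewrite ler_pdivrMr// /mass mulrDl [gain * _]mulrC lerD2r.
  by rewrite ler_peMr ?ler1n// ltW.
rewrite -ln_div//.
have mn0 : 0 < mass n / n%:R by rewrite divr_gt0.
have := lo; rewrite -ler_ln ?posrE// => {}lo.
have := hi; rewrite -ler_ln ?posrE// => {}hi.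
have h1 := ler_norm (ln (s0 + gain)); have h2 := lerNnormlW (lexx `|ln gain|).
have h3 := normr_ge0 (ln (s0 + gain)); have h4 := normr_ge0 (ln gain).
by rewrite ler_norml; apply/andP; split; lra.
Qed.

Definition depth (n : nat) : nat := Num.truncn (beta R kappa * ln n%:R).

Lemma depth_cvg : depth n @[n --> \oo] --> \oo.
Proof.
apply/cvgrnyP; apply/cvgryPge => M; near=> n.
have e0 := expR_gt0 ((M + 1) / beta R kappa).
have n0 : (0 : R) < n%:R by rewrite ltr0n; near: n; exact: nbhs_infty_gt.
have : ln (expR ((M + 1) / beta R kappa)) <= ln n%:R.
  rewrite ler_ln ?posrE//; apply: ltW; apply: lt_le_trans (truncnS_gt _) _.
  by rewrite ler_nat; near: n; exact: nbhs_infty_ge.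
rewrite expRK ler_pdivrMr ?beta_gt0// mulrC => lM.
have [q0|q0] := leP 0 (beta R kappa * ln n%:R).
  by have /andP[_] := truncn_itv q0; rewrite -natr1 -/(depth n); lra.
by apply: (@le_trans _ _ 0) => //; lra.
Unshelve. all: by end_near. Qed.

(** The mass is linear in time, so that its logarithm differs from [ln n] by a
    bounded amount; [depth n] is then off by at most one more. *)
Lemma clock_depth i : exists D : R, \forall n \near \oo,
  `|beta R kappa * (ln (mass n) - ln (mass i)) - (depth n)%:R| <= D.
Proof.
have [D0 D0P] := ln_mass_bound; have b0 := beta_gt0.
exists (beta R kappa * (D0 + `|ln (mass i)|) + 1); near=> n.
have n1 : (1 <= n)%N by near: n; exact: nbhs_infty_ge.
have q0 : 0 <= beta R kappa * ln (n%:R : R).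
  by rewrite mulr_ge0 ?(ltW b0)// ln_ge0// ler1n.
have /andP[t1 t2] := truncn_itv q0.
rewrite -natr1 -/(depth n) in t2; rewrite -/(depth n) in t1.
have := D0P _ n1.
have h2 := ler_norm (ln (mass i)); have h1 := lerNnormlW (lexx `|ln (mass i)|).
rewrite !ler_norml => /andP[h3 h4].
by apply/andP; split; nra.
Unshelve. all: by end_near. Qed.

Lemma mass_cvg : mass n / n%:R @[n --> \oo] --> gain.
Proof.
have inv0 : (n%:R : R)^-1 @[n --> \oo] --> (0 : R).
  apply/gtr0_cvgV0; last exact: cvgr_idn.
  by near=> n; rewrite ltr0n; near: n; exact: nbhs_infty_gt.
have h : s0 / n%:R + gain @[n --> \oo] --> gain.
  rewrite -[X in _ --> X]add0r -[X in X + _](mulr0 s0).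
  apply: cvgD; last exact: cvg_cst.
  by apply: cvgM => //; exact: cvg_cst.
apply: cvg_trans h; apply: near_eq_cvg; near=> n.
have n0 : (n%:R : R) != 0.
  by rewrite pnatr_eq0 -lt0n; near: n; exact: nbhs_infty_gt.
by rewrite /mass; field.
Unshelve. all: by end_near. Qed.

Lemma mass_inv_cvg0 : (mass n)^-1 @[n --> \oo] --> (0 : R).
Proof.
apply/gtr0_cvgV0; first by apply: nearW => n; exact: mass_gt0.
apply/cvgryPge => M; near=> n.
have r0 := gain_gt0.
have : M / gain <= n%:R.
  apply: ltW; apply: lt_le_trans (truncnS_gt _) _; rewrite ler_nat.
  by near: n; exact: nbhs_infty_ge.
rewrite ler_pdivrMr// /mass; have := s0_gt0; lra.
Unshelve. all: by end_near. Qed.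

End urn_clock.

(** * Ancestral lines *)

Section lineage.
Context (R : realType) (kappa : nat) (hkappa : (2 <= kappa)%N) (s0 : R).
Hypothesis hs0 : kappa%:R^-1 <= s0.
Context (P : ptopologicalType) (hP : polish R P) (A : affine_structure P).
Variables (K : R.-pker borel P ~> borel P).
Variables (a : nat -> scalars A) (b : nat -> shifts A) (gamma : probability (borel P) R).
Hypothesis herg : ergodic K a b gamma.
Variables (f : R -> shifts A) (g : R -> scalars A) (mf : borel_fun f) (mg : borel_fun g).
Hypothesis hreg : sqrt_regular a b f g.
Variables (h : P -> R) (B : R).
Hypothesis ch : continuous h.
Hypothesis hB : forall x, `|h x| <= B.

Let c : R := \int[mixture_law hP mf mg gamma]_(x in [set: borel P]) h x.
Let obs n : borel P -> R := observable a b h (depth R kappa n).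

Definition lineage_mean (i n : nat) (mu0 : probability (borel P) R) : R :=
  mix (probs kappa s0 i n) (fun k => \int[mu0]_(y in setT) iter k (trans K) (obs n) y).

Let bobs n : bmeas B (obs n). Proof. exact: bmeas_observable. Qed.

Let c_le : `|c| <= B.
Proof. exact: mixture_mean_le. Qed.

Let mean_le (mu0 : probability (borel P) R) n k : `|\int[mu0]_(y in setT) iter k (trans K) (obs n) y| <= B.
Proof. exact: (Rintegral_prob_bound mu0 (bmeas_iter_trans K k (bobs n))). Qed.

(* The distance is bounded by the error of Le Cam's inequality for a start at
   time [i], which does not vanish as [n] grows, plus the Poisson average. *)
Let lineage_near (mu0 : probability (borel P) R) i e : 0 < e ->
  \forall n \near \oo, `|lineage_mean i n mu0 - c| <=
    err_cst kappa s0 / mass kappa s0 i * (2 * B) + e.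
Proof.
move=> e0; have [D HD] := clock_depth hkappa hs0 i.
have := pois_chain_cvg0 hP herg mf mg hreg ch hB mu0 (depth_cvg R hkappa) HD
  (fun n => leq_addl n.+1 (2 * depth R kappa n)).
move=> /cvgr0Pnorm_le /(_ _ e0) H; near=> n.
have le_in : (i <= n)%N by near: n; exact: nbhs_infty_ge.
rewrite /lineage_mean -[X in _ - X](mix_cst (probs kappa s0 i n)) -mixB.
rewrite (@mixE _ _ _ (n.+1 + 2 * depth R kappa n)); last first.
  by rewrite size_map size_iota ltn_addr// ltnS leq_subr.
set N := (_ + _)%N.
set L := beta R kappa * (ln (mass kappa s0 n) - ln (mass kappa s0 i)).
set u := (_ \- _).
have -> : \sum_(k < N) bern_sum (probs kappa s0 i n) k * u k =
  \sum_(k < N) (bern_sum (probs kappa s0 i n) k - pois L k) * u k +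
  \sum_(k < N) pois L k * u k.
  by rewrite -big_split; apply: eq_bigr => k _ /=; rewrite -mulrDl subrK.
apply: le_trans (ler_normD _ _) _; apply: lerD.
  apply: (@le_trans _ _ (\sum_(k < N) `|bern_sum (probs kappa s0 i n) k - pois L k| * (2 * B))).
    apply: le_trans (ler_norm_sum _ _ _) _; apply: ler_sum => k _.
    rewrite normrM ler_wpM2l// /u /=; apply: le_trans (ler_normB _ _) _.
    by rewrite mulrDl mul1r; apply: lerD.
  rewrite -mulr_suml ler_wpM2r//.
    by rewrite mulr_ge0// (le_trans _ c_le).
  exact: probs_pois_tv.
rewrite (_ : \sum_(k < N) _ = \sum_(k < N) pois L k *
    (\int[chain_law K mu0 k]_(y in setT) obs n y - c)); last first.
  apply: eq_bigr => k _; congr (_ * (_ - _)).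
  by rewrite (integral_chain_law K mu0 k (bobs n)).
rewrite /N /L /c /obs; clear u N L; near: n; exact: H.
Unshelve. all: by end_near. Qed.

Let lineage_mean_step (mu0 : probability (borel P) R) i n : (i < n)%N ->
  lineage_mean i n mu0 =
  (1 - (mass kappa s0 i.+1)^-1) * lineage_mean i.+1 n mu0 +
  (mass kappa s0 i.+1)^-1 * lineage_mean i.+1 n (chain_step K mu0).
Proof.
move=> lt_in; rewrite /lineage_mean /probs -(subnSK lt_in) /=.
congr (_ * _ + _ * _); congr mix; apply/funext => k /=.
by rewrite (integral_chain_step K mu0 (bmeas_iter_trans K k (bobs n))).
Qed.

(** One step of a lineage at time [i] is a convex combination of lineages
    started at time [i + 1], so that the limit superior of the distance to [c]
    is at most what it is for starts at a later time [J]; there [lineage_near]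
    bounds it by O(1 / mass J). *)
Lemma lineage_mean_cvg i (mu0 : probability (borel P) R) :
  lineage_mean i n mu0 @[n --> \oo] --> c.
Proof.
apply/cvgrPdist_le => e e0.
have B0 : 0 <= B by exact: le_trans c_le.
have e20 : 0 < e / 2 by rewrite divr_gt0.
have [J _ HJ] : \forall n \near \oo, err_cst kappa s0 / mass kappa s0 n * (2 * B) <= e / 2.
  have : err_cst kappa s0 * (2 * B) * (mass kappa s0 n)^-1 @[n --> \oo] --> (0 : R).
    rewrite -(mulr0 (err_cst kappa s0 * (2 * B))).
    by apply: cvgM; [exact: cvg_cst|exact: mass_inv_cvg0].
  move=> /cvgr0Pnorm_le /(_ _ e20); apply: filterS => n.
  by rewrite mulrAC; apply: le_trans; exact: ler_norm.
(* The induction moves the starting time back from [J], uniformly over the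
   starting law, which changes by one step of the chain. *)
suff H d : forall i (mu0 : probability (borel P) R), (J <= i + d)%N ->
    \forall n \near \oo, `|lineage_mean i n mu0 - c| <= e.
  by have := H J i mu0 (leq_addl _ _); apply: filterS => n; rewrite distrC.
elim: d => [|d IH] {}i {}mu0.
  rewrite addn0 => Ji; have := lineage_near mu0 i e20; apply: filterS => n.
  by move/le_trans; apply; have := HJ i Ji; lra.
rewrite addnS -addSn => Ji; near=> n.
have lt_in : (i < n)%N by near: n; exact: nbhs_infty_gt.
rewrite lineage_mean_step//.
have /andP[p0 p1] := mass_inv_le1 hkappa hs0 i.
have h1 : `|lineage_mean i.+1 n mu0 - c| <= e by near: n; exact: IH.
have h2 : `|lineage_mean i.+1 n (chain_step K mu0) - c| <= e by near: n; exact: IH.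
move: h1 h2; rewrite !ler_norml => /andP[h1 h2] /andP[h3 h4].
move: p0 p1 h1 h2 h3 h4; move: (_^-1) (lineage_mean _ _ _) (lineage_mean _ _ _).
by move=> p x y p0 p1 h1 h2 h3 h4; apply/andP; split; nra.
Unshelve. all: by end_near. Qed.

End lineage.

Section mix_functions.
Context d (T : measurableType d) (R : realType).
Variables (ps : seq R) (psP : is_prob_seq ps).

Lemma bmeas_mix (w : nat -> T -> R) B : (forall k, bmeas B (w k)) ->
  bmeas B (fun y => mix ps (w ^~ y)).
Proof.
move=> wB; split; last first.
  by move=> y; apply: mix_norm_le => // k; case: (wB k).
have mw k : measurable_fun setT (w k) by case: (wB k).
move: w mw {wB}; elim: ps => [|p ps' IH] w mw /=; first exact: mw.
apply: measurable_funD; apply: measurable_funM => //; first exact: IH.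
by apply: (IH (fun k => w k.+1)) => k; exact: mw.
Qed.
End mix_functions.

Lemma integral_mix d (T : measurableType d) (R : realType) (mu : probability T R)
    (ps : seq R) (psP : is_prob_seq ps) (w : nat -> T -> R) B :
  (forall k, bmeas B (w k)) ->
  \int[mu]_(y in setT) mix ps (w ^~ y) = mix ps (fun k => \int[mu]_(y in setT) w k y).
Proof.
elim: ps psP w => [|p ps IH] psP w wB //=.
have psP' : is_prob_seq ps by move=> q qps; apply: psP; rewrite in_cons qps orbT.
have b1 := bmeas_mix psP' wB.
have b2 := bmeas_mix psP' (fun k => wB k.+1).
rewrite (RintegralD measurableT (bmeas_integrable mu (bmeasZ _ b1))
  (bmeas_integrable mu (bmeasZ _ b2))).
rewrite (RintegralZl _ measurableT (bmeas_integrable mu b1)).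
rewrite (RintegralZl _ measurableT (bmeas_integrable mu b2)).
by rewrite (IH psP' w wB) (IH psP' (fun k => w k.+1)).
Qed.

Section lineage_operator.
Context d (T : measurableType d) (R : realType) (K : R.-pker T ~> T).
Variables (v : T -> R) (B : R) (vB : bmeas B v).

(** The mean of [v] for the chain started at [x] and run for a random number of
    steps, a sum of Bernoulli variables of parameters [ps]. *)
Definition lineage (ps : seq R) (x : T) : R := mix ps (fun k => iter k (trans K) v x).

Lemma bmeas_lineage ps : is_prob_seq ps -> bmeas B (lineage ps).
Proof. by move=> psP; apply: bmeas_mix => // k; exact: bmeas_iter_trans. Qed.

Lemma integral_lineage (mu : probability T R) ps : is_prob_seq ps ->
  \int[mu]_(y in setT) lineage ps y =
  mix ps (fun k => \int[mu]_(y in setT) iter k (trans K) v y).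
Proof.
by move=> psP; apply: (integral_mix _ psP (fun k => bmeas_iter_trans K k vB)).
Qed.

Lemma lineage_cons p ps x : is_prob_seq ps ->
  lineage (p :: ps) x = (1 - p) * lineage ps x + p * trans K (lineage ps) x.
Proof.
move=> psP; rewrite {1}/lineage /= trans_ker (integral_lineage _ psP).
congr (_ * _ + _ * _); congr mix; apply/funext => k /=.
Qed.

End lineage_operator.

(** * Reachable colours and integrality *)

Section atomic.
Context (R : realType) (P : ptopologicalType) (hP : polish R P).

Lemma polish_measurable1 (y : P) : measurable ([set y] : set (borel P)).
Proof.
have [_ [dist [[d0 dC dT] [nE _]]]] := hP.
have dxx x : dist x x = 0 by exact/d0.
have d_ge0 x z : 0 <= dist x z.
  by have := dT x z x; rewrite dxx (dC z x); lra.
rewrite -[X in measurable X]setCK; apply: measurableC; apply: sub_sigma_algebra.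
rewrite openE => x /= xy; apply/nE; exists (dist x y).
  rewrite lt_neqAle d_ge0 andbT eq_sym; apply/eqP => /d0; exact: xy.
by move=> z /= zx zy; move: zx; rewrite zy ltxx.
Qed.

Lemma polish_measurable_seq (s : seq P) : measurable ([set` s] : set (borel P)).
Proof.
elim: s => [|x s IH].
  by rewrite (_ : [set` _] = set0) ?measurable0//; apply/seteqP; split.
have -> : [set` x :: s] = [set x] `|` [set` s].
  apply/seteqP; split => y /=; rewrite in_cons.
    by move=> /orP[/eqP|]; [left|right].
  by move=> [->|ys]; rewrite ?eqxx// ys orbT.
apply: measurableU; [exact: polish_measurable1|exact: IH].
Qed.

Lemma sum_seq_indic (s : seq P) (v : P -> R) x : x \in s ->
  \sum_(y <- undup s) v y * \1_[set y] x = v x.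
Proof.
move=> xs; rewrite (bigD1_seq x)/= ?mem_undup ?undup_uniq//.
rewrite indicE mem_set//= mulr1 big1 ?addr0// => y yx.
by rewrite indicE memNset ?mulr0//= => xy; move: yx; rewrite xy eqxx.
Qed.

Lemma integral_atomic (mu : {finite_measure set (borel P) -> \bar R}) (s : seq P)
    (v : P -> R) B : bmeas B (v : borel P -> R) -> mu (~` [set` s]) = 0%E ->
  \int[mu]_(x in [set: borel P]) v x =
  \sum_(y <- undup s) v y * fine (mu [set y]).
Proof.
move=> vB mu0; have iv := bmeas_integrable mu vB.
have ms := polish_measurable_seq s.
have i1 y : mu.-integrable [set: borel P] (EFin \o (fun x => v y * \1_[set y] x)).
  apply: (@bounded_integrable _ (borel P) R mu _ `|v y|).
    apply: measurable_funM => //; apply: measurable_indic; exact: polish_measurable1.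
  move=> x; rewrite normrM ler_piMr// indicE.
  by case: (_ \in _); rewrite /= ?normr1 ?normr0.
have isum : mu.-integrable [set: borel P]
    (EFin \o (fun x => \sum_(y <- undup s) v y * \1_[set y] x)).
  rewrite (_ : _ \o _ = (fun x => \sum_(y <- undup s) (v y * \1_[set y] x)%:E)%E).
    by apply: integrable_sum => // y _; exact: i1.
  by apply/funext => x /=; rewrite sumEFin.
rewrite /Rintegral.
rewrite (negligible_integral (measurableC ms) measurableT iv mu0).
transitivity (fine (\int[mu]_(x in setT) (\sum_(y <- undup s) v y * \1_[set y] x)%:E)%E).
  congr fine.
  rewrite [RHS](negligible_integral (measurableC ms) measurableT isum mu0).
  apply: eq_integral => x; rewrite inE => -[_ /contrapT xs].
  by congr EFin; apply/esym; exact: sum_seq_indic.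
under eq_integral do rewrite -sumEFin.
rewrite integral_sum// -sum_fine.
  apply: eq_bigr => y _; under eq_integral do rewrite EFinM.
  rewrite integralZl//.
    rewrite integral_indic//; last exact: polish_measurable1.
    by rewrite setIT fineM// fin_num_measure//; exact: polish_measurable1.
  apply: (@bounded_integrable _ (borel P) R mu _ 1).
    by apply: measurable_indic; exact: polish_measurable1.
  by move=> x; rewrite indicE; case: (_ \in _); rewrite /= ?normr1 ?normr0.
move=> y _; exact: integrable_fin_num (i1 y).
Qed.

End atomic.

Section balls.
Context (R : realType) (P : ptopologicalType) (kappa : nat).
Implicit Types (u : P -> nat).

Lemma balls_set1 u y : balls R kappa u [set y] = ((u y)%:R / kappa%:R)%:E.
Proof.
rewrite /balls -(fsbig_widen [set y] setT).
- by rewrite fsbig_set1 diracE mem_set// mule1 -EFinM mulrC.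
- by [].
- by move=> x [_ /= xy]; rewrite diracE memNset ?mule0//= => yx; exact/xy/esym.
Qed.

Lemma balls_eq0 u (A : set (borel P)) : (forall y, A y -> u y = 0%N) ->
  balls R kappa u A = 0%E.
Proof.
move=> uA; rewrite /balls fsbig1 ?mule0// => y _.
have [/set_mem Ay|_] := boolP (y \in (A : set P)).
  by rewrite uA// mul0e.
by rewrite diracE/=; case: (boolP (_ \in _)) => [/set_mem/uA->|]; rewrite ?mul0e ?mule0.
Qed.

Lemma balls_setT u : finite_set [set y | u y != 0%N] ->
  exists N : nat, balls R kappa u setT = (N%:R / kappa%:R)%:E.
Proof.
move=> fu; exists (\sum_(y <- finmap.enum_fset (fset_set [set y | u y != 0%N])) u y)%N.
rewrite /balls -(fsbig_widen [set y | u y != 0%N] setT)//; last first.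
  by move=> y [_ /= /negP/negPn/eqP ->]; rewrite mul0e.
rewrite fsbig_finite//= natr_sum mulrC EFinM -sumEFin; congr (_ * _)%E.
by apply: eq_bigr => y _; rewrite diracT mule1.
Qed.

End balls.

Section reachable.
Context (R : realType) (kappa : nat) (hkappa : (2 <= kappa)%N).
Context (P : ptopologicalType) (hP : polish R P).
Variables (Rep : R.-pker borel P ~> borel P) (M0 : fmeas R P).
Hypothesis hM0 : (0 < M0 [set: borel P])%E.
Context (d : measure_display) (Omega : measurableType d) (Pr : probability Omega R).
Variables (M : nat -> Omega -> fmeas R P) (C : nat -> Omega -> borel P).
Hypothesis hM : discrete_mvpp kappa Rep M Pr C M0.

Let k0 : 0 < kappa%:R :> R. Proof. by rewrite ltr0n (leq_trans _ hkappa). Qed.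

Definition initial_mass : R := fine (M0 [set: borel P]).

Lemma initial_mass_ge : kappa%:R^-1 <= initial_mass.
Proof.
have [w [fw wE]] := mvpp_initial_discrete hM.
have [N NE] := balls_setT R kappa fw.
move: hM0; rewrite /initial_mass wE// NE lte_fin /=.
case: N {NE} => [|N _]; first by rewrite mul0r ltxx.
by rewrite ler_peMl ?ler1n ?invr_ge0 ?(ltW k0).
Qed.

Lemma initial_support_ex : exists2 s : seq P, M0 (~` [set` s]) = 0%E &
  forall y, exists k : nat, M0 [set y] = (k%:R / kappa%:R)%:E.
Proof.
have [w [fw wE]] := mvpp_initial_discrete hM.
exists (finmap.enum_fset (fset_set [set y | w y != 0%N])).
  rewrite wE; last by apply: measurableC; exact: (polish_measurable_seq hP).
  apply: balls_eq0 => y /= yn; apply/eqP/negPn/negP => wy; apply: yn.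
  by rewrite in_fset_set// inE.
move=> y; exists (w y); rewrite wE ?balls_set1//; exact: (polish_measurable1 hP).
Qed.

Lemma replacement_support_ex x : exists2 s : seq P, Rep x (~` [set` s]) = 0%E &
  forall y, exists k : nat, Rep x [set y] = (k%:R / kappa%:R)%:E.
Proof.
have [w [fw _ wE]] := mvpp_replacement_discrete hM x.
exists (finmap.enum_fset (fset_set [set y | w y != 0%N])).
  rewrite wE; last by apply: measurableC; exact: (polish_measurable_seq hP).
  apply: balls_eq0 => y /= yn; apply/eqP/negPn/negP => wy; apply: yn.
  by rewrite in_fset_set// inE.
move=> y; exists (w y); rewrite wE ?balls_set1//; exact: (polish_measurable1 hP).
Qed.

Let s_init : seq P := s2val (cid2 initial_support_ex).
Let s_rep x : seq P := s2val (cid2 (replacement_support_ex x)).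

(** A deterministic finite list of colours that carries the urn at time [n].
    It makes integrals against the random measure sums over a fixed finite set
    of colours. *)
Fixpoint colours (n : nat) : seq P :=
  if n is n'.+1 then colours n' ++ flatten [seq s_rep x | x <- colours n']
  else s_init.

Definition run_upto (n : nat) (w : Omega) : Prop :=
  [/\ forall A : set (borel P), measurable A -> M 0 w A = M0 A,
      forall n (A : set (borel P)), measurable A ->
        M n.+1 w A = (M n w A + signed_replacement kappa Rep (C n w) A)%E &
      forall j, (j < n)%N -> C j w \in colours j].

Let mcolours n : measurable (~` [set` colours n] : set (borel P)).
Proof. by apply: measurableC; exact: (polish_measurable_seq hP). Qed.

Lemma replacement_colours n x : x \in colours n ->
  Rep x (~` [set` colours n.+1]) = 0%E.
Proof.
move=> xn; have h := s2valP (cid2 (replacement_support_ex x)).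
apply/eqP; rewrite eq_le measure_ge0 andbT -h.
apply: le_measure; rewrite ?inE.
- exact: mcolours.
- by apply: measurableC; exact: (polish_measurable_seq hP).
move=> y /= yn yc; apply: yn; rewrite mem_cat; apply/orP; right.
by apply/flattenP; exists (s_rep x) => //; apply: map_f.
Qed.

Lemma colours_null_mono (mu : {measure set (borel P) -> \bar R}) n :
  mu (~` [set` colours n]) = 0%E -> mu (~` [set` colours n.+1]) = 0%E.
Proof.
move=> mu0; apply/eqP; rewrite eq_le measure_ge0 andbT -mu0.
apply: le_measure; rewrite ?inE; [exact: mcolours|exact: mcolours|].
by move=> y /= yn yc; apply: yn; rewrite mem_cat yc.
Qed.

Lemma colours_total n w : run_upto n w -> M n w (~` [set` colours n]) = 0%E.
Proof.
move=> [w0 wS wC]; elim: n wC => [|n IH] wC.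
  by rewrite w0; [exact: (s2valP (cid2 initial_support_ex))|exact: (mcolours 0)].
have Cn := wC n (ltnSn n).
rewrite wS; last exact: (mcolours n.+1).
rewrite /signed_replacement replacement_colours//.
rewrite colours_null_mono; last by apply: IH => j jn; exact: wC _ (ltnW jn).
by rewrite diracE memNset ?mule0 ?oppe0 ?adde0//= mem_cat Cn.
Qed.

(** The drawn colour is only known to lie in [colours n] and might be absent,
    so that a step only keeps the numerator an integer; positivity of the
    measure then makes it a natural number. *)
Lemma masses_integral n w y : run_upto n w ->
  exists k : nat, M n w [set y] = (k%:R / kappa%:R)%:E.
Proof.
move=> [w0 wS wC].
have m1 := @polish_measurable1 R P hP.
suff [z zE] : exists z : int, M n w [set y] = (z%:~R / kappa%:R)%:E.
  have : (0 <= M n w [set y])%E by exact: measure_ge0.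
  rewrite zE lee_fin pmulr_lge0 ?invr_gt0// ler0z => z0.
  by exists `|z|%N; rewrite natr_absz ger0_norm.
elim: n {wC} => [|n [z IH]].
  rewrite w0//; have [k ->] := s2valP' (cid2 initial_support_ex) y.
  by exists k%:Z.
rewrite wS// IH /signed_replacement.
have [k ->] := s2valP' (cid2 (replacement_support_ex (C n w))) y.
exists (z - (C n w \in [set y])%:Z + k%:Z); rewrite diracE -EFinM -EFinN -!EFinD.
congr EFin; rewrite !rmorphD /= rmorphN /= !mulrDl mulNr addrA.
by congr (_ - _ + _); rewrite mulrC.
Qed.

Lemma total_mass n w : run_upto n w ->
  M n w [set: borel P] = (mass kappa initial_mass n)%:E.
Proof.
move=> [w0 wS wC]; elim: n {wC} => [|n IH].
  by rewrite w0// /mass mul0r addr0 fineK// fin_num_measure.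
rewrite wS// IH /signed_replacement diracT prob_kernel mule1 -EFinN -!EFinD massS.
congr (_ + _)%:E; rewrite /gain -subn1 natrB ?(leq_trans _ hkappa)//.
by field; exact: lt0r_neq0.
Qed.

Lemma measurable_fine_mass n (A : set (borel P)) : measurable A ->
  measurable_fun setT (fun w => fine (M n w A)).
Proof. by move=> mA; apply: measurableT_comp => //; exact: (mvpp_measurable hM). Qed.

Lemma measurable_inv_mass n :
  measurable_fun setT (fun w => (fine (M n w [set: borel P]))^-1).
Proof.
have -> : (fun w => (fine (M n w [set: borel P]))^-1) =
    (fun w => fine (M n w [set: borel P]) `^ (-1)).
  by apply/funext => w; rewrite powR_inv1// fine_ge0.
apply: (@measurableT_comp _ _ _ _ _ _ (fun x : R => x `^ (-1))).
  exact: measurable_powR.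
exact: measurable_fine_mass.
Qed.

(** Inductively, the urn at time [n] gives no mass outside [colours n], hence a
    colour outside this list is almost surely not drawn. *)
Lemma ae_run n : \forall w \ae Pr, run_upto n w.
Proof.
have init := mvpp_initial hM.
have steps := ae_foralln (mvpp_step hM).
elim: n => [|n IH].
  by apply: filterS2 init steps => w w0 wS; split.
have mS : measurable (~` [set` colours n] : set (borel P)).
  by apply: measurableC; exact: (polish_measurable_seq hP).
suff Cn : \forall w \ae Pr, C n w \in colours n.
  apply: filterS2 IH Cn => w [w0 wS wC] wCn; split => // j.
  by rewrite ltnS leq_eqVlt => /predU1P[->//|]; exact: wC.
have mC : measurable (C n @^-1` (~` [set` colours n])).
  by rewrite -[X in measurable X]setTI; apply: (mvpp_colour_measurable hM).
exists (C n @^-1` (~` [set` colours n])); split => //.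
have hT : history M n setT.
  by rewrite -setC0 /history; apply: sigma_algebraC; exact: sigma_algebra0.
have := mvpp_draw hM hT mS; rewrite setTI => ->.
rewrite (ae_eq_integral (cst 0%E))//.
- by rewrite integral0.
- apply/measurable_EFinP; apply: measurable_funM.
    by apply: measurableT_comp => //; exact: (mvpp_measurable hM).
  exact: measurable_inv_mass.
- by apply: filterS IH => w wr _; rewrite colours_total//= mul0r.
Qed.

Definition run (w : Omega) : Prop := forall n, run_upto n w.

Lemma good_event : exists G : set Omega,
  [/\ measurable G, Pr (~` G) = 0%E & forall w, G w -> run w].
Proof.
have [N [mN N0 sN]] := ae_foralln ae_run.
exists (~` N); split; [exact: measurableC|by rewrite setCK|].
by move=> w Nw; apply: contrapT => nr; apply: Nw; apply: sN.
Qed.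

End reachable.

(** * Second moments *)

Section second_moment.
Context (R : realType) (kappa : nat) (hkappa : (2 <= kappa)%N).
Context (P : ptopologicalType) (hP : polish R P).
Variables (Rep : R.-pker borel P ~> borel P) (M0 : fmeas R P).
Hypothesis hM0 : (0 < M0 [set: borel P])%E.
Context (d : measure_display) (Omega : measurableType d) (Pr : probability Omega R).
Variables (M : nat -> Omega -> fmeas R P) (C : nat -> Omega -> borel P).
Hypothesis hM : discrete_mvpp kappa Rep M Pr C M0.
Variable G : set Omega.
Hypothesis mG : measurable G.
Hypothesis PrG : Pr (~` G) = 0%E.
Hypothesis Grun : forall w, G w -> run hP hM w.

Let k0 : 0 < kappa%:R :> R. Proof. by rewrite ltr0n (leq_trans _ hkappa). Qed.

Let sz n : R := mass kappa (initial_mass M0) n.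
Let hs0 : kappa%:R^-1 <= initial_mass M0. Proof. exact: (initial_mass_ge hkappa hM0 hM). Qed.
Let sz_gt0 n : 0 < sz n. Proof. exact: mass_gt0. Qed.

Let cs n : seq P := undup (colours hP hM n).
Let m n (y : P) (w : Omega) : R := fine (M n w [set y]).

(** Integral against the urn, written as a sum that is measurable everywhere;
    the two agree on the event [G] ([urn_intE]). *)
Definition urn_int n (v : P -> R) (w : Omega) : R := \sum_(y <- cs n) v y * m n y w.

Lemma urn_intE n v B w : G w -> bmeas B (v : borel P -> R) ->
  \int[M n w]_(x in [set: borel P]) v x = urn_int n v w.
Proof.
move=> Gw vB; apply: (integral_atomic hP vB).
exact: (colours_total (Grun Gw n)).
Qed.

Lemma urn_int_cst n (c : R) w : G w -> urn_int n (fun=> c) w = c * sz n.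
Proof.
move=> Gw; rewrite -(urn_intE _ Gw (@bmeas_cst _ (borel P) R c)) Rintegral_cst//.
by rewrite -[sz n]/(fine (sz n)%:E); congr (_ * fine _); exact: (total_mass hkappa (Grun Gw n)).
Qed.

Lemma urn_intD n u v (a b : R) w :
  urn_int n (fun y => a * u y + b * v y) w = a * urn_int n u w + b * urn_int n v w.
Proof.
rewrite /urn_int !mulr_sumr -big_split; apply: eq_bigr => y _ /=; ring.
Qed.

(** The integral of [v] against the signed replacement measure of [y]. *)
Definition increment (v : borel P -> R) (y : borel P) : R :=
  trans Rep v y - kappa%:R^-1 * v y.

Lemma urn_int_step n v B w : G w -> bmeas B (v : borel P -> R) ->
  urn_int n.+1 v w = urn_int n v w + (trans Rep v (C n w) - kappa%:R^-1 * v (C n w)).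
Proof.
move=> Gw vB; have [w0 wS _] := Grun Gw n.
rewrite -!(urn_intE _ Gw vB) trans_ker.
have Cn : C n w \in colours hP hM n by have [_ _] := Grun Gw n.+1; apply.
have MS0 := colours_total (Grun Gw n.+1).
have M00 := colours_null_mono (colours_total (Grun Gw n)).
have R00 := replacement_colours Cn.
rewrite (integral_atomic hP vB MS0) (integral_atomic hP vB M00).
rewrite (integral_atomic hP (mu := ker_prob Rep (C n w)) vB R00).
have CS : C n w \in colours hP hM n.+1 by rewrite mem_cat Cn.
rewrite -(sum_seq_indic v CS) mulr_sumr -sumrB -big_split; apply: eq_bigr => y _ /=.
have m1 := polish_measurable1 hP y.
have [_ _ /(_ y) [k2 k2E]] := replacement_support_ex hP hM (C n w).
have [k1 k1E] := masses_integral hkappa y (Grun Gw n).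
rewrite wS// /signed_replacement diracE k1E /ker_prob k2E -EFinM -EFinN -!EFinD /=.
by rewrite indicE; ring.
Qed.

Let mE n y w : G w -> exists k : nat, m n y w = k%:R / kappa%:R.
Proof.
move=> Gw; have [k kE] := masses_integral hkappa y (Grun Gw n).
by exists k; rewrite /m kE.
Qed.

Let m_ge0 n y w : 0 <= m n y w. Proof. exact: fine_ge0. Qed.

Let m_le n y w : G w -> m n y w <= sz n.
Proof.
move=> Gw; have m1 := polish_measurable1 hP y.
have : fine (M n w [set y]) <= fine (M n w [set: borel P]).
  by apply: fine_le; rewrite ?fin_num_measure//; apply: le_measure; rewrite ?inE.
have -> : fine (M n w [set: borel P]) = fine (sz n)%:E.
  by congr fine; exact: (total_mass hkappa (Grun Gw n)).
by [].
Qed.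

Let mm n y : measurable_fun setT (m n y).
Proof. by apply: (measurable_fine_mass hM); exact: (polish_measurable1 hP). Qed.

(* Expectations are taken over the event [G] of full measure, because the urn
   is bounded by its deterministic mass only there. *)
Let bint (X : Omega -> R) := measurable_fun setT X /\
  exists B : R, forall w, G w -> `|X w| <= B.

Let bint_int X : bint X -> Pr.-integrable G (EFin \o X).
Proof.
move=> [mX [B XB]]; apply: measurable_bounded_integrable => //.
- by apply: (le_lt_trans (probability_le1 Pr mG)); rewrite ltry.
- exact: measurable_funTS.
- exists B; split; first exact: num_real.
  by move=> y By w Gw /=; apply: le_trans (XB w Gw) _; exact: ltW.
Qed.

Let bintD X Y : bint X -> bint Y -> bint (fun w => X w + Y w).
Proof.
move=> [mX [B XB]] [mY [B' YB]]; split; first exact: measurable_funD.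
exists (B + B') => w Gw; apply: le_trans (ler_normD _ _) _.
by apply: lerD; [exact: XB|exact: YB].
Qed.

Let bintM X Y : bint X -> bint Y -> bint (fun w => X w * Y w).
Proof.
move=> [mX [B XB]] [mY [B' YB]]; split; first exact: measurable_funM.
exists (B * B') => w Gw; rewrite normrM.
by apply: ler_pM => //; [exact: XB|exact: YB].
Qed.

Let bint_cst c : bint (fun=> c).
Proof. by split => //; exists `|c|. Qed.

Let bint_sum (I : Type) (s : seq I) (X : I -> Omega -> R) :
  (forall i, bint (X i)) -> bint (fun w => \sum_(i <- s) X i w).
Proof.
move=> bX; elim: s => [|i s IH].
  by rewrite (_ : (fun w => _) = fun=> 0); [exact: bint_cst|apply/funext => w; rewrite big_nil].
rewrite (_ : (fun w => _) = fun w => X i w + \sum_(i <- s) X i w).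
  exact: bintD.
by apply/funext => w; rewrite big_cons.
Qed.

Let bint_m n y : bint (m n y).
Proof.
by split; [exact: mm|exists (sz n) => w Gw; rewrite ger0_norm ?m_le].
Qed.

Let bint_indic (E : set Omega) : measurable E -> bint (\1_E).
Proof.
move=> mE'; split; first exact: measurable_indic.
exists 1 => w _; rewrite indicE.
by case: (_ \in _); rewrite /= ?normr1 ?normr0.
Qed.

Let bint_urn n v : bint (urn_int n v).
Proof. by apply: bint_sum => y; apply: bintM; [exact: bint_cst|exact: bint_m]. Qed.

Let Ex (X : Omega -> R) : R := \int[Pr]_(w in G) X w.

Let ExD X Y : bint X -> bint Y -> Ex (fun w => X w + Y w) = Ex X + Ex Y.
Proof. by move=> bX bY; rewrite /Ex RintegralD//; exact: bint_int. Qed.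

Let ExZ c X : bint X -> Ex (fun w => c * X w) = c * Ex X.
Proof. by move=> bX; rewrite /Ex RintegralZl//; exact: bint_int. Qed.

Let eq_Ex X Y : (forall w, G w -> X w = Y w) -> Ex X = Ex Y.
Proof. by move=> XY; apply: eq_Rintegral => w /set_mem; exact: XY. Qed.

Let le_Ex X Y : bint X -> bint Y -> (forall w, G w -> X w <= Y w) -> Ex X <= Ex Y.
Proof. by move=> bX bY XY; apply: le_Rintegral => //; exact: bint_int. Qed.

Let Ex_sum (I : Type) (s : seq I) (X : I -> Omega -> R) :
  (forall i, bint (X i)) -> Ex (fun w => \sum_(i <- s) X i w) = \sum_(i <- s) Ex (X i).
Proof.
move=> bX; elim: s => [|i s IH].
  rewrite big_nil (_ : (fun w => _) = fun=> 0).
    by rewrite /Ex Rintegral_cst// mul0r.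
  by apply/funext => w; rewrite big_nil.
rewrite big_cons -IH -ExD//; last exact: bint_sum.
by apply: eq_Ex => w _; rewrite big_cons.
Qed.

Let Pr_G E : measurable E -> Pr (E `&` G) = Pr E.
Proof.
move=> mE'.
have E0 : Pr (E `&` ~` G) = 0%E.
  apply/eqP; rewrite eq_le measure_ge0 andbT -PrG.
  by apply: le_measure; rewrite ?inE//; [apply: measurableI => //|]; exact: measurableC.
rewrite [RHS](@measureDI _ _ _ Pr E (~` G))// ?setDE ?setCK; last exact: measurableC.
transitivity (Pr (E `&` G) + 0)%E; first by rewrite adde0.
by congr (_ + _)%E; exact/esym.
Qed.

Let mCn n y : measurable (C n @^-1` [set y]).
Proof.
rewrite -[X in measurable X]setTI; apply: (mvpp_colour_measurable hM) => //.
exact: (polish_measurable1 hP).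
Qed.

Let history_measurable n E : history M n E -> measurable E.
Proof.
apply: smallest_sub; first exact: sigma_algebra_measurable.
move=> _ [i [A [Y [_ mA mY ->]]]]; rewrite -[X in measurable X]setTI.
by apply: (mvpp_measurable hM).
Qed.

Let draw_event n E y : history M n E ->
  Ex (fun w => \1_E w * \1_(C n @^-1` [set y]) w) =
  (sz n)^-1 * Ex (fun w => \1_E w * m n y w).
Proof.
move=> hE; have mE' := history_measurable hE.
have := mvpp_draw hM hE (polish_measurable1 hP y).
move=> drawE.
have LE : Ex (fun w => \1_E w * \1_(C n @^-1` [set y]) w) =
    fine (Pr (E `&` C n @^-1` [set y])).
  rewrite -Pr_G; last exact: measurableI.
  rewrite -integral_indic//; last exact: measurableI.
  by congr fine; apply: eq_integral => w _; rewrite indicI.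
rewrite LE drawE.
have f0 w : 0 <= fine (M n w [set y]) / fine (M n w [set: borel P]).
  by rewrite divr_ge0// fine_ge0.
have mf : measurable_fun E
    (fun w => (fine (M n w [set y]) / fine (M n w [set: borel P]))%:E).
  apply/measurable_EFinP; apply: measurable_funTS; apply: measurable_funM; first exact: mm.
  exact: (measurable_inv_mass hM).
have f0' w : E w -> (0 <= (fine (M n w [set y]) / fine (M n w [set: borel P]))%:E)%E.
  by move=> _; rewrite lee_fin.
rewrite (ge0_negligible_integral (measurableC mG) mE' mf f0' PrG).
rewrite setDE setCK -ExZ; last by apply: bintM; [exact: bint_indic|exact: bint_m].
rewrite setIC -/(Rintegral _ _ _) Rintegral_mkcondr /Ex; apply: eq_Rintegral => w /set_mem Gw.
rewrite /patch indicE; case: ifP => wE; last by rewrite mul0r mulr0.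
rewrite mul1r mulrC; congr (_^-1 * _).
by rewrite -[RHS]/(fine (sz n)%:E); congr fine; exact: (total_mass hkappa (Grun Gw n)).
Qed.

(* The conditional law of the drawn colour is given on events of the past. The
   mass [m n y] has finitely many values, all multiples of [kappa%:R^-1], so
   that it is a combination of indicators of such events. *)
Let draw_pair n y y' :
  Ex (fun w => m n y w * \1_(C n @^-1` [set y']) w) =
  (sz n)^-1 * Ex (fun w => m n y w * m n y' w).
Proof.
pose K := (Num.truncn (kappa%:R * sz n)).+1.
pose E (k : nat) := (fun w => M n w [set y]) @^-1` [set (k%:R / kappa%:R : R)%:E].
have hE k : history M n (E k).
  apply: sub_sigma_algebra; exists n, [set y], [set (k%:R / kappa%:R : R)%:E].
  by split => //; exact: (polish_measurable1 hP).
have mEk k : measurable (E k) := history_measurable (hE k).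
have mS w : G w -> m n y w = \sum_(k <- iota 0 K) k%:R / kappa%:R * \1_(E k) w.
  move=> Gw; have [k kE] := masses_integral hkappa y (Grun Gw n).
  have my : m n y w = k%:R / kappa%:R by rewrite /m kE.
  have kK : (k < K)%N.
    rewrite ltnS; have := m_le n y Gw; rewrite my ler_pdivrMr// mulrC => h.
    by rewrite -(@natrK R k) le_truncn.
  rewrite (bigD1_seq k) ?iota_uniq ?mem_iota//=.
  rewrite indicE mem_set; last by rewrite /E /= kE.
  rewrite mulr1 big1 ?addr0// => j jk; rewrite indicE memNset ?mulr0//.
  rewrite /E /= kE => -[] /(mulIf (lt0r_neq0 _)) kj.
  have /eqP := kj (etrans (invr_gt0 _) k0); rewrite eqr_nat => /eqP kj'.
  by rewrite kj' eqxx in jk.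
have bE k : bint (\1_(E k)) := bint_indic (mEk k).
rewrite (@eq_Ex _ (fun w => \sum_(k <- iota 0 K)
    k%:R / kappa%:R * (\1_(E k) w * \1_(C n @^-1` [set y']) w))); last first.
  by move=> w Gw; rewrite mS// mulr_suml; apply: eq_bigr => k _; rewrite mulrA.
rewrite (@eq_Ex (fun w => m n y w * m n y' w) (fun w => \sum_(k <- iota 0 K)
    k%:R / kappa%:R * (\1_(E k) w * m n y' w))); last first.
  by move=> w Gw; rewrite mS// mulr_suml; apply: eq_bigr => k _; rewrite mulrA.
have b1 k : bint (fun w => \1_(E k) w * \1_(C n @^-1` [set y']) w).
  by apply: bintM => //; apply: bint_indic; exact: mCn.
have b2 k : bint (fun w => \1_(E k) w * m n y' w).
  by apply: bintM => //; exact: bint_m.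
rewrite Ex_sum; last by move=> k; apply: bintM; [exact: bint_cst|exact: b1].
rewrite Ex_sum; last by move=> k; apply: bintM; [exact: bint_cst|exact: b2].
rewrite mulr_sumr; apply: eq_bigr => k _; rewrite !ExZ// draw_event//.
by rewrite mulrCA.
Qed.

Let colour_in n w : G w -> C n w \in colours hP hM n.
Proof. by move=> Gw; have [_ _] := Grun Gw n.+1; apply. Qed.

(* The value at the drawn colour: [v] itself need not be measurable, the sum
   is. *)
Let drawn n (v : P -> R) w : R := \sum_(y <- cs n) v y * \1_(C n @^-1` [set y]) w.

Let drawnE n v w : G w -> drawn n v w = v (C n w).
Proof. by move=> Gw; rewrite -(sum_seq_indic v (colour_in n Gw)). Qed.

Let bint_drawn n v : bint (drawn n v).
Proof.
by apply: bint_sum => y; apply: bintM; [exact: bint_cst|apply: bint_indic; exact: mCn].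
Qed.

(* Given the past, the mean of [v] at the drawn colour is its average over the
   urn. *)
Let draw_cov n u v : Ex (fun w => urn_int n u w * drawn n v w) =
  (sz n)^-1 * Ex (fun w => urn_int n u w * urn_int n v w).
Proof.
have b0 y y' : bint (fun w => m n y w * \1_(C n @^-1` [set y']) w).
  by apply: bintM; [exact: bint_m|apply: bint_indic; exact: mCn].
have b1 y y' : bint (fun w => m n y w * m n y' w) by apply: bintM; exact: bint_m.
have E1 (X : P -> Omega -> R) : (forall y, bint (X y)) ->
    (forall y y', bint (fun w => m n y w * X y' w)) ->
    Ex (fun w => urn_int n u w * \sum_(y' <- cs n) v y' * X y' w) =
    \sum_(y <- cs n) \sum_(y' <- cs n) (u y * v y') * Ex (fun w => m n y w * X y' w).
  move=> bX bmX.
  rewrite (@eq_Ex _ (fun w => \sum_(y <- cs n) \sum_(y' <- cs n)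
      (u y * v y') * (m n y w * X y' w))); last first.
    move=> w _; rewrite /urn_int mulr_suml; apply: eq_bigr => y _.
    by rewrite mulr_sumr; apply: eq_bigr => y' _; ring.
  rewrite Ex_sum; last first.
    by move=> y; apply: bint_sum => y'; apply: bintM; [exact: bint_cst|exact: bmX].
  apply: eq_bigr => y _; rewrite Ex_sum; last first.
    by move=> y'; apply: bintM; [exact: bint_cst|exact: bmX].
  by apply: eq_bigr => y' _; rewrite ExZ.
rewrite (E1 (fun y' => \1_(C n @^-1` [set y'])))//; last first.
  by move=> y; apply: bint_indic; exact: mCn.
rewrite (E1 (m n))//.
rewrite mulr_sumr; apply: eq_bigr => y _; rewrite mulr_sumr; apply: eq_bigr => y' _.
by rewrite draw_pair mulrCA.
Qed.

(** The function [v + (sz n)^-1 * increment v], integrated against the urn at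
    time [n], is the conditional expectation of the integral of [v] at time
    [n + 1]. The conditional variance is at most the second moment of the
    increment at the drawn colour, bounded by [b]. *)
Lemma second_moment_step n v B (b : R) : bmeas B (v : borel P -> R) -> 0 <= b ->
  (forall y, y \in cs n -> increment v y ^+ 2 <= b) ->
  Ex (fun w => urn_int n.+1 v w ^+ 2) <=
  Ex (fun w => urn_int n (fun y => v y + (sz n)^-1 * increment v y) w ^+ 2) + b.
Proof.
move=> vB b0 vb; pose u := increment v.
pose S := urn_int n v; pose D := drawn n u; pose U := urn_int n u.
have bS : bint S := bint_urn n v.
have bD : bint D := bint_drawn n u.
have bU : bint U := bint_urn n u.
have s0 := sz_gt0 n.
rewrite (@eq_Ex _ (fun w => S w * S w + (2 * (S w * D w) + D w * D w))); last first.
  by move=> w Gw; rewrite (urn_int_step n Gw vB) -/(increment v (C n w)) -/u -(drawnE n u Gw) -/S -/D; ring.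
rewrite [in leRHS](@eq_Ex _ (fun w => S w * S w +
    (2 * (sz n)^-1 * (S w * U w) + (sz n)^-1 ^+ 2 * (U w * U w)))); last first.
  move=> w Gw; have := urn_intD n v u 1 (sz n)^-1 w.
  under eq_fun do rewrite mul1r.
  by move=> ->; rewrite mul1r -/S -/U; ring.
have bSS : bint (fun w => S w * S w) by exact: bintM.
have bSD : bint (fun w => S w * D w) by exact: bintM.
have bDD : bint (fun w => D w * D w) by exact: bintM.
have bSU : bint (fun w => S w * U w) by exact: bintM.
have bUU : bint (fun w => U w * U w) by exact: bintM.
have b2 c X : bint X -> bint (fun w => c * X w) by move=> bX; apply: bintM => //; exact: bint_cst.
rewrite !ExD ?ExZ//; try (by repeat (apply: bintD || apply: b2)).
rewrite draw_cov -/S -/U.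
(* The conditional variance is the second moment of the increment minus the
   square of its mean; the latter is discarded. *)
have UU0 : 0 <= Ex (fun w => U w * U w).
  by apply: Rintegral_ge0 => w _; rewrite -expr2 sqr_ge0.
have DD : Ex (fun w => D w * D w) <= b.
  apply: (@le_trans _ _ (Ex (fun=> b))).
    apply: le_Ex; [exact: bDD|exact: bint_cst|].
    move=> w Gw; rewrite /D drawnE// -expr2; apply: vb.
    by rewrite mem_undup; exact: colour_in.
  rewrite /Ex Rintegral_cst// ler_piMr//.
  by rewrite -[leRHS]/(fine 1%E) fine_le ?fin_num_measure// probability_le1.
have : 0 <= (sz n)^-1 ^+ 2 * Ex (fun w => U w * U w) by rewrite mulr_ge0// sqr_ge0.
lra.
Qed.

Lemma second_moment0 v : Ex (fun w => urn_int 0 v w ^+ 2) <=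
  (sz 0 * \sum_(y <- cs 0) `|v y|) ^+ 2.
Proof.
apply: (@le_trans _ _ (Ex (fun=> (sz 0 * \sum_(y <- cs 0) `|v y|) ^+ 2))).
  apply: le_Ex; [exact: (bintM (bint_urn 0 v) (bint_urn 0 v))|exact: bint_cst|].
  move=> w Gw; rewrite -[leLHS]ger0_norm ?sqr_ge0// normrX.
  rewrite lerXn2r ?nnegrE ?mulr_ge0 ?sumr_ge0 ?(ltW (sz_gt0 0))//.
  rewrite mulr_sumr; apply: le_trans (ler_norm_sum _ _ _) _.
  apply: ler_sum => y _; rewrite normrM mulrC ler_wpM2r//.
  by rewrite ger0_norm// m_le.
rewrite /Ex Rintegral_cst// ler_piMr ?sqr_ge0//.
by rewrite -[leRHS]/(fine 1%E) fine_le ?fin_num_measure// probability_le1.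
Qed.

Lemma measurable_urn_int n v : measurable_fun setT (urn_int n v).
Proof. by case: (bint_urn n v). Qed.

Lemma measurable_deviation n v (e : R) :
  measurable [set w | e <= `|urn_int n v w|].
Proof.
rewrite (_ : mkset _ = (fun w => `|urn_int n v w|) @^-1` `[e, +oo[%classic).
  rewrite -[X in measurable X]setTI; apply: measurableT_comp => //.
  exact: measurable_urn_int.
by apply/seteqP; split => w /=; rewrite in_itv/= andbT.
Qed.

Lemma chebyshev_urn n v (e : R) : 0 < e ->
  fine (Pr (G `&` [set w | e <= `|urn_int n v w|])) <=
  Ex (fun w => urn_int n v w ^+ 2) / e ^+ 2.
Proof.
move=> e0; have mS := measurable_deviation n v e.
rewrite ler_pdivlMr ?exprn_gt0// setIC -integral_indic//.
rewrite -/(Rintegral _ _ _) -/(Ex _) mulrC -ExZ; last exact: bint_indic.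
apply: le_Ex => [||w Gw].
- by apply: bintM; [exact: bint_cst|exact: bint_indic].
- exact: (bintM (bint_urn n v) (bint_urn n v)).
rewrite /=; case: (boolP (_ \in _)) => [/set_mem/= h|_]; last by rewrite mulr0 sqr_ge0.
by rewrite mulr1 -[leRHS]ger0_norm ?sqr_ge0// normrX lerXn2r ?nnegrE ?(ltW e0).
Qed.

End second_moment.

(** * Concentration *)

Lemma cvg0_sum (R : realType) (I : Type) (s : seq I) (F : I -> nat -> R) :
  (forall i, F i n @[n --> \oo] --> (0 : R)) ->
  \sum_(i <- s) F i n @[n --> \oo] --> (0 : R).
Proof.
move=> F0; elim: s => [|i s IH].
  by under eq_fun do rewrite big_nil; exact: cvg_cst.
rewrite (_ : (fun n => _) = (fun n => F i n + \sum_(j <- s) F j n)).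
  by rewrite -[X in _ --> X]addr0; exact: cvgD.
by apply/funext => n; rewrite big_cons.
Qed.

Section concentration.
Context (R : realType) (kappa : nat) (hkappa : (2 <= kappa)%N).
Context (P : ptopologicalType) (hP : polish R P) (A : affine_structure P).
Variables (Rep : R.-pker borel P ~> borel P).
Variables (a : nat -> scalars A) (b : nat -> shifts A) (gamma : probability (borel P) R).
Hypothesis herg : ergodic Rep a b gamma.
Variables (f : R -> shifts A) (g : R -> scalars A) (mf : borel_fun f) (mg : borel_fun g).
Hypothesis hreg : sqrt_regular a b f g.
Variable M0 : fmeas R P.
Hypothesis hM0 : (0 < M0 [set: borel P])%E.
Context (d : measure_display) (Omega : measurableType d) (Pr : probability Omega R).
Variables (M : nat -> Omega -> fmeas R P) (C : nat -> Omega -> borel P).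
Hypothesis hM : discrete_mvpp kappa Rep M Pr C M0.
Variable G : set Omega.
Hypothesis mG : measurable G.
Hypothesis PrG : Pr (~` G) = 0%E.
Hypothesis Grun : forall w, G w -> run hP hM w.
Variables (h : P -> R) (B : R).
Hypothesis ch : continuous h.
Hypothesis hB : forall x, `|h x| <= B.

Let c : R := \int[mixture_law hP mf mg gamma]_(x in [set: borel P]) h x.
Let obs n : borel P -> R := observable a b h (depth R kappa n).
Let s0 := initial_mass M0.
Let sz n : R := mass kappa s0 n.
Let hs0 : kappa%:R^-1 <= s0. Proof. exact: (initial_mass_ge hkappa hM0 hM). Qed.
Let sz_gt0 n : 0 < sz n. Proof. exact: mass_gt0. Qed.
Let k0 : 0 < kappa%:R :> R. Proof. by rewrite ltr0n (leq_trans _ hkappa). Qed.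
Let cs n : seq P := undup (colours hP hM n).
Let bobs n : bmeas B (obs n). Proof. exact: bmeas_observable. Qed.
Let psP i n : is_prob_seq (probs kappa s0 i n). Proof. exact: probs_is_prob. Qed.

Let L i n : borel P -> R := lineage Rep (obs n) (probs kappa s0 i n).
Let bL i n : bmeas B (L i n). Proof. exact: bmeas_lineage. Qed.

Let B0 : 0 <= B. Proof. exact: le_trans (hB point). Qed.
Let c_le : `|c| <= B.
Proof. exact: mixture_mean_le. Qed.

Let transL i n y : trans Rep (L i n) y =
  lineage_mean kappa s0 Rep a b h i n (ker_prob Rep y).
Proof. by rewrite trans_ker (integral_lineage Rep (bobs n) _ (@psP i n)). Qed.

Let transL_cvg i y : trans Rep (L i n) y @[n --> \oo] --> c.
Proof.
have := lineage_mean_cvg (hP := hP) (mf := mf) (mg := mg) hkappa hs0 herg hreg ch hB i (ker_prob Rep y).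
by apply: cvg_trans; apply: near_eq_cvg; apply: nearW => n; rewrite transL.
Qed.

Let L_cvg i y : L i n y @[n --> \oo] --> c.
Proof.
have := lineage_mean_cvg (hP := hP) (mf := mf) (mg := mg) hkappa hs0 herg hreg ch hB i
  (dirac (y : borel P) : probability (borel P) R).
apply: cvg_trans; apply: near_eq_cvg; apply: nearW => n.
rewrite /lineage_mean -(integral_lineage Rep (bobs n) _ (@psP i n)) -/(L i n).
rewrite /Rintegral integral_dirac ?diracT ?mul1e//.
by apply/measurable_EFinP; case: (bL i n).
Qed.

(* The centring and the factor make the integral of [u i n] against the urn
   at time [i] a martingale in [i]; see [u_step]. *)
Let u i n (y : borel P) : R := sz n / sz i * (L i n y - c).

Let bu i n : bmeas (`|sz n / sz i| * (B + `|c|)) (u i n).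
Proof. apply: bmeasZ; apply: bmeasB => //; exact: (@bmeas_cst _ (borel P) R c). Qed.

Let uE n y : u n n y = obs n y - c.
Proof.
rewrite /u divff ?lt0r_neq0// mul1r /L /lineage /probs subnn /=.
by [].
Qed.

Let incrE i n y : increment kappa Rep (u i n) y =
  sz n / sz i * ((trans Rep (L i n) y - c) - kappa%:R^-1 * (L i n y - c)).
Proof.
rewrite /increment.
have -> : trans Rep (u i n) y = sz n / sz i * (trans Rep (L i n) y - c).
  have -> : u i n = (fun x => sz n / sz i * L i n x + (- (sz n / sz i)) * c).
    by apply/funext => x; rewrite /u; ring.
  rewrite (trans_lin _ _ _ _ (bL i n) (@bmeas_cst _ (borel P) R c)) trans_cst.
  by ring.
by rewrite /u; ring.
Qed.

(* This combines the recursion of lineages, [lineage_cons], with the growth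
   [sz i.+1 = sz i + 1 - kappa%:R^-1] of the mass. *)
Let u_step i n y : (i < n)%N ->
  u i.+1 n y + (sz i)^-1 * increment kappa Rep (u i.+1 n) y = u i n y.
Proof.
move=> lt_in; rewrite incrE /u.
have -> : L i n y = (1 - (sz i.+1)^-1) * L i.+1 n y +
    (sz i.+1)^-1 * trans Rep (L i.+1 n) y.
  have := lineage_cons Rep (bobs n) (sz i.+1)^-1 y (@psP i.+1 n).
  by rewrite {1}/lineage /L /lineage /probs -(subnSK lt_in).
have := sz_gt0 i; have := sz_gt0 i.+1; rewrite /sz massS -/(sz i) => h1 h2.
move: h1; have -> : gain R kappa = 1 - kappa%:R^-1.
  by rewrite /gain -subn1 natrB ?(leq_trans _ hkappa)//; field; exact: lt0r_neq0.
set s' := sz i + (1 - kappa%:R^-1) => h1.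
have E : kappa%:R^-1 = sz i + 1 - s' by rewrite /s'; ring.
clearbody s'; rewrite E -/(sz n).
move: h1 h2; move: (sz i) (sz n) (L _ _ _) (trans _ _ _) => x z l l' h1 h2.
by field; rewrite !lt0r_neq0.
Qed.

Let Ex (X : Omega -> R) : R := \int[Pr]_(w in G) X w.

Let err (i n : nat) (y : P) : R := increment kappa Rep (u i.+1 n) y / sz n.

Let errE i n y : err i n y = (sz i.+1)^-1 *
  ((trans Rep (L i.+1 n) y - c) - kappa%:R^-1 * (L i.+1 n y - c)).
Proof. by rewrite /err incrE; field; rewrite !lt0r_neq0. Qed.

Let err_cvg i y : err i n y ^+ 2 @[n --> \oo] --> (0 : R).
Proof.
have H : (sz i.+1)^-1 * ((trans Rep (L i.+1 n) y - c) -
    kappa%:R^-1 * (L i.+1 n y - c)) @[n --> \oo] --> (0 : R).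
  have -> : (0 : R) = (sz i.+1)^-1 * ((c - c) - kappa%:R^-1 * (c - c)) by ring.
  apply: cvgM; first exact: cvg_cst.
  apply: cvgB; first by apply: cvgB; [exact: transL_cvg|exact: cvg_cst].
  apply: cvgM; first exact: cvg_cst.
  by apply: cvgB; [exact: L_cvg|exact: cvg_cst].
rewrite (_ : (fun n => _) = (fun n => err i n y * err i n y)); last first.
  by apply/funext => n; rewrite expr2.
rewrite -(mulr0 0); apply: cvgM.
- by rewrite (_ : err i ^~ y = fun n => (sz i.+1)^-1 * ((trans Rep (L i.+1 n) y - c) -
    kappa%:R^-1 * (L i.+1 n y - c)))//; apply/funext => n; exact: errE.
- by rewrite (_ : err i ^~ y = fun n => (sz i.+1)^-1 * ((trans Rep (L i.+1 n) y - c) -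
    kappa%:R^-1 * (L i.+1 n y - c)))//; apply/funext => n; exact: errE.
Qed.

Let bnd : R := (4 * B) ^+ 2 * beta R kappa.

Let bnd_ge0 : 0 <= bnd.
Proof. by rewrite mulr_ge0 ?sqr_ge0// ltW// beta_gt0. Qed.

Let err_le i n y : err i n y ^+ 2 <= bnd * ((sz i)^-1 - (sz i.+1)^-1).
Proof.
have s1 := sz_gt0 i; have s2 := sz_gt0 i.+1; have b1 := beta_gt0 R hkappa.
have r0 := gain_gt0 R hkappa; have br := beta_gain R hkappa.
have [_ /(_ y) l1] := bL i.+1 n; have [_ /(_ y) l2] := bmeas_trans Rep (bL i.+1 n).
have q1 : 0 <= (kappa%:R^-1 : R) <= 1.
  apply/andP; split; first by rewrite invr_ge0 ltW.
  by rewrite invf_le1// ler1n; exact: leq_trans hkappa.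
rewrite errE exprMn.
have h1 : `|(trans Rep (L i.+1 n) y - c) - kappa%:R^-1 * (L i.+1 n y - c)| <= 4 * B.
  apply: le_trans (ler_normB _ _) _.
  have t1 : `|trans Rep (L i.+1 n) y - c| <= 2 * B.
    by apply: le_trans (ler_normB _ _) _; have := c_le; lra.
  have t2 : `|L i.+1 n y - c| <= 2 * B.
    by apply: le_trans (ler_normB _ _) _; have := c_le; lra.
  rewrite normrM; have /andP[q2 q3] := q1; rewrite (ger0_norm q2).
  have : kappa%:R^-1 * `|L i.+1 n y - c| <= 1 * `|L i.+1 n y - c| by rewrite ler_wpM2r.
  lra.
have h2 : ((trans Rep (L i.+1 n) y - c) - kappa%:R^-1 * (L i.+1 n y - c)) ^+ 2 <= (4 * B) ^+ 2.
  rewrite -[leLHS]ger0_norm ?sqr_ge0// normrX lerXn2r ?nnegrE ?mulr_ge0//.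
apply: (@le_trans _ _ ((sz i.+1)^-1 ^+ 2 * (4 * B) ^+ 2)).
  by rewrite ler_wpM2l// sqr_ge0.
rewrite /bnd mulrC -mulrA ler_wpM2l ?sqr_ge0//.
have -> : (sz i)^-1 - (sz i.+1)^-1 = gain R kappa / (sz i * sz i.+1).
  by rewrite /sz massS -/(sz i); move: s2; rewrite /sz massS -/(sz i) => s2;
    field; rewrite !lt0r_neq0.
rewrite mulrA br mul1r expr2 -invfM lef_pV2 ?posrE ?mulr_gt0// ler_pM2r//.
by rewrite /sz massS lerDl ltW.
Qed.

(* The second moment of the martingale at time [j], relative to the square of
   the total mass at time [n]. *)
Let Y j n : R := Ex (fun w => urn_int hP hM j (u j n) w ^+ 2) / sz n ^+ 2.

Let Y_step j n (e : R) : (j < n)%N -> 0 <= e ->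
  (forall y, y \in cs j -> err j n y ^+ 2 <= e) -> Y j.+1 n <= Y j n + e.
Proof.
move=> jn e0 He; have sn := sz_gt0 n.
rewrite /Y ler_pdivrMr ?exprn_gt0// mulrDl mulfVK ?lt0r_neq0 ?exprn_gt0//.
have H2 (y : P) : y \in cs j -> increment kappa Rep (u j.+1 n) y ^+ 2 <= e * sz n ^+ 2.
  by move=> yj; have := He y yj; rewrite /err expr_div_n ler_pdivrMr ?exprn_gt0.
have := second_moment_step hkappa hM0 mG PrG Grun (bu j.+1 n) (mulr_ge0 e0 (sqr_ge0 (sz n))) H2.
move=> SM; apply: (le_trans SM).
rewrite le_eqVlt; apply/orP; left; apply/eqP; congr (_ + _).
apply: eq_Rintegral => w _; congr (urn_int hP hM j _ w ^+ 2); apply/funext => y.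
exact: u_step.
Qed.

(* For the finitely many steps before a fixed time every possible colour
   contributes an error that vanishes as [n] grows ([err_cvg]). *)
Let Y_head j n : (j <= n)%N ->
  Y j n <= Y 0 n + \sum_(i <- iota 0 j) \sum_(y <- cs i) err i n y ^+ 2.
Proof.
elim: j => [|j IH] jn; first by rewrite big_nil addr0.
rewrite -addn1 iotaD big_cat big_seq1 add0n addn1 /= addrA.
apply: le_trans (Y_step jn (e := \sum_(y <- cs j) err j n y ^+ 2) _ _) _.
- by apply: sumr_ge0 => y _; exact: sqr_ge0.
- move=> y yj; rewrite (bigD1_seq y)//= ?undup_uniq// lerDl.
  by apply: sumr_ge0 => z _; exact: sqr_ge0.
- by rewrite lerD2r; apply: IH; exact: ltnW.
Qed.

(* For the other steps the uniform bound [err_le] telescopes. *)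
Let Y_tail J j n : (J <= j <= n)%N ->
  Y j n <= Y J n + bnd * ((sz J)^-1 - (sz j)^-1).
Proof.
elim: j => [|j IH] /andP[Jj jn].
  by move: Jj; rewrite leqn0 => /eqP ->; rewrite subrr mulr0 addr0.
move: Jj; rewrite leq_eqVlt => /predU1P[->|]; first by rewrite subrr mulr0 addr0.
rewrite ltnS => Jj; have H := IH _.
have {}H : Y j n <= Y J n + bnd * ((sz J)^-1 - (sz j)^-1).
  by apply: H; rewrite Jj ltnW.
apply: le_trans (Y_step jn (e := bnd * ((sz j)^-1 - (sz j.+1)^-1)) _ _) _.
- apply: le_trans (err_le j n point); exact: sqr_ge0.
- by move=> y _; exact: err_le.
- lra.
Qed.

Let Y0_cvg : Y 0 n @[n --> \oo] --> (0 : R).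
Proof.
have S0 : \sum_(y <- cs 0) `|L 0 n y - c| @[n --> \oo] --> (0 : R).
  apply: cvg0_sum => y.
  have Lc : L 0 n y - c @[n --> \oo] --> (0 : R).
    by rewrite -(subrr c); apply: cvgB; [exact: L_cvg|exact: cvg_cst].
  by rewrite -[X in _ --> X](@normr0 _ R); exact: cvg_norm.
have S1 : (\sum_(y <- cs 0) `|L 0 n y - c|) * (\sum_(y <- cs 0) `|L 0 n y - c|)
    @[n --> \oo] --> (0 : R).
  by rewrite -[X in _ --> X](mulr0 (0 : R)); exact: cvgM.
apply: (squeeze_cvgr _ (cvg_cst 0) S1); apply: nearW => n.
have sn := sz_gt0 n; apply/andP; split.
  by rewrite divr_ge0 ?sqr_ge0// Rintegral_ge0// => w _; exact: sqr_ge0.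
rewrite /Y ler_pdivrMr ?exprn_gt0//.
apply: le_trans (second_moment0 hkappa hM0 mG Grun (u 0 n)) _.
rewrite -expr2 -exprMn le_eqVlt; apply/orP; left; apply/eqP; congr (_ ^+ 2).
rewrite mulr_sumr mulr_suml; apply: eq_bigr => y _.
rewrite /u normrM gtr0_norm ?divr_gt0// -/(sz 0).
by have := sz_gt0 0; move=> s00; field; rewrite lt0r_neq0.
Qed.

Let Y_cvg : Y n n @[n --> \oo] --> (0 : R).
Proof.
apply/cvgr0Pnorm_le => e e0; have e30 : 0 < e / 3 by rewrite divr_gt0.
have [J _ HJ] : \forall J \near \oo, bnd * (sz J)^-1 <= e / 3.
  have : bnd * (sz J)^-1 @[J --> \oo] --> (0 : R).
    rewrite -(mulr0 bnd); apply: cvgM; first exact: cvg_cst.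
    exact: mass_inv_cvg0.
  move=> /cvgr0Pnorm_le /(_ _ e30); apply: filterS => J.
  by apply: le_trans; exact: ler_norm.
have {}HJ := HJ J (leqnn J).
have H0 : \sum_(i <- iota 0 J) \sum_(y <- cs i) err i n y ^+ 2 @[n --> \oo] --> (0 : R).
  by apply: cvg0_sum => i; apply: cvg0_sum => y; exact: err_cvg.
have := Y0_cvg; move=> /cvgr0Pnorm_le /(_ _ e30) H1.
move: H0 => /cvgr0Pnorm_le /(_ _ e30) H2.
near=> n.
have Jn : (J <= n)%N by near: n; exact: nbhs_infty_ge.
have h1 : `|Y 0 n| <= e / 3 by near: n.
have h2 : `|\sum_(i <- iota 0 J) \sum_(y <- cs i) err i n y ^+ 2| <= e / 3 by near: n.
have h3 := Y_head Jn; have h4 : Y n n <= Y J n + bnd * ((sz J)^-1 - (sz n)^-1).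
  by apply: Y_tail; rewrite Jn leqnn.
have h5 : 0 <= bnd * (sz n)^-1 by rewrite mulr_ge0// invr_ge0 ltW.
rewrite ger0_norm; last by rewrite divr_ge0 ?sqr_ge0// Rintegral_ge0// => w _; exact: sqr_ge0.
have := ler_norm (Y 0 n).
have := ler_norm (\sum_(i <- iota 0 J) \sum_(y <- cs i) err i n y ^+ 2).
lra.
Unshelve. all: by end_near. Qed.

Lemma concentration (e : R) : 0 < e ->
  fine (Pr (G `&` [set w | e * sz n <= `|urn_int hP hM n (fun y => obs n y - c) w|]))
    @[n --> \oo] --> (0 : R).
Proof.
move=> e0.
have H : Y n n * (e ^+ 2)^-1 @[n --> \oo] --> (0 : R).
  by rewrite -(mul0r (e ^+ 2)^-1); apply: cvgM; [exact: Y_cvg|exact: cvg_cst].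
apply: (squeeze_cvgr _ (cvg_cst 0) H); apply: nearW => n.
rewrite fine_ge0//=.
have es0 : 0 < e * sz n by rewrite mulr_gt0.
apply: le_trans (chebyshev_urn hkappa mG Grun n _ es0) _.
rewrite le_eqVlt; apply/orP; left; apply/eqP.
rewrite /Y exprMn invfM mulrA mulrAC; congr (_ / _ / _).
by apply: eq_Rintegral => w _; congr (urn_int hP hM n _ w ^+ 2); apply/funext => y; rewrite uE.
Qed.

End concentration.

(** * Convergence in probability *)

Section probability_filter.
Context d (Omega : measurableType d) (R : realType) (Pr : probability Omega R).
Context (T : topologicalType) (X : nat -> Omega -> T).

(** The sets into which [X n] falls with probability tending to 1, in the sense
    of inner approximation by events. They form a filter, and convergence in
    probability is convergence of this filter. *)
Definition likely (U : set T) : Prop :=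
  exists2 E : nat -> set Omega,
    (forall n, measurable (E n) /\ E n `<=` [set w | U (X n w)]) &
    (fun n => Pr (E n)) @ \oo --> (1%:E : \bar R).

Lemma likely_compl (E : nat -> set Omega) : (forall n, measurable (E n)) ->
  (fun n => Pr (E n)) @ \oo --> (1%:E : \bar R) <->
  fine (Pr (~` E n)) @[n --> \oo] --> (0 : R).
Proof.
move=> mE.
have PE n : Pr (~` E n) = (1 - Pr (E n))%E by exact: probability_setC.
have fE n : Pr (E n) \is a fin_num by exact: fin_num_measure.
have EE n : Pr (E n) = (1 - fine (Pr (~` E n)))%:E.
  by rewrite PE fineB//= subKr fineK.
split=> H.
  have -> : (fun n => fine (Pr (~` E n))) = (fun n => 1 - fine (Pr (E n))).
    by apply/funext => n; rewrite PE fineB.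
  rewrite -(subrr 1); apply: cvgB; first exact: cvg_cst.
  exact: fine_cvg H.
rewrite (_ : (fun n => Pr (E n)) = (fun n => (1 - fine (Pr (~` E n)))%:E)); last first.
  by apply/funext => n; exact: EE.
apply: cvg_EFin; first by apply: nearW.
by rewrite -[X in _ --> X](subr0 1); apply: cvgB; [exact: cvg_cst|exact: H].
Qed.

Lemma likely_filter : Filter likely.
Proof.
split.
- exists (fun=> setT); first by [].
  by rewrite probability_setT; exact: cvg_cst.
- move=> U V [E HE cE] [F HF cF].
  have mE n : measurable (E n) by case: (HE n).
  have mF n : measurable (F n) by case: (HF n).
  exists (fun n => E n `&` F n).
    move=> n; split; first exact: measurableI.
    by move=> w [Ew Fw]; split; [apply: (HE n).2|apply: (HF n).2].
  apply/likely_compl; first by move=> n; exact: measurableI.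
  move/(likely_compl mE) : cE => cE; move/(likely_compl mF) : cF => cF.
  have H := cvgD cE cF; rewrite addr0 in H.
  apply: (@squeeze_cvgr _ _ _ _ (fun=> 0)
    (fun n => fine (Pr (~` E n)) + fine (Pr (~` F n)))); first last.
  - exact: H.
  - exact: cvg_cst.
  apply: nearW => n.
  rewrite fine_ge0//= -lee_fin !EFinD !fineK ?fin_num_measure//; try exact: measurableC.
    by rewrite setCI; apply: measureU2; exact: measurableC.
  by apply: measurableC; exact: measurableI.
- move=> U V UV [E HE cE]; exists E => // n; have [mE EU] := HE n.
  by split => // w /EU; exact: UV.
Qed.

End probability_filter.

Lemma Rintegral_fscale d (T : measurableType d) (R : realType) (k : {nonneg R})
    (mu : {finite_measure set T -> \bar R}) B (v : T -> R) : bmeas B v ->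
  \int[fscale k mu]_(x in setT) v x = k%:num * \int[mu]_(x in setT) v x.
Proof.
move=> vB; have [mv vb] := vB.
have vS : bmeas (B + `|B|) (fun x => v x + B) by apply: bmeasD => //; exact: bmeas_cst.
have v0 x : 0 <= v x + B by have := vb x; rewrite ler_norml => /andP[? _]; lra.
have shift (m : {finite_measure set T -> \bar R}) :
    \int[m]_(x in setT) v x = \int[m]_(x in setT) (v x + B) - B * fine (m setT).
  rewrite RintegralD//; first by rewrite Rintegral_cst// addrK.
    exact: bmeas_integrable vB.
  exact: (bmeas_integrable _ (@bmeas_cst _ T R B)).
have E : \int[fscale k mu]_(x in setT) (v x + B) = k%:num * \int[mu]_(x in setT) (v x + B).
  rewrite /Rintegral (_ : (\int[fscale k mu]_x _)%E =
      (\int[mscale k mu]_x (v x + B)%:E)%E); last by apply: eq_measure_integral.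
  rewrite ge0_integral_mscale//.
  - by rewrite fineM// (integrable_fin_num _ (bmeas_integrable mu vS)).
  - by apply/measurable_EFinP; case: vS.
  - by move=> x _; rewrite lee_fin.
rewrite (shift mu) (shift (fscale k mu)) E.
have -> : fine (fscale k mu setT) = k%:num * fine (mu setT).
  by rewrite /fscale /mscale fineM// fin_num_measure.
ring.
Qed.

Theorem theorem8 (R : realType) (kappa : nat) (hkappa : (2 <= kappa)%N)
  (P : ptopologicalType) (hP : polish R P) (A : affine_structure P)
  (Rep : R.-pker borel P ~> borel P)
  (a : nat -> scalars A) (b : nat -> shifts A) (gamma : probability (borel P) R)
  (herg : ergodic Rep a b gamma)
  (f : R -> shifts A) (g : R -> scalars A) (mf : borel_fun f) (mg : borel_fun g)
  (hreg : sqrt_regular a b f g)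
  (M0 : fmeas R P) (hM0 : (0 < M0 [set: borel P])%E)
  (d : measure_display) (Omega : measurableType d) (Pr : probability Omega R)
  (M : nat -> Omega -> fmeas R P) (C : nat -> Omega -> borel P)
  (hM : discrete_mvpp kappa Rep M Pr C M0) :
  cvg_in_probability Pr
    (fun n w =>
       let t := Num.truncn (beta R kappa * ln n%:R) in
       Theta (a t) (b t) (fscale (n%:R^-1)%:nng (M n w)) : measures R P)
    (fscale ((kappa.-1)%:R / kappa%:R)%:nng (mixture_law hP mf mg gamma)
      : measures R P).
Proof.
set X := (fun (n : nat) (w : Omega) => _).
set lim := fscale _ _.
have FX : Filter (likely Pr X) := likely_filter Pr X.
suff : (likely Pr X : set_system (measures R P)) --> (lim : measures R P) by exact.
have [G [mG PrG Grun]] := good_event hP hM.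
apply: measures_cvgP => h ch [B hB].
set c := \int[mixture_law hP mf mg gamma]_(x in [set: borel P]) h x.
have bh : bmeas B (h : borel P -> R) by exact: bmeas_h.
have limE : \int[lim]_(x in [set: borel P]) h x = gain R kappa * c.
  by rewrite /lim (Rintegral_fscale _ _ bh).
rewrite limE; apply/cvgrPdist_le => e e0.
pose obs n : borel P -> R := observable a b h (depth R kappa n).
pose sz n := mass kappa (initial_mass M0) n.
have hs0 := initial_mass_ge hkappa hM0 hM.
have sz0 n : 0 < sz n by exact: mass_gt0.
(* Off the deviation event the error is at most e' sz n / n, which is at most
   e / 4 once sz n / n <= gain + 1; the other half of e is for sz n / n -> gain. *)
pose e' : R := e / 4 / (gain R kappa + 1).
have g0 : 0 < gain R kappa by exact: gain_gt0.
have e'0 : 0 < e' by rewrite /e' !divr_gt0// addr_gt0.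
have XE n w : G w -> \int[X n w]_(x in [set: borel P]) h x =
    n%:R^-1 * (urn_int hP hM n (fun y => obs n y - c) w + c * sz n).
  move=> Gw; rewrite /X /Theta (Rintegral_fimage _ _ bh).
  have bo := bmeas_observable a b ch hB (Num.truncn (beta R kappa * ln n%:R)).
  rewrite (Rintegral_fscale _ _ bo) /=; congr (_ * _).
  transitivity (urn_int hP hM n (obs n) w); first exact: (@urn_intE _ _ _ hP _ _ _ _ _ _ _ hM _ Grun n _ _ w Gw bo).
  rewrite -(urn_int_cst hkappa Grun n c Gw).
  transitivity (urn_int hP hM n (fun y => 1 * (obs n y - c) + 1 * c) w).
    by congr (urn_int hP hM n _ w); apply/funext => y; rewrite !mul1r subrK.
  by rewrite urn_intD !mul1r.
pose dev n : set Omega :=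
  [set w | e' * sz n <= `|urn_int hP hM n (fun y => obs n y - c) w|].
have mdev n : measurable (dev n) by exact: (measurable_deviation hkappa Grun).
have small : \forall n \near \oo, `|c| * `|gain R kappa - sz n / n%:R| <= e / 2 /\
    sz n / n%:R <= gain R kappa + 1.
  have d0 : 0 < Num.min 1 (e / 2 / (`|c| + 1)).
    by rewrite lt_min ltr01/= !divr_gt0// ltr_wpDl.
  have /cvgrPdist_le /(_ _ d0) := @mass_cvg R kappa (initial_mass M0).
  apply: filterS => n; rewrite -/(sz n) le_min => /andP[H1 H2].
  split; last by move: H1; rewrite ler_norml => /andP[? _]; lra.
  apply: le_trans (_ : `|c| * (e / 2 / (`|c| + 1)) <= _).
    by rewrite ler_wpM2l.
  by rewrite mulrA ler_pdivrMr ?ltr_wpDl// [leRHS]mulrC ler_wpM2r ?divr_ge0 ?(ltW e0)//; lra.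
have [N _ HN] : \forall n \near \oo, (0 < n)%N /\
    (`|c| * `|gain R kappa - sz n / n%:R| <= e / 2 /\ sz n / n%:R <= gain R kappa + 1).
  by near=> n; split; near: n; [exact: nbhs_infty_gt|exact: small].
(* Inner approximating events: empty for the finitely many small [n]. *)
exists (fun n => if (n < N)%N then set0 else G `&` ~` dev n).
  move=> n; case: ltnP => [_|Nn]; first by split.
  split.
    by apply: measurableI => //; exact: measurableC.
  move=> w [Gw ndev] /=.
  have [n0 [H1 H2]] := HN _ Nn.
  have nR0 : 0 < n%:R :> R by rewrite ltr0n.
  rewrite (XE n w Gw); set U := urn_int _ _ _ _ _.
  have {}ndev : `|U| < e' * sz n by rewrite ltNge; apply/negP.
  have -> : gain R kappa * c - n%:R^-1 * (U + c * sz n) =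
    c * (gain R kappa - sz n / n%:R) - U / n%:R by field; rewrite lt0r_neq0.
  apply: le_trans (ler_normB _ _) _; rewrite normrM [leRHS]splitr lerD//.
  rewrite normrM normfV (ger0_norm (ltW nR0)).
  apply: le_trans (_ : e' * sz n / n%:R <= _).
    by rewrite ler_wpM2r ?invr_ge0 ?(ltW nR0)// ltW.
  rewrite -mulrA; apply: le_trans (ler_wpM2l (ltW e'0) H2) _.
  by rewrite /e' divfK ?lt0r_neq0 ?addr_gt0//; lra.
apply/likely_compl.
  by move=> n; case: ifP => // _; apply: measurableI => //; exact: measurableC.
apply: cvg_trans (concentration hkappa herg mf mg hreg hM0 mG PrG Grun ch hB e'0).
apply: near_eq_cvg; near=> n.
have -> : (n < N)%N = false by apply/negbTE; rewrite -leqNgt; near: n; exact: nbhs_infty_ge.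
rewrite -/(dev n) (_ : ~` (G `&` ~` dev n) = (G `&` dev n) `|` ~` G).
  congr fine; apply/esym/measureU0 => //; [exact: measurableI|exact: measurableC].
apply/seteqP; split=> w.
  rewrite setCI setCK => -[nG|D]; first by right.
  by case: (pselect (G w)) => ?; [left|right].
by move=> [[_ D]|nG] [Gw ndev]; [apply: ndev|apply: nG].
Unshelve. all: by end_near. Qed.
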